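(* Let $K\subseteq\mathbb{C}^d$ be a compact convex set with at least $3$ extreme points. Then there is a tuple $A\in\mathcal{B}(H)^d$, for some Hilbert space $H$, such that $\mathcal{W}(A)=\mathcal{W}^{\min}(K)$, $A$ has no nontrivial normal summands, and any summand $B$ of $A$ such that $\mathcal{W}(B)=\mathcal{W}(A)$ has the property that $B$ is not minimal for its matrix range.
   Context: Let $\mathcal{M}^d=\bigcup_{n\ge1}M_n^d$, where $M_n^d$ is the set of $d$-tuples of complex $n\times n$ matrices. UCP means unital completely positive. For $T\in\mathcal{B}(H)^d$, the matrix range is $\mathcal{W}(T)=\bigcup_n\mathcal{W}_n(T)$, where $\mathcal{W}_n(T)=\{(\psi(T_1),\ldots,\psi(T_d)):\psi:\mathcal{B}(H)\to M_n\text{ UCP}\}$. A tuple of operators is normal if its members are normal and commute with each other; $\sigma(N)$ denotes the joint spectrum of a normal tuple. $Y\in\mathcal{B}(L)^d$ is a dilation of $X\in\mathcal{B}(H)^d$ if there is an isometry $V:H\to L$ with $X_i=V^*Y_iV$ for all $i$. For a compact convex set $K\subseteq\mathbb{C}^d$, $\mathcal{W}^{\min}(K)$ is the set of $X\in\mathcal{M}^d$ having a normal dilation $N$ with $\sigma(N)\subseteq K$. A summand of $A$ is the restriction of $A$ to a (joint) reducing subspace, possibly all of $H$; it is nontrivial if the subspace is nonzero. A tuple $T\in\mathcal{B}(H)^d$ is minimal (for its matrix range) if the restriction of $T$ to any proper reducing subspace has strictly smaller matrix range. *)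

(* Defs.v *)
From HB Require Import structures.
From mathcomp Require Import all_boot all_order all_algebra.
From mathcomp Require Import sesquilinear complex.
From mathcomp Require Import all_classical all_reals topology normedtype convex.

Set Implicit Arguments.
Unset Strict Implicit.
Unset Printing Implicit Defensive.

Import Order.TTheory GRing.Theory Num.Theory.
Import numFieldNormedType.Exports.

Local Open Scope classical_set_scope.
Local Open Scope ring_scope.
Local Open Scope complex_scope.

(* `inner` is linear in its first argument and conjugate-linear in the second.
   With the norm identity, completeness is that of a Hilbert space; H = 0 is
   allowed. *)
HB.mixin Record CompleteNormedModule_isHilbert (R : realType) H
    & CompleteNormedModule R[i] H := {
  inner : {dot H for (@Num.conj R[i])};
  sqr_normE : forall x : H, `|x| ^+ 2 = inner x x
}.

#[short(type="hilbertType")]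
HB.structure Definition Hilbert (R : realType) :=
  {H of CompleteNormedModule R[i] H & CompleteNormedModule_isHilbert R H}.

Section BoundedOperators.
Variables (R : realType) (H : hilbertType R).

Definition bounded_linear : {pred H -> H} :=
  fun f => `[< linear f /\ continuous f >].

Lemma bounded_linearP f :
  reflect (linear f /\ continuous f) (f \in bounded_linear).
Proof. exact: asboolP. Qed.

Fact bounded_linear_closed : submod_closed bounded_linear.
Proof.
split=> [|a f g /bounded_linearP[lf cf] /bounded_linearP[lg cg]].
  apply/bounded_linearP; split=> [b x y|x]; last exact: cst_continuous.
  by rewrite /= scaler0 addr0.
apply/bounded_linearP; split=> [b x y|x].
  by rewrite /= !fctE lf lg !scalerDr !scalerA mulrC addrACA.
by apply: continuousD; [apply: continuousZr; exact: cf|exact: cg].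
Qed.

HB.instance Definition _ :=
  GRing.isSubmodClosed.Build _ _ bounded_linear bounded_linear_closed.

Record bop := Bop { bop_fun :> H -> H; _ : bop_fun \in bounded_linear }.

HB.instance Definition _ := [isSub for bop_fun].
HB.instance Definition _ := [Choice of bop by <:].
HB.instance Definition _ := [SubChoice_isSubLmodule of bop by <:].

Lemma bop_linear (T : bop) : linear T.
Proof. by case/bounded_linearP: (valP T). Qed.

Lemma bop_continuous (T : bop) : continuous T.
Proof. by case/bounded_linearP: (valP T). Qed.

Fact bop1_subproof : id \in bounded_linear.
Proof. by apply/bounded_linearP; split=> // x; exact: cvg_id. Qed.

Definition bop1 : bop := Bop bop1_subproof.

Fact bopM_subproof (S T : bop) : S \o T \in bounded_linear.
Proof.
apply/bounded_linearP; split=> [a x y|x] /=.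
  by rewrite !bop_linear.
by apply: continuous_comp; exact: bop_continuous.
Qed.

Definition bopM (S T : bop) : bop := Bop (bopM_subproof S T).

(* T = S^* *)
Definition is_adjoint (S T : bop) := forall x y, inner (S x) y = inner x (T y).

Definition normal (T : bop) :=
  exists2 S, is_adjoint T S & bopM T S = bopM S T.

(* The closure of A in the operator norm is contained in A: the bound in e
   says that the operator norm of T - S is at most e. *)
Definition norm_closed (A : set bop) := forall T : bop,
  (forall e : R[i], 0 < e ->
    exists2 S, A S & forall x, `|T x - S x| <= e * `|x|) -> A T.

Definition unital_Cstar_subalgebra (A : set bop) :=
  [/\ A bop1,
      (forall (a : R[i]) S T, A S -> A T -> A (a *: S + T)),
      (forall S T, A S -> A T -> A (bopM S T)),
      (forall S T, is_adjoint S T -> A S -> A T) &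
      norm_closed A].

End BoundedOperators.

Notation "''B' ( H )" := (bop H) (at level 0, format "''B' ( H )").

Section Tuples.
Variables (R : realType) (d : nat) (H : hilbertType R).
Implicit Types N : 'I_d -> 'B(H).

Definition normal_tuple N :=
  (forall i, normal (N i)) /\ (forall i j, bopM (N i) (N j) = bopM (N j) (N i)).

Definition Cstar N : set 'B(H) :=
  \bigcap_(A in [set A | unital_Cstar_subalgebra A /\ forall i, A (N i)]) A.

(* Only the values of chi on A matter. *)
Definition character (A : set 'B(H)) (chi : 'B(H) -> R[i]) :=
  [/\ chi (bop1 H) = 1,
      (forall a S T, A S -> A T -> chi (a *: S + T) = a * chi S + chi T) &
      (forall S T, A S -> A T -> chi (bopM S T) = chi S * chi T)].

(* Gelfand spectrum of C^*(1, N_1, ..., N_d), embedded in C^d by evaluation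
   at N_1, ..., N_d. *)
Definition joint_spectrum N : set 'rV[R[i]^o]_d :=
  [set l | exists2 chi, character (Cstar N) chi & forall i, l 0 i = chi (N i)].

End Tuples.

Section MatrixRange.
Variables (R : realType) (d : nat).
Local Notation C := R[i].

(* The component of index n consists of the tuples of matrices of size n.+1. *)
Definition matrix_tuples := {n : nat & 'I_d -> 'M[C]_n.+1}.

Definition cdot n (x y : 'cV[C]_n) : C := \sum_i x i 0 * (y i 0)^*%C.

(* Positivity in M_k(B(H)) = B(H^k) and in M_k(M_n) = B((C^n)^k). *)
Definition bop_mx_positive (H : hilbertType R) k (T : 'I_k -> 'I_k -> 'B(H)) :=
  forall x : 'I_k -> H, 0 <= \sum_i \sum_j inner (T i j (x j)) (x i).

Definition mx_mx_positive n k (T : 'I_k -> 'I_k -> 'M[C]_n) :=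
  forall x : 'I_k -> 'cV[C]_n, 0 <= \sum_i \sum_j cdot (T i j *m x j) (x i).

Definition ucp (H : hilbertType R) n (psi : {linear 'B(H) -> 'M[C]_n}) :=
  psi (bop1 H) = 1%:M /\
  forall k (T : 'I_k -> 'I_k -> 'B(H)),
    bop_mx_positive T -> mx_mx_positive (fun i j => psi (T i j)).

Definition matrix_range (H : hilbertType R) (T : 'I_d -> 'B(H)) :
    set matrix_tuples :=
  [set X : matrix_tuples | exists2 psi : {linear 'B(H) -> 'M[C]_((tag X).+1)},
     ucp psi & forall i, tagged X i = psi (T i)].

(* V is an isometry from C^n, with adjoint W, and X_i = V^* Y_i V. *)
Definition dilation (L : hilbertType R) (Y : 'I_d -> 'B(L)) n
    (X : 'I_d -> 'M[C]_n) :=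
  exists (V : {linear 'cV[C]_n -> L}) (W : L -> 'cV[C]_n),
    [/\ (forall x, `|V x| ^+ 2 = cdot x x),
        (forall x z, inner (V x) z = cdot x (W z)) &
        forall i x, X i *m x = W (Y i (V x))].

Definition Wmin (K : set 'rV[C^o]_d) : set matrix_tuples :=
  [set X : matrix_tuples | exists (L : hilbertType R) (N : 'I_d -> 'B(L)),
     [/\ normal_tuple N, joint_spectrum N `<=` K & dilation N (tagged X)]].

End MatrixRange.

Section Subspaces.
Variables (R : realType) (H : hilbertType R).

Record closedSubspace := ClosedSubspace {
  csub_set :> set H;
  csub0 : csub_set 0;
  csubP : forall (a : R[i]) x y,
    csub_set x -> csub_set y -> csub_set (a *: x + y);
  csub_closed : closed csub_set
}.

Definition orthogonal_complement (M : set H) : set H :=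
  [set x | forall y, M y -> inner x y = 0].

Section SubHilbert.
Variable M : closedSubspace.

Definition csub_pred : {pred H} := fun x => `[< csub_set M x >].

Fact csub_submod_closed : submod_closed csub_pred.
Proof.
split=> [|a x y /asboolP Mx /asboolP My]; apply/asboolP; first exact: csub0.
exact: csubP.
Qed.

HB.instance Definition _ :=
  GRing.isSubmodClosed.Build _ _ csub_pred csub_submod_closed.

Record subspace_type := Subsp { subsp_val :> H; _ : subsp_val \in csub_pred }.

HB.instance Definition _ := [isSub for subsp_val].
HB.instance Definition _ := [Choice of subspace_type by <:].
HB.instance Definition _ := [SubChoice_isSubLmodule of subspace_type by <:].

Let norm (x : subspace_type) : R[i] := `|val x|.

Let norm_triangle x y : norm (x + y) <= norm x + norm y.
Proof. by rewrite /norm raddfD ler_normD. Qed.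

Let normZ (l : R[i]) x : norm (l *: x) = `|l| * norm x.
Proof. by rewrite /norm linearZ normrZ. Qed.

Let norm0_eq0 x : norm x = 0 -> x = 0.
Proof. by move=> /normr0_eq0 x0; apply: val_inj; rewrite x0 raddf0. Qed.

HB.instance Definition _ := @Lmodule_isNormed.Build R[i] subspace_type
  norm norm_triangle normZ norm0_eq0.

Lemma subspace_valB (x y : subspace_type) : val (x - y) = val x - val y.
Proof. exact: raddfB. Qed.

Lemma subspace_valP (a : R[i]) (x y : subspace_type) :
  val (a *: x + y) = a *: val x + val y.
Proof. exact: linearP. Qed.

Lemma subspace_normE (x : subspace_type) : `|x| = `|val x|.
Proof. by []. Qed.

Fact subspace_complete (F : set_system subspace_type) :
  ProperFilter F -> cauchy F -> cvg F.
Proof.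
move=> FF Fc.
have Gc : cauchy (val @ F).
  apply: (@cauchy_exP R[i] H) => e e0.
  have [x Fx] := (@cauchyP R[i] subspace_type F FF).1 Fc e e0.
  exists (val x); apply: (@filterS _ F _ (ball x e)) Fx => y.
  by rewrite /preimage /= -!ball_normE /ball_ /= -subspace_valB.
have /cvg_ex[l Gl] : cvg (val @ F) by exact: cauchy_cvg.
have Ml : l \in csub_pred.
  apply/asboolP.
  apply: (@closed_cvg _ _ F _ val (csub_set M) (@csub_closed M) _ l Gl).
  by apply: filterE; case=> x /= /asboolP.
apply/cvg_ex; exists (Subsp Ml); apply/cvgrPdist_lt => e e0.
move/cvgrPdist_lt: Gl => /(_ e e0); apply: filterS => x.
by rewrite subspace_normE subspace_valB.
Qed.

HB.instance Definition _ :=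
  Uniform_isComplete.Build subspace_type subspace_complete.

Definition subspace_inner (x y : subspace_type) : R[i] :=
  inner (val x) (val y).

Fact subspace_inner_bilinear :
  bilinear_for (GRing.Scale.Law.clone _ _ *%R _)
    (GRing.Scale.Law.clone _ _ ((@Num.conj R[i]) \; *%R) _) subspace_inner.
Proof.
by split=> z a x y; rewrite /subspace_inner subspace_valP ?linearPl ?linearPr.
Qed.

HB.instance Definition _ := bilinear_isBilinear.Build _ _ _ _
  (GRing.Scale.Law.clone _ _ *%R _)
  (GRing.Scale.Law.clone _ _ ((@Num.conj R[i]) \; *%R) _)
  subspace_inner subspace_inner_bilinear.

Fact subspace_inner_hermitian x y :
  subspace_inner x y = (-1) ^+ false * Num.conj (subspace_inner y x).
Proof. exact: hermitian_subproof. Qed.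

HB.instance Definition _ := isHermitianSesquilinear.Build _ _ _ _
  subspace_inner subspace_inner_hermitian.

Fact subspace_inner_gt0 x : x != 0 -> 0 < subspace_inner x x.
Proof.
by move=> x0; apply: neq0_dnorm_gt0; rewrite raddf_eq0 //; exact: val_inj.
Qed.

HB.instance Definition _ := isDotProduct.Build _ _
  subspace_inner subspace_inner_gt0.

Fact subspace_sqr_normE (x : subspace_type) : `|x| ^+ 2 = subspace_inner x x.
Proof. by rewrite subspace_normE sqr_normE. Qed.

HB.instance Definition _ :=
  CompleteNormedModule_isHilbert.Build R subspace_type subspace_sqr_normE.

End SubHilbert.
End Subspaces.

Section Summands.
Variables (R : realType) (d : nat).

(* Invariance of the orthogonal complement under T_i is invariance of M under
   T_i^*. *)
Definition reducing (H : hilbertType R) (T : 'I_d -> 'B(H))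
    (M : closedSubspace H) :=
  forall i, (forall x, csub_set M x -> csub_set M (T i x)) /\
    (forall x, orthogonal_complement M x -> orthogonal_complement M (T i x)).

Section Restriction.
Variables (H : hilbertType R) (T : 'I_d -> 'B(H)) (M : closedSubspace H).
Hypothesis redTM : reducing T M.

Fact restr_fun_subproof i (x : subspace_type M) : T i (val x) \in csub_pred M.
Proof.
by case: x => x /= /asboolP Mx; apply/asboolP; exact: (redTM i).1.
Qed.

Definition restr_fun i (x : subspace_type M) : subspace_type M :=
  Subsp (restr_fun_subproof i x).

Fact restr_subproof i : restr_fun i \in @bounded_linear R (subspace_type M).
Proof.
apply/bounded_linearP; split=> [a x y|x].
  by apply: val_inj;
     rewrite subspace_valP -[LHS]/(T i (val _)) subspace_valP bop_linear.
have vc : continuous (val : subspace_type M -> H).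
  move=> y; apply/(@cvgrPdist_lt _ _ _ (nbhs y) (nbhs_filter y)) => e e0.
  by apply/(@nbhs_normP _ (subspace_type M)); exists e.
have /(@cvgrPdist_lt _ _ _ (nbhs x) (nbhs_filter x)) Tx :
    T i (val z) @[z --> x] --> T i (val x).
  exact: (continuous_comp (vc x) (@bop_continuous _ _ (T i) _)).
apply/(@cvgrPdist_lt _ _ _ (nbhs x) (nbhs_filter x)) => e e0.
apply: (@filterS _ (nbhs x) (nbhs_filter x)) (Tx e e0) => z.
by rewrite subspace_normE subspace_valB.
Qed.

Definition restr i : 'B(subspace_type M) := Bop (restr_subproof i).

End Restriction.

Definition minimal (H : hilbertType R) (T : 'I_d -> 'B(H)) :=
  forall (M : closedSubspace H) (redTM : reducing T M),
    (M : set H) != setT -> matrix_range (restr redTM) `<` matrix_range T.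

End Summands.

Definition extreme_points (R : realType) d (K : set 'rV[R[i]^o]_d) :
    set 'rV[R[i]^o]_d :=
  [set x | K x /\ forall y z (t : R), K y -> K z -> 0 < t < 1 ->
     x = t%:C *: y + (1 - t)%:C *: z -> y = x /\ z = x].

(* Main.v *)
(* Membership in [Wmin K] has a dual description: by Caratheodory and a
   separation argument in [R^N], [X] lies in [Wmin K] as soon as every matrix
   pencil that is nonpositive on [K] is nonpositive at [X] (then
   [X_i = \sum_j mu_j,i v_j v_j^*] with [mu_j] in [K], which dilates to a
   diagonal tuple).  Conversely, Fuglede's theorem and joint approximate
   eigenvectors show that a normal tuple with spectrum in [K] satisfies all
   these pencils.

   The tuple [A] acts on [l^2] as a direct sum of 2x2 blocks
     (1 - 2 eps_n) diag(s_n, y_n) + eps_n (e_2 P_+ + e_3 P_-) + eps_n c I,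
   where [P_+], [P_-] project onto the span of (1, 1) and of (1, -1), [s] is dense
   in [K], [c] is in the relative interior of [K], e_1, e_2, e_3 are extreme points
   of [K], and [y_n] is whichever of e_1, e_3 is far from [s_n] for a real functional
   [alpha_1] that agrees at e_2 and e_3 but not at e_1; let [alpha_2] separate e_2
   from e_3.  Every block is a compression of a normal tuple with spectrum in
   [K], and since [eps_n -> 0] the numerical range of [A] is dense in [K]; so
   [W(A) = Wmin K].  The real part of [alpha_1(A)] is diagonal, that of
   [alpha_2(A)] is not, and the square of their commutator is scalar on each block
   with a different value on each.  Hence a reducing subspace is a sum of blocks,
   and none of these is normal.  Because of the term [eps_n c], no single block
   touches a face of [K], so that removing a block from a summand with the full
   matrix range leaves the range unchanged. *)
Require Import Defs.
From HB Require Import structures.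
From mathcomp Require Import all_boot all_order all_algebra.
From mathcomp Require Import sesquilinear complex.
From mathcomp Require Import all_classical all_reals topology normedtype convex.
From mathcomp Require Import ring lra zify.
From mathcomp Require cyclic separable cyclotomic.

Set Implicit Arguments.
Unset Strict Implicit.
Unset Printing Implicit Defensive.

Import Order.TTheory GRing.Theory Num.Theory.
Import numFieldNormedType.Exports.

Local Open Scope classical_set_scope.
Local Open Scope ring_scope.
Local Open Scope complex_scope.
Local Open Scope card_scope.
Local Notation Re := complex.Re.
Local Notation Im := complex.Im.
Local Notation "x ^*" := (conjc x) : ring_scope.

(** * Complex numbers, inner products and bounded operators *)

(** Pencils take the place of two known theorems: no normal dilation of [A] is built to place its
    matrix range in [Wmin K], and no completely positive map is extended for the converse inclusion.
    [Wmin K] is generated by its first level, so a matrix range contains it as soon as the numerical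
    range has at least the support function of [K]. This is why only scalar functionals occur when a
    block is removed.

    With two extreme points [K] would be a segment and [A] an affine function of one self-adjoint
    operator, hence normal. The third extreme point makes room for two real functionals of [A] that
    fail to commute.

    The weights eps_n shrink by the factor 4(G + 1) from one block to the next, where G bounds the
    oscillation of alpha_1 on [K]. The gap between the two diagonal entries of alpha_1(A) in a block
    lies between 1/4 and G; the factor outweighs this variation and so keeps the commutators of
    different blocks apart.

    The removal of a block exploits a gap between the value of a functional at c and its maximum on
    [K]. A functional without such a gap is constant on [K] and needs a separate argument. *)

Section ComplexParts.
Variable R : realType.
Implicit Types a b : R[i].

(** The norm of [R[i]] takes its values in [R[i]]; real-valued substitutes keep the estimates within
    reach of [lra] and [nra]. *)
Definition csq a : R := Re a ^+ 2 + Im a ^+ 2.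
Definition cabs a : R := Num.sqrt (csq a).

Lemma ReD a b : Re (a + b) = Re a + Re b.
Proof. by case: a b => ? ? []. Qed.
Lemma ImD a b : Im (a + b) = Im a + Im b.
Proof. by case: a b => ? ? []. Qed.
Lemma ReN a : Re (- a) = - Re a.
Proof. by case: a. Qed.
Lemma ImN a : Im (- a) = - Im a.
Proof. by case: a. Qed.
Lemma ReB a b : Re (a - b) = Re a - Re b.
Proof. by rewrite ReD ReN. Qed.
Lemma ImB a b : Im (a - b) = Im a - Im b.
Proof. by rewrite ImD ImN. Qed.
Lemma ReM a b : Re (a * b) = Re a * Re b - Im a * Im b.
Proof. by case: a b => ? ? []. Qed.
Lemma ImM a b : Im (a * b) = Re a * Im b + Im a * Re b.
Proof. by case: a b => ? ? []. Qed.
Lemma ReMr (r : R) b : Re (r%:C * b) = r * Re b.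
Proof. by rewrite ReM /= mul0r subr0. Qed.
Lemma ImMr (r : R) b : Im (r%:C * b) = r * Im b.
Proof. by rewrite ImM /= mul0r addr0. Qed.
Lemma ReJ a : Re a^* = Re a.
Proof. by case: a. Qed.
Lemma ImJ a : Im a^* = - Im a.
Proof. by case: a. Qed.
Lemma Re_sum I (r : seq I) (P : pred I) (F : I -> R[i]) :
  Re (\sum_(i <- r | P i) F i) = \sum_(i <- r | P i) Re (F i).
Proof. by apply: (big_morph (@complex.Re R) ReD). Qed.
Lemma Im_sum I (r : seq I) (P : pred I) (F : I -> R[i]) :
  Im (\sum_(i <- r | P i) F i) = \sum_(i <- r | P i) Im (F i).
Proof. by apply: (big_morph (@complex.Im R) ImD). Qed.
Lemma complex_ext a b : Re a = Re b -> Im a = Im b -> a = b.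
Proof. by case: a b => ? ? [? ?] /= -> ->. Qed.

Lemma csq_ge0 a : 0 <= csq a. Proof. by rewrite addr_ge0 ?sqr_ge0. Qed.
Lemma csqM a b : csq (a * b) = csq a * csq b.
Proof. rewrite /csq ReM ImM; ring. Qed.
Lemma csqJ a : csq a^* = csq a.
Proof. by rewrite /csq ReJ ImJ sqrrN. Qed.
Lemma csqN a : csq (- a) = csq a.
Proof. by rewrite /csq ReN ImN !sqrrN. Qed.
Lemma csqr (r : R) : csq r%:C = r ^+ 2.
Proof. by rewrite /csq /= expr0n addr0. Qed.
Lemma csq1 : csq (1 : R[i]) = 1.
Proof. by rewrite /csq /= expr1n expr0n addr0. Qed.
Lemma mulcJ a : a * a^* = (csq a)%:C.
Proof. by apply: complex_ext; rewrite ?ReM ?ImM ReJ ImJ /csq /=; ring. Qed.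
Lemma csq_eq0 a : (csq a == 0) = (a == 0).
Proof.
rewrite paddr_eq0 ?sqr_ge0 // !sqrf_eq0; apply/andP/eqP => [[/eqP ra /eqP ia]|->//].
exact: complex_ext.
Qed.

Lemma cabs_ge0 a : 0 <= cabs a. Proof. exact: sqrtr_ge0. Qed.
Lemma cabsM a b : cabs (a * b) = cabs a * cabs b.
Proof. by rewrite /cabs csqM sqrtrM ?csq_ge0. Qed.
Lemma cabsJ a : cabs a^* = cabs a. Proof. by rewrite /cabs csqJ. Qed.
Lemma cabsN a : cabs (- a) = cabs a. Proof. by rewrite /cabs csqN. Qed.
Lemma cabsr (r : R) : cabs r%:C = `|r|.
Proof. by rewrite /cabs csqr sqrtr_sqr. Qed.
Lemma sqr_cabs a : cabs a ^+ 2 = csq a.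
Proof. by rewrite sqr_sqrtr ?csq_ge0. Qed.
Lemma norm_cabs a : `|a| = (cabs a)%:C.
Proof. by rewrite normc_def. Qed.
Lemma cabs_eq0 a : (cabs a == 0) = (a == 0).
Proof. by rewrite -[LHS](inj_eq (@complexI R)) -norm_cabs normr_eq0. Qed.
Lemma cabs0 : cabs 0 = 0. Proof. by apply/eqP; rewrite cabs_eq0. Qed.
Lemma cabsD a b : cabs (a + b) <= cabs a + cabs b.
Proof. by rewrite -lecR rmorphD /= -!norm_cabs ler_normD. Qed.
Lemma cabs_sum I (r : seq I) (P : pred I) (F : I -> R[i]) :
  cabs (\sum_(i <- r | P i) F i) <= \sum_(i <- r | P i) cabs (F i).
Proof.
elim/big_ind2 : _ => [|x x' y y' hx hy|//]; first by rewrite cabs0.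
by apply: le_trans (cabsD _ _) _; exact: lerD.
Qed.
Lemma Re_le_cabs a : `|Re a| <= cabs a.
Proof.
by rewrite -(@ler_pXn2r _ 2) ?nnegrE ?cabs_ge0 // sqr_cabs real_normK ?num_real // lerDl sqr_ge0.
Qed.
Lemma Im_le_cabs a : `|Im a| <= cabs a.
Proof.
by rewrite -(@ler_pXn2r _ 2) ?nnegrE ?cabs_ge0 // sqr_cabs real_normK ?num_real // lerDr sqr_ge0.
Qed.
Lemma cabs_le_ReIm a : cabs a <= `|Re a| + `|Im a|.
Proof.
rewrite -(@ler_pXn2r _ 2) ?nnegrE ?cabs_ge0 ?addr_ge0 // sqr_cabs sqrrD !real_normK ?num_real //.
by rewrite /csq -addrA lerD2l lerDr mulrn_wge0 // mulr_ge0.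
Qed.
Lemma cabsB a b : cabs (a - b) = cabs (b - a).
Proof. by rewrite -cabsN opprB. Qed.
Lemma conjc_sum I (r : seq I) (P : pred I) (F : I -> R[i]) :
  (\sum_(i <- r | P i) F i)^* = \sum_(i <- r | P i) (F i)^*.
Proof. exact: rmorph_sum. Qed.
Lemma conjcM a b : (a * b)^* = a^* * b^*. Proof. exact: rmorphM. Qed.
Lemma conjcD a b : (a + b)^* = a^* + b^*. Proof. exact: rmorphD. Qed.
Lemma conjcN a : (- a)^* = - a^*. Proof. exact: rmorphN. Qed.
End ComplexParts.

(** * Positive semidefinite Hermitian forms *)

Section HermitianForm.
Variables (R : realType) (V : lmodType R[i]) (F : V -> V -> R[i]).
Hypothesis FP : forall a x y z, F (a *: x + y) z = a * F x z + F y z.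
Hypothesis FJ : forall x y, F y x = (F x y)^*.
Hypothesis F_ge0 : forall x, 0 <= Re (F x x).

Lemma formDl x y z : F (x + y) z = F x z + F y z.
Proof. by rewrite -[x]scale1r FP scale1r mul1r. Qed.
Lemma form0l z : F 0 z = 0.
Proof. by apply: (@addrI _ (F 0 z)); rewrite -formDl !addr0. Qed.
Lemma formZl a x z : F (a *: x) z = a * F x z.
Proof. by rewrite -[_ *: x]addr0 FP form0l addr0. Qed.
Lemma formDr x y z : F z (x + y) = F z x + F z y.
Proof. by rewrite FJ formDl conjcD -!FJ. Qed.
Lemma formZr a x z : F z (a *: x) = a^* * F z x.
Proof. by rewrite FJ formZl conjcM -FJ. Qed.
Lemma form_self x : F x x = (Re (F x x))%:C.
Proof.
apply: complex_ext => //=; have := congr1 (@complex.Im R) (FJ x x).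
by rewrite ImJ => h; lra.
Qed.
Lemma form_sqD x y : Re (F (x + y) (x + y)) = Re (F x x) + Re (F y y) + 2 * Re (F x y).
Proof. rewrite formDl !formDr !ReD (FJ x y) ReJ; ring. Qed.
Lemma form_sqZ a x : Re (F (a *: x) (a *: x)) = csq a * Re (F x x).
Proof. by rewrite formZl formZr mulrA mulcJ ReMr. Qed.

(** Semidefiniteness allows [q = 0]; there [key] is affine in [t] and forces [w = 0]. Otherwise
    [t = 1 / q] is optimal. *)
Lemma form_cauchy_schwarz x y : csq (F x y) <= Re (F x x) * Re (F y y).
Proof.
set q := Re (F y y); set w := F x y; set p := Re (F x x).
have key (t : R) : 0 <= p - 2 * t * csq w + t ^+ 2 * csq w * q.
  have := F_ge0 (x + (- t%:C * w) *: y).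
  rewrite form_sqD form_sqZ formZr -/w -/p -/q csqM csqN csqr.
  rewrite conjcM conjcN conjc_real -(mulrA (- t%:C)) (mulrC w^*) mulcJ mulNr ReN ReMr /= => h.
  by apply: le_trans h _; rewrite le_eqVlt; apply/orP; left; apply/eqP; ring.
have w0 := csq_ge0 w; have p0 : 0 <= p := F_ge0 x; have q0 : 0 <= q := F_ge0 y.
have [qz|nq] := eqVneq q 0.
  rewrite qz mulr0 leNgt; apply/negP => wp.
  have := key ((p + 1) / (2 * csq w)); rewrite qz mulr0 addr0.
  have -> : 2 * ((p + 1) / (2 * csq w)) * csq w = p + 1 by field; rewrite lt0r_neq0.
  by rewrite opprD addrA subrr add0r oppr_ge0 ler10.
have qp : 0 < q by rewrite lt_def nq.
have := key q^-1.
have -> : p - 2 * q^-1 * csq w + q^-1 ^+ 2 * csq w * q = p - csq w / q by field.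
by rewrite subr_ge0 ler_pdivrMr.
Qed.

Lemma form_triangle x y : Num.sqrt (Re (F (x + y) (x + y))) <=
  Num.sqrt (Re (F x x)) + Num.sqrt (Re (F y y)).
Proof.
rewrite -(@ler_pXn2r _ 2) ?nnegrE ?addr_ge0 ?sqrtr_ge0 // sqrrD !sqr_sqrtr ?F_ge0 //.
rewrite form_sqD addrAC lerD2r lerD2l mulr_natl lerMn2r /=.
rewrite -sqrtrM ?F_ge0 //; apply: le_trans (ler_norm _) _.
rewrite -sqrtr_sqr ler_wsqrtr //; apply: le_trans (form_cauchy_schwarz x y).
by rewrite /csq lerDl sqr_ge0.
Qed.
End HermitianForm.

Section InnerProduct.
Variables (R : realType) (H : hilbertType R).
Implicit Types (x y z : H) (a : R[i]).

Definition nsq x : R := Re (inner x x).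
Definition nrm x : R := Num.sqrt (nsq x).
Definition rip x y : R := Re (inner x y).

Lemma innerJ x y : inner y x = (inner x y)^*.
Proof. by rewrite hermC expr0 mul1r. Qed.
Lemma innerDl x y z : inner (x + y) z = inner x z + inner y z.
Proof. exact: linearDl. Qed.
Lemma innerDr x y z : inner z (x + y) = inner z x + inner z y.
Proof. exact: linearDr. Qed.
Lemma innerNl x z : inner (- x) z = - inner x z.
Proof. exact: linearNl. Qed.
Lemma innerNr x z : inner z (- x) = - inner z x.
Proof. exact: linearNr. Qed.
Lemma innerBl x y z : inner (x - y) z = inner x z - inner y z.
Proof. by rewrite innerDl innerNl. Qed.
Lemma innerBr x y z : inner z (x - y) = inner z x - inner z y.
Proof. by rewrite innerDr innerNr. Qed.
Lemma innerZl a x z : inner (a *: x) z = a * inner x z.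
Proof. exact: linearZl_LR. Qed.
Lemma innerZr a x z : inner z (a *: x) = a^* * inner z x.
Proof. exact: linearZr_LR. Qed.
Lemma inner0l z : inner 0 z = 0. Proof. exact: linear0l. Qed.
Lemma inner0r z : inner z 0 = 0. Proof. exact: linear0r. Qed.
Lemma inner_suml I (r : seq I) (P : pred I) (F : I -> H) z :
  inner (\sum_(i <- r | P i) F i) z = \sum_(i <- r | P i) inner (F i) z.
Proof. exact: linear_sumlz. Qed.
Lemma inner_sumr I (r : seq I) (P : pred I) (F : I -> H) z :
  inner z (\sum_(i <- r | P i) F i) = \sum_(i <- r | P i) inner z (F i).
Proof. exact: linear_sumr. Qed.

Lemma inner_self x : inner x x = (nsq x)%:C.
Proof. by rewrite /nsq RRe_real // ger0_real // -sqr_normE exprn_ge0. Qed.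
Lemma nsq_ge0 x : 0 <= nsq x.
Proof. by rewrite -ler0c -inner_self -sqr_normE exprn_ge0. Qed.
Lemma norm_nrm x : `|x| = (nrm x)%:C.
Proof.
apply/eqP; rewrite -(@eqrXn2 _ 2) ?normr_ge0 ?ler0c ?sqrtr_ge0 //.
by rewrite sqr_normE inner_self -rmorphXn /= sqr_sqrtr // nsq_ge0.
Qed.
Lemma nrm_ge0 x : 0 <= nrm x. Proof. exact: sqrtr_ge0. Qed.
Lemma sqr_nrm x : nrm x ^+ 2 = nsq x.
Proof. by rewrite sqr_sqrtr ?nsq_ge0. Qed.
Lemma nrm_eq0 x : (nrm x == 0) = (x == 0).
Proof. by rewrite -[LHS](inj_eq (@complexI R)) -norm_nrm normr_eq0. Qed.
Lemma nsq_eq0 x : (nsq x == 0) = (x == 0).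
Proof. by rewrite -sqr_nrm sqrf_eq0 nrm_eq0. Qed.
Lemma nsq_gt0 x : (0 < nsq x) = (x != 0).
Proof. by rewrite lt_def nsq_ge0 andbT nsq_eq0. Qed.
Lemma nsq0 : nsq 0 = 0. Proof. by apply/eqP; rewrite nsq_eq0. Qed.
Lemma nrm0 : nrm 0 = 0. Proof. by apply/eqP; rewrite nrm_eq0. Qed.
Lemma nsqZ a x : nsq (a *: x) = csq a * nsq x.
Proof.
by rewrite /nsq innerZl innerZr mulrA mulcJ ReMr.
Qed.
Lemma nrmZ a x : nrm (a *: x) = cabs a * nrm x.
Proof. by rewrite /nrm nsqZ sqrtrM ?csq_ge0. Qed.
Lemma nsqN x : nsq (- x) = nsq x.
Proof. by rewrite /nsq innerNl innerNr opprK. Qed.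
Lemma nrmN x : nrm (- x) = nrm x.
Proof. by rewrite /nrm nsqN. Qed.
Lemma nrmD x y : nrm (x + y) <= nrm x + nrm y.
Proof. by rewrite -lecR rmorphD /= -!norm_nrm ler_normD. Qed.
Lemma nrm_sum I (r : seq I) (P : pred I) (F : I -> H) :
  nrm (\sum_(i <- r | P i) F i) <= \sum_(i <- r | P i) nrm (F i).
Proof.
elim/big_ind2 : _ => [|x x' y y' hx hy|//]; first by rewrite nrm0.
by apply: le_trans (nrmD _ _) _; exact: lerD.
Qed.
Lemma ripC x y : rip x y = rip y x.
Proof. by rewrite /rip innerJ ReJ. Qed.
Lemma nsqD x y : nsq (x + y) = nsq x + nsq y + 2 * rip x y.
Proof.
rewrite /nsq innerDl !innerDr !ReD -/(rip x y) -/(rip y x) (ripC y x); ring.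
Qed.
Lemma nsqB x y : nsq (x - y) = nsq x + nsq y - 2 * rip x y.
Proof. by rewrite nsqD nsqN /rip innerNr ReN mulrN. Qed.
Lemma parallelogram x y : nsq (x + y) + nsq (x - y) = 2 * nsq x + 2 * nsq y.
Proof. rewrite nsqD nsqB; ring. Qed.

Lemma cauchy_schwarz_sq x y : csq (inner x y) <= nsq x * nsq y.
Proof.
apply: form_cauchy_schwarz => [a u v w|u v|u]; last exact: nsq_ge0.
  by rewrite innerDl innerZl.
exact: innerJ.
Qed.
Lemma cauchy_schwarz x y : cabs (inner x y) <= nrm x * nrm y.
Proof.
rewrite -(@ler_pXn2r _ 2) ?nnegrE ?cabs_ge0 ?mulr_ge0 ?nrm_ge0 //.
by rewrite sqr_cabs exprMn !sqr_nrm cauchy_schwarz_sq.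
Qed.
Lemma inner_ext x y : (forall z, inner x z = inner y z) -> x = y.
Proof.
move=> h; apply/eqP; rewrite -subr_eq0 -nsq_eq0 /nsq innerBl.
by rewrite h subrr.
Qed.

Lemma cvg_nrmP (u : nat -> H) l :
  (u @ \oo --> l) <-> forall e : R, 0 < e -> exists N, forall n, (N <= n)%N -> nrm (l - u n) < e.
Proof.
split=> [/cvgrPdist_lt h e e0|h].
  have := h e%:C; rewrite ltcR => /(_ e0) [N _ hN]; exists N => n /hN /=.
  by rewrite norm_nrm ltcR.
apply/cvgrPdist_lt => e e0.
have er : e = (Re e)%:C by rewrite RRe_real // gtr0_real.
have [|N hN] := h (Re e); first by rewrite -ltcR -er.
by exists N => // n /= Nn; rewrite norm_nrm er ltcR; exact: hN.
Qed.

Lemma hilbert_complete (u : nat -> H) :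
  (forall e : R, 0 < e -> exists N, forall m n, (N <= m)%N -> (N <= n)%N -> nrm (u m - u n) < e) ->
  exists l, forall e : R, 0 < e -> exists N, forall n, (N <= n)%N -> nrm (l - u n) < e.
Proof.
move=> h.
have /cvg_ex[l hl] : cvg (u @ \oo).
  apply: cauchy_cvg; apply: cauchy_exP => e e0.
  have er : e = (Re e)%:C by rewrite RRe_real // gtr0_real.
  have [|N hN] := h (Re e); first by rewrite -ltcR -er.
  exists (u N), N => // n /= Nn; rewrite -ball_normE /ball_ /=.
  by rewrite norm_nrm er ltcR; exact: hN.
by exists l; apply/cvg_nrmP.
Qed.

Lemma csub_limit (M : closedSubspace H) x :
  (forall e : R, 0 < e -> exists2 y, csub_set M y & nrm (x - y) < e) -> csub_set M x.
Proof.
move=> h; have Mc := @csub_closed _ _ M.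
apply: Mc => B /(@nbhs_ballP _ H) [e /= e0 eB].
have er : e = (Re e)%:C by rewrite RRe_real // gtr0_real.
have [|y My xy] := h (Re e); first by rewrite -ltcR -er.
exists y; split=> //; apply: eB; rewrite -ball_normE /ball_ /=.
by rewrite norm_nrm er ltcR.
Qed.

Lemma closed_of_limits (A : set H) :
  (forall x, (forall e : R, 0 < e -> exists2 y, A y & nrm (x - y) < e) -> A x) -> closed A.
Proof.
move=> h x Ax; apply: h => e e0.
have /Ax [y [Ay xy]] : nbhs x (ball x e%:C).
  by apply/(@nbhs_ballP _ H); exists e%:C; rewrite /= ?ltcR.
by exists y => //; move: xy; rewrite -ball_normE /ball_ /= norm_nrm ltcR.
Qed.

End InnerProduct.

Section Bop.
Variables (R : realType) (H : hilbertType R).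
Implicit Types (S T : 'B(H)) (x y : H) (a : R[i]).

Lemma bopD T x y : T (x + y) = T x + T y.
Proof. by have := bop_linear T 1 x y; rewrite !scale1r. Qed.
Lemma bop0 T : T 0 = 0.
Proof. by apply: (@addrI _ (T 0)); rewrite -bopD !addr0. Qed.
Lemma bopZ T a x : T (a *: x) = a *: T x.
Proof. by have := bop_linear T a x 0; rewrite bop0 !addr0. Qed.
Lemma bopN T x : T (- x) = - T x.
Proof. by rewrite -scaleN1r bopZ scaleN1r. Qed.
Lemma bopB T x y : T (x - y) = T x - T y.
Proof. by rewrite bopD bopN. Qed.
Lemma bop_sum T I (r : seq I) (P : pred I) (F : I -> H) :
  T (\sum_(i <- r | P i) F i) = \sum_(i <- r | P i) T (F i).
Proof. by apply: (big_morph T (bopD T) (bop0 T)). Qed.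

Lemma bop_ext S T : S =1 T -> S = T.
Proof. by move=> h; apply: val_inj; apply: funext. Qed.
Lemma bop_addE S T x : (S + T) x = S x + T x. Proof. by []. Qed.
Lemma bop_oppE S x : (- S) x = - S x. Proof. by []. Qed.
Lemma bop_subE S T x : (S - T) x = S x - T x. Proof. by []. Qed.
Lemma bop_scaleE a T x : (a *: T) x = a *: T x. Proof. by []. Qed.
Lemma bop_zeroE x : (0 : 'B(H)) x = 0. Proof. by []. Qed.
Lemma bopME S T x : bopM S T x = S (T x). Proof. by []. Qed.
Lemma bop1E x : bop1 H x = x. Proof. by []. Qed.
Lemma bop_sumE I (r : seq I) (P : pred I) (F : I -> 'B(H)) x :
  (\sum_(i <- r | P i) F i) x = \sum_(i <- r | P i) F i x.
Proof. by apply: (big_morph (fun T : 'B(H) => T x)). Qed.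

Lemma bop_bounded T : exists2 M : R, 0 <= M & forall x, nrm (T x) <= M * nrm x.
Proof.
pose f : {linear H -> H} := HB.pack (T : H -> H) (GRing.isLinear.Build _ _ _ _ (T : H -> H) (bop_linear T)).
have /linear_bounded_continuous/linear_boundedP : continuous f by exact: bop_continuous.
case=> M [Mr hM].
have er : M = (Re M)%:C by rewrite RRe_real.
pose N := Num.max 0 (Re M + 1).
exists N; first by rewrite /N le_max lexx.
have : M < N%:C by rewrite er ltcR lt_max ltrDl ltr01 orbT.
move/hM => h x; have := h x; rewrite !norm_nrm -rmorphM /= lecR.
done.
Qed.

Lemma bounded_bop (f : H -> H) (M : R) : linear f ->
  (forall x, nrm (f x) <= M * nrm x) -> f \in @bounded_linear R H.
Proof.
move=> lf bf; apply/bounded_linearP; split=> //.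
pose g : {linear H -> H} := HB.pack f (GRing.isLinear.Build _ _ _ _ f lf).
apply: (linear_bounded_continuous g).1; apply/linear_boundedP.
exists M%:C; split; first by apply/complex_realP; exists M.
move=> r Mr x; rewrite !norm_nrm.
apply: le_trans (_ : (M * nrm x)%:C <= _); first by rewrite lecR.
by rewrite rmorphM ler_wpM2r ?ler0c ?nrm_ge0 // ltW.
Qed.

End Bop.

(** * Ultralimits and adjoints *)

Section UltraLimits.
Variables (R : realType) (T : Type).
Implicit Types (f g : T -> R[i]) (l : R[i]).

Definition ucvg (U : set_system T) f l :=
  forall e : R, 0 < e -> U [set x | cabs (f x - l) < e].

Section Filter.
Variables (U : set_system T).
Context {FU : ProperFilter U}.

Lemma proper_meet (A B : set T) : U A -> U B -> exists x, A x /\ B x.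
Proof. by move=> UA UB; have [x] := filter_ex (filterI UA UB); exists x. Qed.

Lemma ucvg_uniq f l l' : ucvg U f l -> ucvg U f l' -> l = l'.
Proof.
move=> fl fl'; apply/eqP; rewrite -subr_eq0 -cabs_eq0; apply/negPn/negP => h.
have e0 : 0 < cabs (l - l') / 2 by rewrite divr_gt0 // lt_def h cabs_ge0.
have [x [/= h1 h2]] := proper_meet (fl _ e0) (fl' _ e0).
have := cabsD (l - f x) (f x - l'); rewrite subrKA cabsB => h3.
by have := le_lt_trans h3 (ltrD h1 h2); rewrite -splitr ltxx.
Qed.

Lemma ucvg_cst l : ucvg U (fun=> l) l.
Proof. by move=> e e0; apply: filterE => x /=; rewrite subrr cabs0. Qed.

Lemma ucvg_ext f g l : U [set x | f x = g x] -> ucvg U f l -> ucvg U g l.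
Proof. by move=> fg fl e e0; apply: filterS2 fg (fl e e0) => x /= ->. Qed.

Lemma ucvgD f g l m : ucvg U f l -> ucvg U g m -> ucvg U (fun x => f x + g x) (l + m).
Proof.
move=> fl gm e e0; have e2 : 0 < e / 2 by rewrite divr_gt0.
apply: filterS2 (fl _ e2) (gm _ e2) => x /= h1 h2.
rewrite opprD addrACA; apply: le_lt_trans (cabsD _ _) _.
by rewrite (splitr e) ltrD.
Qed.

Lemma ucvgJ f l : ucvg U f l -> ucvg U (fun x => conjc (f x)) (conjc l).
Proof.
move=> fl e e0; apply: filterS (fl e e0) => x /=.
by rewrite -(cabsJ (f x - l)) raddfB.
Qed.

Lemma ucvgN f l : ucvg U f l -> ucvg U (fun x => - f x) (- l).
Proof. by move=> fl e e0; apply: filterS (fl e e0) => x /=; rewrite -opprD cabsN. Qed.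

Lemma ucvgB f g l m : ucvg U f l -> ucvg U g m -> ucvg U (fun x => f x - g x) (l - m).
Proof. by move=> fl gm; exact: ucvgD fl (ucvgN gm). Qed.

Lemma ucvg_near f l : ucvg U f l -> U [set x | cabs (f x) <= cabs l + 1].
Proof.
move=> fl; apply: filterS (fl 1 ltr01) => x /= h.
rewrite -[f x](subrK l) addrC; apply: le_trans (cabsD _ _) _.
by rewrite lerD2l ltW.
Qed.

Lemma ucvgM f g l m : ucvg U f l -> ucvg U g m -> ucvg U (fun x => f x * g x) (l * m).
Proof.
move=> fl gm e e0.
pose e1 := e / 2 / (cabs l + 1); pose e2 := e / 2 / (cabs m + 1).
have l0 : 0 < cabs l + 1 by rewrite ltr_wpDl ?cabs_ge0.
have m0 : 0 < cabs m + 1 by rewrite ltr_wpDl ?cabs_ge0.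
have e10 : 0 < e1 by rewrite !divr_gt0.
have e20 : 0 < e2 by rewrite !divr_gt0.
apply: filterS3 (ucvg_near fl) (fl _ e20) (gm _ e10) => x /= h0 h1 h2.
have -> : f x * g x - l * m = f x * (g x - m) + (f x - l) * m by ring.
apply: le_lt_trans (cabsD _ _) _; rewrite !cabsM (splitr e).
have h3 : cabs (f x) * cabs (g x - m) <= (cabs l + 1) * cabs (g x - m).
  by rewrite ler_wpM2r ?cabs_ge0.
have h4 : (cabs l + 1) * cabs (g x - m) < e / 2.
  by rewrite mulrC -ltr_pdivlMr.
have h5 : cabs (f x - l) * cabs m <= cabs (f x - l) * (cabs m + 1).
  by rewrite ler_wpM2l ?cabs_ge0 // lerDl.
have h6 : cabs (f x - l) * (cabs m + 1) < e / 2 by rewrite -ltr_pdivlMr.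
by apply: ltrD; [apply: le_lt_trans h3 h4|apply: le_lt_trans h5 h6].
Qed.

Lemma ucvg_sum I (r : seq I) (F : I -> T -> R[i]) (L : I -> R[i]) :
  (forall i, ucvg U (F i) (L i)) ->
  ucvg U (fun x => \sum_(i <- r) F i x) (\sum_(i <- r) L i).
Proof.
move=> h; elim: r => [|i r IH].
  by rewrite big_nil; apply: ucvg_ext (ucvg_cst 0); apply: filterE => x /=; rewrite big_nil.
rewrite big_cons; apply: ucvg_ext (ucvgD (h i) IH).
by apply: filterE => x /=; rewrite big_cons.
Qed.

Lemma ucvg_Re_le f l (r : R) : ucvg U f l -> U [set x | Re (f x) <= r] -> Re l <= r.
Proof.
move=> fl fr; apply/ler_addgt0Pr => e e0.
have [x [/= h1 h2]] := proper_meet (fl _ e0) fr.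
have := Re_le_cabs (f x - l); rewrite ReB ler_norml => /andP[h3 _].
lra.
Qed.

Lemma ucvg_Re_ge f l (r : R) : ucvg U f l -> U [set x | r <= Re (f x)] -> r <= Re l.
Proof.
move=> fl fr; apply/ler_addgt0Pr => e e0.
have [x [/= h1 h2]] := proper_meet (fl _ e0) fr.
have := Re_le_cabs (f x - l); rewrite ReB ler_norml => /andP[_ h3].
lra.
Qed.

Lemma ucvg_cabs_le f l (r : R) : ucvg U f l -> U [set x | cabs (f x) <= r] -> cabs l <= r.
Proof.
move=> fl fr; apply/ler_addgt0Pr => e e0.
have [x [/= h1 h2]] := proper_meet (fl _ e0) fr.
have := cabsD (l - f x) (f x); rewrite subrK cabsB => h3.
lra.
Qed.

End Filter.

Section Ultra.
Variables (U : set_system T).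
Context {UU : UltraFilter U}.

Lemma ultra_fmap (T' : Type) (f : T -> T') : UltraFilter (f @ U).
Proof.
split; first exact: fmap_proper_filter.
move=> G PG UG; apply/seteqP; split=> [A GA|]; last exact: UG.
have [//|h] := in_ultra_setVsetC (f @^-1` A) UU.
have : G (A `&` ~` A) by apply: filterI => //; apply: UG.
by rewrite setICr => /(@filter_not_empty _ G PG).
Qed.

Lemma ultra_cvg_compact (V : topologicalType) (K : set V) (f : T -> V) :
  compact K -> U [set x | K (f x)] -> exists2 p, K p & f @ U --> p.
Proof.
rewrite compact_ultra => cK Kf.
by have [p [Kp fp]] := cK _ (ultra_fmap f) Kf; exists p.
Qed.

Lemma ultra_real_cvg (f : T -> R) (M : R) :
  U [set x | `|f x| <= M] ->
  exists l : R, forall e : R, 0 < e -> U [set x | `|f x - l| < e].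
Proof.
move=> fM; have [|l _ fl] := @ultra_cvg_compact _ _ f (@segment_compact R (- M) M).
  by apply: filterS fM => x /=; rewrite ler_norml /= in_itv.
exists l => e e0; have /cvgrPdist_lt/(_ e e0) := fl.
by apply: filterS => x /=; rewrite distrC.
Qed.

(** Boundedness alone gives a limit along an ultrafilter; this replaces the extraction of
    subsequences in the compactness arguments below. *)
Lemma ultra_cvg f (M : R) : U [set x | cabs (f x) <= M] -> exists l, ucvg U f l.
Proof.
move=> fM.
have [|a ha] := @ultra_real_cvg (fun x => Re (f x)) M.
  by apply: filterS fM => x /=; apply: le_trans; exact: Re_le_cabs.
have [|b hb] := @ultra_real_cvg (fun x => Im (f x)) M.
  by apply: filterS fM => x /=; apply: le_trans; exact: Im_le_cabs.
exists (a +i* b) => e e0; have e2 : 0 < e / 2 by rewrite divr_gt0.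
apply: filterS2 (ha _ e2) (hb _ e2) => x /= h1 h2.
apply: le_lt_trans (cabs_le_ReIm _) _; rewrite (splitr e) ReB ImB /=.
exact: ltrD.
Qed.

Definition clim f : R[i] := xget 0 [set l | ucvg U f l].

Lemma clim_cvg f (M : R) : U [set x | cabs (f x) <= M] -> ucvg U f (clim f).
Proof. by move=> /ultra_cvg[l fl]; rewrite /clim; case: xgetP => // /(_ l). Qed.

Lemma clim_eq f l : ucvg U f l -> clim f = l.
Proof.
move=> fl; apply: (@ucvg_uniq U _ f) => //.
by rewrite /clim; case: xgetP => // /(_ l).
Qed.

End Ultra.
End UltraLimits.

(** * Orthogonal projections, Riesz representation and adjoints *)

Section Projection.
Variables (R : realType) (H : hilbertType R).
Implicit Types (M : closedSubspace H) (x y z : H).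

Lemma csubD M x y : csub_set M x -> csub_set M y -> csub_set M (x + y).
Proof. by move=> hx hy; rewrite -[x]scale1r; exact: csubP. Qed.
Lemma csubZ M a x : csub_set M x -> csub_set M (a *: x).
Proof. by move=> hx; rewrite -[_ *: x]addr0; apply: csubP => //; exact: csub0. Qed.

Lemma exists_projection M x :
  exists2 p, csub_set M p & orthogonal_complement M (x - p).
Proof.
pose D := [set nsq (x - y) | y in csub_set M].
have D0 : D !=set0 by exists (nsq (x - 0)), 0 => //; exact: csub0.
have lD : lbound D 0 by move=> _ [y _ <-]; exact: nsq_ge0.
pose dl := inf D.
have dlP y : csub_set M y -> dl <= nsq (x - y).
  by move=> My; apply: ge_inf; [exists 0|exists y].
pose q (n : nat) : R := n.+1%:R^-1.
have q0 n : 0 < q n by rewrite invr_gt0 ltr0n.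
have near_inf (n : nat) : exists y, csub_set M y /\ nsq (x - y) < dl + q n.
  have [_ [y My <-] h] := @inf_adherent R D (q n) (q0 n) (conj D0 (ex_intro _ 0 lD)).
  by exists y.
have [y hy] := choice near_inf.
have hM n : csub_set M (y n) by have [] := hy n.
have hlt n : nsq (x - y n) < dl + q n by have [] := hy n.
have small (e : R) : 0 < e -> exists N, forall n, (N <= n)%N -> q n < e.
  move=> e0; exists (Num.bound e^-1) => n hn.
  rewrite /q -[e]invrK ltf_pV2 ?posrE ?invr_gt0 ?ltr0n //.
  apply: lt_le_trans (archi_boundP _) _; first by rewrite invr_ge0 ltW.
  by rewrite ler_nat (leq_trans hn).
have [|p hp] := @hilbert_complete R H y.
  move=> e e0; have e4 : 0 < e ^+ 2 / 4 by rewrite divr_gt0 // exprn_gt0.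
  have [N hN] := small _ e4; exists N => m n Nm Nn.
  rewrite -(@ltr_pXn2r _ 2) ?nnegrE ?nrm_ge0 ?(ltW e0) // sqr_nrm.
  have := parallelogram (x - y n) (x - y m).
  have -> : x - y n - (x - y m) = y m - y n by rewrite opprB addrC addrA subrK addrC.
  have -> : x - y n + (x - y m) = (2 : R)%:C *: (x - (2^-1 : R)%:C *: (y n + y m)).
    rewrite scalerBr scalerA -rmorphM /= divff ?pnatr_eq0 // scale1r.
    by rewrite rmorph_nat scaler_nat mulr2n addrACA opprD.
  rewrite nsqZ csqr => par.
  have := dlP ((2^-1 : R)%:C *: (y n + y m)).
  move=> /(_ (csubZ _ (csubD (hM n) (hM m)))) h1.
  have h2 := hlt n; have h3 := hlt m; have h4 := hN _ Nm; have h5 := hN _ Nn.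
  set A := nsq (x - _) in h1 par.
  have : (2 : R) ^+ 2 = 4 by ring.
  move=> h6; rewrite h6 in par; lra.
exists p.
  apply: csub_limit => e /hp[N /(_ N (leqnn N)) hN].
  by exists (y N).
move=> z Mz.
(* Orthogonality is first proved approximately, at [y n] instead of the limit [p]: adding
   [w / |z|^2] times [z] to [y n] stays in [M] and lowers the squared distance by [|w|^2 / |z|^2],
   which is at most the excess [q n] over the infimum. *)
have bnd n : csq (inner (x - y n) z) <= nsq z * q n.
  have [->|z0] := eqVneq z 0; first by rewrite inner0r csqr expr0n nsq0 mul0r.
  have nz : 0 < nsq z by rewrite nsq_gt0.
  set w := inner (x - y n) z.
  have /dlP := csubD (hM n) (csubZ (w / (nsq z)%:C) Mz).
  rewrite opprD addrA nsqB nsqZ /rip innerZr -/w => h1.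
  have h2 := hlt n.
  have e1 : csq (w / (nsq z)%:C) * nsq z = csq w / nsq z.
    rewrite csqM -fmorphV csqr; field; exact: lt0r_neq0.
  have e2 : Re ((w / (nsq z)%:C)^* * w) = csq w / nsq z.
    rewrite conjcM -fmorphV conjc_real mulrAC [_^* * _]mulrC mulcJ mulrC ReMr /= mulrC.
    by [].
  rewrite e1 e2 in h1.
  by rewrite mulrC -ler_pdivrMr //; lra.
apply/eqP; rewrite -cabs_eq0; apply/eqP/le_anti; rewrite cabs_ge0 andbT.
apply/ler_addgt0Pr => e e0; rewrite add0r.
have c0 : 0 < nrm z + 1 by rewrite ltr_wpDl ?nrm_ge0.
have e1 : 0 < e / 2 / (nrm z + 1) by rewrite !divr_gt0.
have [N1 h1] := hp _ e1.
have z1 : 0 < nsq z + 1 by rewrite ltr_wpDl ?nsq_ge0.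
have e2 : 0 < (e / 2) ^+ 2 / (nsq z + 1) by rewrite divr_gt0 // exprn_gt0 // divr_gt0.
have [N2 h2] := small _ e2.
pose n := maxn N1 N2.
have -> : inner (x - p) z = inner (x - y n) z - inner (p - y n) z.
  by rewrite -innerBl opprB addrA subrK.
apply: le_trans (cabsD _ _) _; rewrite cabsN (splitr e); apply: lerD.
  rewrite -(@ler_pXn2r _ 2) ?nnegrE ?cabs_ge0 ?divr_ge0 ?(ltW e0) // sqr_cabs.
  apply: le_trans (bnd n) _.
  have := h2 n (leq_maxr _ _); rewrite ltr_pdivlMr // => h3.
  apply: le_trans (ltW h3); rewrite mulrC; apply: ler_wpM2l; [exact: ltW|by rewrite lerDl].
apply: le_trans (cauchy_schwarz _ _) _.
have := h1 n (leq_maxl _ _); rewrite ltr_pdivlMr // => h3.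
by apply: le_trans (ltW h3); rewrite ler_wpM2l ?nrm_ge0 // lerDl.
Qed.

Lemma orthogonal_complementK M x :
  (forall y, orthogonal_complement M y -> inner x y = 0) -> csub_set M x.
Proof.
move=> hx; have [p Mp hp] := exists_projection M x.
have : nsq (x - p) = 0.
  by rewrite /nsq {1}innerBl (hx _ hp) innerJ hp // conjc0 subrr.
by move/eqP; rewrite nsq_eq0 subr_eq0 => /eqP ->.
Qed.

Lemma riesz (f : H -> R[i]) (B : R) :
  (forall a x y, f (a *: x + y) = a * f x + f y) -> (forall x, cabs (f x) <= B * nrm x) ->
  exists y, forall x, f x = inner x y.
Proof.
move=> lf bf.
have fD x y : f (x + y) = f x + f y by have := lf 1 x y; rewrite scale1r mul1r.
have f0 : f 0 = 0 by apply: (@addrI _ (f 0)); rewrite -fD !addr0.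
have fZ a x : f (a *: x) = a * f x by have := lf a x 0; rewrite f0 !addr0.
have fB x y : f (x - y) = f x - f y by rewrite fD -scaleN1r fZ mulN1r.
have kclosed : closed [set x | f x = 0].
  apply: closed_of_limits => x hx /=; apply/eqP; rewrite -cabs_eq0.
  apply/eqP/le_anti; rewrite cabs_ge0 andbT; apply/ler_addgt0Pr => e e0; rewrite add0r.
  have B0 : 0 < `|B| + 1 by rewrite ltr_wpDl.
  have [|y /= fy hy] := hx (e / (`|B| + 1)); first by rewrite divr_gt0.
  rewrite -[f x]subr0 -fy -fB; apply: le_trans (bf _) _.
  move: hy; rewrite ltr_pdivlMr // => hy; apply: le_trans (ltW hy).
  rewrite mulrC ler_wpM2l ?nrm_ge0 //.
  by apply: le_trans (ler_norm B) _; rewrite lerDl.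
pose M := @ClosedSubspace R H [set x | f x = 0] f0
  (fun a x y (hx : f x = 0) (hy : f y = 0) => etrans (lf a x y)
     (etrans (congr2 +%R (congr1 ( *%R a) hx) hy) (etrans (addr0 _) (mulr0 a)))) kclosed.
have [h|/existsNP[x0 /eqP fx0]] := pselect (forall x, f x = 0).
  by exists 0 => x; rewrite inner0r.
have [p Mp hp] := exists_projection M x0.
pose z := x0 - p.
have fz : f z != 0 by rewrite fB (Mp : f p = 0) subr0.
have nz : (nsq z)%:C != 0.
  apply: contraNneq fz => /complexI/eqP; rewrite nsq_eq0 => /eqP ->.
  by rewrite f0.
(* [z] is orthogonal to the kernel of [f], which contains [f z *: x - f x *: z] for every [x]. *)
exists (conjc (f z / (nsq z)%:C) *: z) => x.
rewrite innerZr conjcK.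
have Mw : csub_set M (f z *: x - f x *: z).
  by rewrite /M /= fB !fZ mulrC subrr.
have := hp _ Mw; rewrite -/z innerJ => /eqP.
rewrite conjc_eq0 innerBl !innerZl subr_eq0 inner_self => /eqP h.
by rewrite mulrAC h mulfK.
Qed.

Lemma exists_adjoint (T : 'B(H)) : exists S : 'B(H), is_adjoint T S.
Proof.
have [B B0 hB] := bop_bounded T.
have ex y : exists z, forall x, inner (T x) y = inner x z.
  apply: (@riesz _ (B * nrm y)) => [a u v|x].
    by rewrite bop_linear innerDl innerZl.
  by rewrite mulrAC; apply: le_trans (cauchy_schwarz _ _) _; rewrite ler_wpM2r ?nrm_ge0.
have [S hS] := choice ex.
have lS : linear S.
  move=> a u v; apply: inner_ext => x.
  by rewrite innerJ -hS innerDr innerZr !hS -innerZr -innerDr -innerJ.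
suff bS x : nrm (S x) <= B * nrm x by exists (Bop (bounded_bop lS bS)).
have [->|n0] := eqVneq (nrm (S x)) 0; first by rewrite mulr_ge0 ?nrm_ge0.
have np : 0 < nrm (S x) by rewrite lt_def n0 nrm_ge0.
rewrite -(ler_pM2l np) -expr2 sqr_nrm.
apply: le_trans (ler_norm _) _; apply: le_trans (Re_le_cabs _) _.
rewrite -hS; apply: le_trans (cauchy_schwarz _ _) _.
by rewrite mulrA [_ * B]mulrC ler_wpM2r ?nrm_ge0.
Qed.

Definition adj (T : 'B(H)) : 'B(H) := xget 0 [set S | is_adjoint T S].

Lemma adjP T : is_adjoint T (adj T).
Proof.
rewrite /adj; case: xgetP => //.
by have [S hS] := exists_adjoint T => /(_ S).
Qed.
Lemma adjl T x y : inner (adj T x) y = inner x (T y).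
Proof. by rewrite innerJ -adjP -innerJ. Qed.
Lemma adj_uniq T S : is_adjoint T S -> S = adj T.
Proof.
move=> h; apply: bop_ext => x; apply: inner_ext => z.
by rewrite innerJ -h adjP -innerJ.
Qed.

End Projection.

(** * The Hilbert space of square-summable sequences *)

Section SquareSummable.
Variable R : realType.
Implicit Types (f g h : nat -> R[i]^o).

Definition sqsum f (n : nat) : R := \sum_(k < n) csq (f k).

Lemma sqsum_ge0 f n : 0 <= sqsum f n.
Proof. by apply: sumr_ge0 => k _; exact: csq_ge0. Qed.
Lemma le_sqsum f m n : (m <= n)%N -> sqsum f m <= sqsum f n.
Proof.
move=> /subnKC <-; rewrite /sqsum big_split_ord /= lerDl.
by apply: sumr_ge0 => k _; exact: csq_ge0.
Qed.
Lemma csqD_le (a b : R[i]) : csq (a + b) <= 2 * csq a + 2 * csq b.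
Proof.
rewrite /csq ReD ImD.
have := sqr_ge0 (Re a - Re b); have := sqr_ge0 (Im a - Im b); nra.
Qed.

Definition sqsummable : {pred nat -> R[i]^o} :=
  fun f => `[< exists B, forall n, sqsum f n <= B >].

Fact sqsummable_closed : submod_closed sqsummable.
Proof.
split=> [|a f g /asboolP[B hB] /asboolP[B' hB']]; apply/asboolP.
  exists 0 => n; rewrite /sqsum big1 // => k _.
  by rewrite /csq /= expr0n addr0.
exists (2 * (csq a * B) + 2 * B') => n.
apply: le_trans (_ : 2 * (csq a * sqsum f n) + 2 * sqsum g n <= _).
  rewrite /sqsum !mulr_sumr -big_split /=; apply: ler_sum => k _.
  by apply: le_trans (csqD_le _ _) _; rewrite -csqM.
by rewrite lerD // ler_wpM2l // ler_wpM2l ?csq_ge0.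
Qed.

HB.instance Definition _ :=
  GRing.isSubmodClosed.Build _ _ sqsummable sqsummable_closed.

Record ell2 := Ell2 { ell2_fun :> nat -> R[i]^o; _ : ell2_fun \in sqsummable }.

HB.instance Definition _ := [isSub for ell2_fun].
HB.instance Definition _ := [Choice of ell2 by <:].
HB.instance Definition _ := [SubChoice_isSubLmodule of ell2 by <:].

Implicit Types (x y z : ell2).

Lemma ell2_ext x y : (forall k, x k = y k) -> x = y.
Proof. by move=> h; apply: val_inj; apply: funext. Qed.
Lemma ell2D x y k : (x + y) k = x k + y k. Proof. by []. Qed.
Lemma ell2N x k : (- x) k = - x k. Proof. by []. Qed.
Lemma ell2B x y k : (x - y) k = x k - y k. Proof. by []. Qed.
Lemma ell2Z a x k : (a *: x) k = a * x k. Proof. by []. Qed.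
Lemma ell20 k : (0 : ell2) k = 0. Proof. by []. Qed.

Fact even_ultra_subproof :
  exists U : set_system nat, UltraFilter U /\ (double @ \oo) `<=` U.
Proof. exact: ultraFilterLemma. Qed.

(* Containing the even numbers lets partial sums be cut between the blocks
   {2n, 2n+1}. *)
Definition even_ultra : set_system nat := projT1 (cid even_ultra_subproof).
Fact even_ultra_ultra : UltraFilter even_ultra.
Proof. by rewrite /even_ultra; case: cid => U []. Qed.
#[local] Existing Instance even_ultra_ultra.
#[local] Instance even_ultra_proper : ProperFilter even_ultra := ultra_proper.
Lemma even_ultra_eventually (N : nat) :
  even_ultra [set n | (N <= n)%N /\ ~~ odd n].
Proof.
rewrite /even_ultra; case: cid => U [_ /=]; apply; exists N => // n /= Nn.
by split; [rewrite -addnn (leq_trans Nn) ?leq_addr|rewrite odd_double].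
Qed.

Lemma ell2_bound x : exists B, forall n, sqsum x n <= B.
Proof. by case: x => f /= /asboolP. Qed.

Lemma cabsM_le (a b : R[i]) : 2 * cabs (a * b) <= csq a + csq b.
Proof.
by rewrite cabsM -!sqr_cabs; have := sqr_ge0 (cabs a - cabs b); nra.
Qed.

(** The series converges absolutely, so this is its usual sum. As an ultralimit it exists by
    boundedness of the partial sums alone, and its algebraic rules follow from those of limits. *)
Definition ell2_inner x y : R[i] :=
  clim even_ultra (fun n => \sum_(k < n) x k * (y k)^*).

Lemma ell2_inner_cvg x y :
  ucvg even_ultra (fun n => \sum_(k < n) x k * (y k)^*) (ell2_inner x y).
Proof.
have [B hB] := ell2_bound x; have [B' hB'] := ell2_bound y.
apply: (@clim_cvg _ _ _ _ _ (B + B')).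
apply: filterE => n /=; apply: le_trans (cabs_sum _ _ _) _.
apply: le_trans (lerD (hB n) (hB' n)); rewrite -big_split /=.
apply: ler_sum => k _; rewrite -(csqJ (y k)).
by apply: le_trans (cabsM_le _ _); rewrite ler_peMl ?cabs_ge0 ?ler1n.
Qed.

Lemma ell2_innerJ x y : ell2_inner y x = (ell2_inner x y)^*.
Proof.
apply: clim_eq; apply: ucvg_ext (ucvgJ (ell2_inner_cvg x y)).
apply: filterE => n /=; rewrite conjc_sum; apply: eq_bigr => k _.
by rewrite conjcM conjcK mulrC.
Qed.

Lemma ell2_innerP a x y z :
  ell2_inner (a *: x + y) z = a * ell2_inner x z + ell2_inner y z.
Proof.
apply: clim_eq.
apply: ucvg_ext (ucvgD (ucvgM (ucvg_cst a) (ell2_inner_cvg x z)) (ell2_inner_cvg y z)).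
apply: filterE => n /=; rewrite mulr_sumr -big_split /=; apply: eq_bigr => k _.
by rewrite mulrA -mulrDl.
Qed.

Definition ell2_sq x : R := Re (ell2_inner x x).

Lemma sqsum_inner x n : \sum_(k < n) x k * (x k)^* = (sqsum x n)%:C.
Proof. by rewrite rmorph_sum /=; apply: eq_bigr => k _; rewrite mulcJ. Qed.

Lemma sqsum_le x n : sqsum x n <= ell2_sq x.
Proof.
apply: ucvg_Re_ge (ell2_inner_cvg x x) _.
by apply: filterS (even_ultra_eventually n) => m /= [nm _]; rewrite sqsum_inner /= le_sqsum.
Qed.

Lemma ell2_sq_le x (B : R) : (forall n, sqsum x n <= B) -> ell2_sq x <= B.
Proof.
move=> h; apply: ucvg_Re_le (ell2_inner_cvg x x) _.
by apply: filterE => m /=; rewrite sqsum_inner /=.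
Qed.

Lemma ell2_sq_ge0 x : 0 <= ell2_sq x.
Proof. exact: le_trans (sqsum_ge0 x 0) (sqsum_le x 0). Qed.

Lemma csq_ell2 x k : csq (x k) <= ell2_sq x.
Proof.
apply: le_trans (sqsum_le x k.+1); rewrite /sqsum big_ord_recr /= lerDr.
exact: sqsum_ge0.
Qed.

Lemma ell2_sq_eq0 x : ell2_sq x = 0 -> x = 0.
Proof.
move=> x0; apply: ell2_ext => k; apply/eqP; rewrite -csq_eq0 eq_le csq_ge0 andbT.
by rewrite -x0 csq_ell2.
Qed.

Definition ell2_norm x : R[i] := (Num.sqrt (ell2_sq x))%:C.

Fact ell2_norm_triangle x y : ell2_norm (x + y) <= ell2_norm x + ell2_norm y.
Proof.
rewrite -rmorphD /= lecR.
exact: form_triangle ell2_innerP ell2_innerJ ell2_sq_ge0 x y.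
Qed.

Fact ell2_normZ a x : ell2_norm (a *: x) = `|a| * ell2_norm x.
Proof.
rewrite norm_cabs -rmorphM /=; congr (_%:C).
by rewrite -sqrtrM ?csq_ge0 // /ell2_sq (form_sqZ ell2_innerP ell2_innerJ).
Qed.

Fact ell2_norm_eq0 x : ell2_norm x = 0 -> x = 0.
Proof.
move/complexI/eqP; rewrite sqrtr_eq0 => h; apply: ell2_sq_eq0.
by apply: le_anti; rewrite h ell2_sq_ge0.
Qed.

HB.instance Definition _ := @Lmodule_isNormed.Build R[i] ell2
  ell2_norm ell2_norm_triangle ell2_normZ ell2_norm_eq0.

Lemma ell2_normE x : `|x| = (Num.sqrt (ell2_sq x))%:C.
Proof. by []. Qed.

(** Coordinatewise limits are taken along an ultrafilter [G] finer than [F]. Bounds on finite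
    partial sums survive these limits and give convergence in norm along [F] itself. *)
Fact ell2_complete (F : set_system ell2) : ProperFilter F -> cauchy F -> cvg F.
Proof.
move=> FF Fc; have [G [UG FG]] := ultraFilterLemma FF.
have PG : ProperFilter G := ultra_proper.
have small (e : R) : 0 < e -> exists2 y, F [set z | ell2_sq (y - z) < e ^+ 2] & True.
  move=> e0; have [|y Fy] := (@cauchyP R[i] ell2 F FF).1 Fc e%:C; first by rewrite ltcR.
  exists y => //; apply: filterS Fy => z; rewrite -ball_normE /ball_ /= ell2_normE ltcR.
  by rewrite -[X in _ < X](ger0_norm (ltW e0)) -sqrtr_sqr ltr_sqrt ?exprn_gt0.
pose f k := clim G (fun z : ell2 => z k).
have fP k : ucvg G (fun z : ell2 => z k) (f k).
  have [y /FG Gy _] := small 1 ltr01.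
  apply: (@clim_cvg _ _ G _ _ (cabs (y k) + 1)); apply: filterS Gy => z /= hz.
  rewrite -[z k](subrK (y k)) addrC; apply: le_trans (cabsD _ _) _; rewrite lerD2l.
  rewrite cabsB -(@ler_pXn2r _ 2) ?nnegrE ?cabs_ge0 // sqr_cabs.
  by apply: le_trans (ltW hz); rewrite -ell2B csq_ell2.
have key (e : R) y : F [set z | ell2_sq (y - z) < e ^+ 2] ->
    forall n, \sum_(k < n) csq (y k - f k) <= e ^+ 2.
  move=> /FG Gy n.
  have : ucvg G (fun z : ell2 => \sum_(k < n) (y k - z k) * (y k - z k)^*)
      (\sum_(k < n) (y k - f k) * (y k - f k)^*).
    apply: ucvg_sum => k; have h : ucvg G (fun z : ell2 => y k - z k) (y k - f k).
      exact: ucvgB (ucvg_cst _) (fP k).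
    by apply: ucvgM => //; exact: ucvgJ.
  move=> /ucvg_Re_le => /(_ (e ^+ 2)); rewrite Re_sum.
  under eq_bigr do rewrite mulcJ /=.
  apply; apply: filterS Gy => z /= hz; rewrite Re_sum.
  under eq_bigr do rewrite mulcJ /=.
  exact: le_trans (sqsum_le (y - z) n) (ltW hz).
have fl : f \in sqsummable.
  have [y /key h _] := small 1 ltr01.
  have hy : (fun k => y k - f k) \in sqsummable.
    by apply/asboolP; exists (1 ^+ 2) => n; exact: h.
  have -> : f = (y : nat -> R[i]^o) - (fun k => y k - f k).
    by apply: funext => k; rewrite !fctE opprB addrC subrK.
  by apply: rpredB => //; case: (y).
apply/cvg_ex; exists (Ell2 fl); apply/cvgrPdist_lt => e e0.
have er : e = (Re e)%:C by rewrite RRe_real // gtr0_real.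
have re0 : 0 < Re e by rewrite -ltcR -er.
have e3 : 0 < Re e / 3 by rewrite divr_gt0.
have [y Fy _] := small _ e3.
apply: filterS (Fy) => z /= hz.
have -> : Ell2 fl - z = (Ell2 fl - y) + (y - z) by rewrite addrA subrK.
apply: le_lt_trans (ler_normD _ _) _.
rewrite [in X in _ < X]er [`|Ell2 fl - y|]distrC !ell2_normE -rmorphD /= ltcR.
have a1 : Num.sqrt (ell2_sq (y - Ell2 fl)) <= Re e / 3.
  rewrite -[X in _ <= X](ger0_norm (ltW e3)) -sqrtr_sqr ler_wsqrtr //.
  by apply: ell2_sq_le => n; exact: key.
have a2 : Num.sqrt (ell2_sq (y - z)) <= Re e / 3.
  by rewrite -[X in _ <= X](ger0_norm (ltW e3)) -sqrtr_sqr ler_wsqrtr // ltW.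
apply: le_lt_trans (lerD a1 a2) _; lra.
Qed.

HB.instance Definition _ := Uniform_isComplete.Build ell2 ell2_complete.

Fact ell2_inner_bilinear :
  bilinear_for (GRing.Scale.Law.clone _ _ *%R _)
    (GRing.Scale.Law.clone _ _ ((@Num.conj R[i]) \; *%R) _) ell2_inner.
Proof.
split=> z a x y; first exact: ell2_innerP.
by rewrite /= (formDr ell2_innerP ell2_innerJ) (formZr ell2_innerP ell2_innerJ).
Qed.

HB.instance Definition _ := bilinear_isBilinear.Build _ _ _ _
  (GRing.Scale.Law.clone _ _ *%R _)
  (GRing.Scale.Law.clone _ _ ((@Num.conj R[i]) \; *%R) _)
  ell2_inner ell2_inner_bilinear.

Fact ell2_inner_hermitian x y :
  ell2_inner x y = (-1) ^+ false * Num.conj (ell2_inner y x).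
Proof. by rewrite expr0 mul1r; exact: ell2_innerJ. Qed.

HB.instance Definition _ := isHermitianSesquilinear.Build _ _ _ _
  ell2_inner ell2_inner_hermitian.

Fact ell2_inner_gt0 x : x != 0 -> 0 < ell2_inner x x.
Proof.
move=> x0; rewrite (form_self ell2_innerJ) ltcR lt_def ell2_sq_ge0 andbT.
by apply: contraNneq x0 => /ell2_sq_eq0 ->.
Qed.

HB.instance Definition _ := isDotProduct.Build _ _ ell2_inner ell2_inner_gt0.

Fact ell2_sqr_normE x : `|x| ^+ 2 = ell2_inner x x.
Proof.
by rewrite ell2_normE -rmorphXn /= sqr_sqrtr ?ell2_sq_ge0 // (form_self ell2_innerJ).
Qed.

HB.instance Definition _ := CompleteNormedModule_isHilbert.Build R ell2 ell2_sqr_normE.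

End SquareSummable.

#[local] Existing Instance even_ultra_ultra.
#[local] Existing Instance even_ultra_proper.

Section Coordinates.
Variable R : realType.
Implicit Types (x y : ell2 R).

Lemma ell2_cvg x y :
  ucvg even_ultra (fun n => \sum_(k < n) x k * (y k)^*) (inner x y).
Proof. exact: ell2_inner_cvg. Qed.

Fact ell2_basis_subproof (j : nat) :
  (fun k => (k == j)%:R : R[i]^o) \in @sqsummable R.
Proof.
apply/asboolP; exists 1 => n; rewrite /sqsum.
apply: le_trans (_ : \sum_(k < n) ((k : nat) == j)%:R <= _).
  apply: ler_sum => k _; case: eqP => _ /=.
    by rewrite /csq /= expr1n expr0n addr0.
  by rewrite /csq /= !expr0n addr0.
have [jn|nj] := ltnP j n.
  rewrite (bigD1 (Ordinal jn)) //= eqxx big1 ?addr0 // => k kj.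
  by case: eqP => // /eqP; rewrite -[j]/(nat_of_ord (Ordinal jn)) (inj_eq val_inj) (negPf kj).
rewrite big1 ?ler01 // => k _; case: eqP => // kj.
by have := ltn_ord k; rewrite kj ltnNge nj.
Qed.
Definition ell2_basis j : ell2 R := Ell2 (ell2_basis_subproof j).

Lemma ell2_basisE j k : ell2_basis j k = (k == j)%:R. Proof. by []. Qed.

Lemma inner_ell2_basis x j : inner x (ell2_basis j) = x j.
Proof.
apply: (ucvg_uniq (ell2_cvg x _)).
apply: ucvg_ext (ucvg_cst _); apply: filterS (even_ultra_eventually j.+1) => n /= [jn _].
rewrite (bigD1 (Ordinal jn)) //= eqxx conjc1 mulr1 big1 ?addr0 // => k kj.
case: eqP => [/eqP|_]; last by rewrite conjc0 mulr0.
by rewrite -[X in _ == X]/(nat_of_ord (Ordinal jn)) (inj_eq val_inj) (negPf kj).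
Qed.

Lemma inner_basis_ell2 x j : inner (ell2_basis j) x = (x j)^*.
Proof. by rewrite innerJ inner_ell2_basis. Qed.

(** The off-diagonal part of a block operator couples [k] with the other index of its pair {2n,
    2n+1}. *)
Definition flip (k : nat) : nat := if odd k then k.-1 else k.+1.

Lemma flipK : involutive flip.
Proof.
move=> k; rewrite /flip; have [ok|ek] := boolP (odd k).
  have k0 : (0 < k)%N by case: k ok.
  by move: ok; rewrite -{1}(prednK k0) /= => /negPf ->; rewrite prednK.
by rewrite /= ek.
Qed.

Lemma flip_half k : (flip k)./2 = k./2.
Proof. rewrite /flip; case: ifP; lia. Qed.
Lemma flip_neq k : flip k != k.
Proof. rewrite /flip; case: ifP; lia. Qed.
Lemma half_eq k j : (k./2 == j./2) = (k == j) || (k == flip j).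
Proof. by rewrite /flip; case: ifP => h; apply/idP/idP; lia. Qed.
Lemma flip_double n : flip n.*2 = n.*2.+1.
Proof. by rewrite /flip odd_double. Qed.
Lemma flip_doubleS n : flip n.*2.+1 = n.*2.
Proof. by rewrite /flip /= odd_double. Qed.

Lemma sum_flip (g : nat -> R) m : \sum_(k < m.*2) g (flip k) = \sum_(k < m.*2) g k.
Proof.
elim: m => [|m IH]; first by rewrite !big_ord0.
by rewrite doubleS !big_ord_recr /= IH flip_double flip_doubleS -!addrA [g _ + _]addrC.
Qed.

Lemma sqsum_flip x n : \sum_(k < n) csq (x (flip k)) <= nsq x.
Proof.
(* The indices below [n] are not stable under [flip] when [n] is odd; those below [2n] always
   are. *)
apply: le_trans (_ : \sum_(k < n.*2) csq (x (flip k)) <= _).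
  rewrite -addnn big_split_ord /= lerDl; apply: sumr_ge0 => k _; exact: csq_ge0.
by rewrite (sum_flip (fun k => csq (x k))); exact: sqsum_le.
Qed.

Section BlockOperator.
Variables (a b : nat -> R[i]) (B : R).
Hypotheses (ha : forall k, csq (a k) <= B) (hb : forall k, csq (b k) <= B).

Let f x : nat -> R[i]^o := fun k => a k * x k + b k * x (flip k).

Let f_bound x n : sqsum (f x) n <= 4 * B * nsq x.
Proof.
have B0 : 0 <= B := le_trans (csq_ge0 _) (ha 0).
apply: le_trans (_ : \sum_(k < n) (2 * B * csq (x k) + 2 * B * csq (x (flip k))) <= _).
  apply: ler_sum => k _; apply: le_trans (csqD_le _ _) _; rewrite !csqM.
  by rewrite -!mulrA; apply: lerD; rewrite ler_wpM2l // ler_wpM2r ?csq_ge0.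
rewrite big_split -!mulr_sumr /=.
have -> : 4 * B * nsq x = 2 * B * nsq x + 2 * B * nsq x by ring.
by apply: lerD; rewrite ler_wpM2l ?mulr_ge0 // ?sqsum_flip //; exact: sqsum_le.
Qed.

Fact blkop_subproof x : f x \in @sqsummable R.
Proof. by apply/asboolP; exists (4 * B * nsq x); exact: f_bound. Qed.

Let F x : ell2 R := Ell2 (blkop_subproof x).

Let F_linear : linear F.
Proof.
by move=> c x y; apply: ell2_ext => k; rewrite ell2D ell2Z /= /f !ell2D !ell2Z; ring.
Qed.

Let F_bounded x : nrm (F x) <= Num.sqrt (4 * B) * nrm x.
Proof.
have B0 : 0 <= B := le_trans (csq_ge0 _) (ha 0).
rewrite /nrm -sqrtrM ?mulr_ge0 //; apply: ler_wsqrtr; apply: ell2_sq_le.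
exact: f_bound.
Qed.

Definition blkop : 'B(ell2 R) := Bop (bounded_bop F_linear F_bounded).

Lemma blkopE x k : blkop x k = a k * x k + b k * x (flip k).
Proof. by []. Qed.

Lemma blkop_basis j :
  blkop (ell2_basis j) = a j *: ell2_basis j + b (flip j) *: ell2_basis (flip j).
Proof.
apply: ell2_ext => k; rewrite blkopE ell2D !ell2Z !ell2_basisE (can2_eq flipK flipK).
congr (_ + _); first by case: eqP => [->|_]; rewrite // !mulr0.
by case: eqP => [->|_]; rewrite // !mulr0.
Qed.

Lemma adj_blkopE x k :
  adj blkop x k = (a k)^* * x k + (b (flip k))^* * x (flip k).
Proof.
by rewrite -inner_ell2_basis adjl blkop_basis innerDr !innerZr !inner_ell2_basis.
Qed.

End BlockOperator.
End Coordinates.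

(** * The dual description of Wmin *)

Lemma big_option_sum (V : nmodType) (T : finType) (F : option T -> V) :
  \sum_o F o = F None + \sum_i F (Some i).
Proof.
rewrite (bigD1 None) //=; congr (_ + _).
rewrite (reindex_omap Some id) => [|[]] //=.
by apply: eq_bigl => i; rewrite eqxx.
Qed.

(** First-order optimality: [y] is the displacement to a nearest point, and the term linear in [s]
    of the squared distance cannot be negative. Only [s <= 1] is available, since convexity gives no
    longer steps; hence the choice between [s = 1] and [s = r / (G + 1)]. *)
Lemma nearest_polar (R : realType) (I : finType) (y g : I -> R[i]) :
  (forall s : R, 0 < s <= 1 -> \sum_k csq (y k) <= \sum_k csq (y k - s%:C * g k)) ->
  Re (\sum_k (y k)^* * g k) <= 0.
Proof.
move=> h; set r := Re _; pose G := \sum_k csq (g k).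
have G0 : 0 <= G by apply: sumr_ge0 => k _; exact: csq_ge0.
have key (s : R) : 0 < s <= 1 -> 2 * r <= s * G.
  move=> s01; have s0 : 0 < s by case/andP: s01.
  have := h s s01.
  have -> : \sum_k csq (y k - s%:C * g k) = \sum_k csq (y k) - 2 * s * r + s ^+ 2 * G.
    rewrite /r Re_sum /G !mulr_sumr -sumrB -big_split /=; apply: eq_bigr => k _.
    rewrite /csq !(ReB, ImB, ReM, ImM, ReJ, ImJ) /=; ring.
  by move=> hs; rewrite -(ler_pM2l s0); nra.
rewrite leNgt; apply/negP => r0.
have [h1|h1] := leP (G + 1) r.
  by have := key 1; rewrite ltr01 lexx => /(_ isT); lra.
have G1 : 0 < G + 1 by rewrite ltr_wpDl.
have := key (r / (G + 1)); rewrite divr_gt0 //= ler_pdivrMr // mul1r (ltW h1).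
move=> /(_ isT); rewrite mulrAC ler_pdivlMr //; nra.
Qed.

(** * Caratheodory's theorem for cones *)

Section ConicCaratheodory.
Variables (R : realType) (J : finType) (G : (J -> R) -> Prop).
Hypothesis G0 : G (fun=> 0).
Hypothesis GZ : forall g (t : R), 0 <= t -> G g -> G (fun j => t * g j).

(** For a linear dependence [v] of the [g i] whose largest entry [v k1] is positive, the factors
    [1 - v i / v k1] are nonnegative, leave the sum unchanged and kill the term [k1]. *)
Lemma caratheodory_step m (g : 'I_m.+1 -> J -> R) :
  (#|J| < m.+1)%N -> (forall i, G (g i)) ->
  exists2 g' : 'I_m -> J -> R, (forall i, G (g' i)) &
    forall j, \sum_i g' i j = \sum_i g i j.
Proof.
move=> Jm Gg.
pose A : 'M[R]_(m.+1, #|J|) := \matrix_(i, k) g i (enum_val k).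
have [v vA [k0 vk0]] : exists2 v : 'rV_m.+1, v *m A = 0 & exists k, 0 < v 0 k.
  have : kermx A != 0.
    rewrite kermx_eq0 -row_leq_rank -ltnNge.
    exact: leq_ltn_trans (rank_leq_col A) Jm.
  move=> /rowV0Pn[v /sub_kermxP vA v0].
  have [k vk] : exists k, v 0 k != 0.
    apply/existsP; apply: contraNT v0 => /existsPn h.
    by apply/eqP/rowP => k; rewrite mxE; apply/eqP/negPn/h.
  have [vn|vp|/eqP] := ltgtP (v 0 k) 0; last by rewrite (negPf vk).
    by exists (- v); [rewrite mulNmx vA oppr0|exists k; rewrite mxE oppr_gt0].
  by exists v => //; exists k.
have vg j : \sum_i v 0 i * g i j = 0.
  transitivity ((v *m A) 0 (enum_rank j)); last by rewrite vA mxE.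
  by rewrite mxE; apply: eq_bigr => i _; rewrite mxE enum_rankK.
case: (@arg_maxP _ _ _ k0 xpredT (fun k => v 0 k)) => // k1 _ k1max.
have vk1 : 0 < v 0 k1 by apply: lt_le_trans vk0 (k1max _ _).
pose c i := 1 - v 0 i / v 0 k1.
have c0 i : 0 <= c i by rewrite subr_ge0 ler_pdivrMr // mul1r; exact: k1max.
exists (fun i j => c (lift k1 i) * g (lift k1 i) j) => [i|j].
  by apply: GZ.
transitivity (\sum_i c i * g i j).
  by rewrite [RHS](bigD1_ord k1) //= /c divff ?lt0r_neq0 // subrr mul0r add0r.
under eq_bigr do rewrite /c mulrBl mul1r mulrAC.
by rewrite sumrB -mulr_suml vg mul0r subr0.
Qed.

(** The number of terms is exactly [#|J|], with zeros as padding, so that [cone_nearest] can pass to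
    the limit in families of a fixed length. *)
Lemma caratheodory m (g : 'I_m -> J -> R) : (forall i, G (g i)) ->
  exists2 g' : 'I_#|J| -> J -> R, (forall i, G (g' i)) &
    forall j, \sum_i g' i j = \sum_i g i j.
Proof.
have pad N : forall m' (g : 'I_m' -> J -> R), (m' <= N)%N -> (forall i, G (g i)) ->
    exists2 g' : 'I_N -> J -> R, (forall i, G (g' i)) &
      forall j, \sum_i g' i j = \sum_i g i j.
  elim: N => [|N IH] m' g1 mN Gg.
    by move: g1 Gg; rewrite leqn0 in mN; rewrite (eqP mN) => g1 Gg; exists g1.
  case: m' => [|m'] in g1 mN Gg *.
    by exists (fun _ _ => 0) => // j; rewrite big_ord0 big1.
  have [g' Gg' sg'] := IH m' (fun i => g1 (lift ord0 i)) mN (fun i => Gg _).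
  exists (fun i => if unlift ord0 i is Some i' then g' i' else g1 ord0) => [i|j].
    by case: unliftP.
  rewrite !big_ord_recl unlift_none; congr (_ + _); rewrite -sg'.
  by apply: eq_bigr => i _; rewrite liftK.
elim: m g => [|m IH] g Gg; first exact: pad.
have [mJ|Jm] := leqP m.+1 #|J|; first exact: pad.
have [g1 Gg1 s1] := caratheodory_step Jm Gg.
by have [g2 Gg2 s2] := IH g1 Gg1; exists g2 => // j; rewrite s2.
Qed.

End ConicCaratheodory.

Section Duality.
Variables (R : realType) (d : nat) (K : set 'rV[R[i]^o]_d).
Hypothesis Kcompact : compact K.

Lemma compact_ucvg (T : Type) (U : set_system T) (UU : UltraFilter U)
    (mu : T -> 'rV[R[i]^o]_d) : (forall t, K (mu t)) ->
  exists2 nu, K nu & forall i, ucvg U (fun t => mu t 0 i) (nu 0 i).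
Proof.
move=> Kmu; have PU : ProperFilter U := @ultra_proper _ _ UU.
have [|nu Knu mnu] := @ultra_cvg_compact _ U UU _ _ mu Kcompact.
  exact: filterE.
exists nu => // i e e0; move/cvg_ballP: mnu => /(_ e%:C).
rewrite ltcR => /(_ e0); apply: filterS => t /= h.
have := h.2 0 i; rewrite -ball_normE /ball_ /= norm_cabs ltcR cabsB.
by [].
Qed.

(* The dual description of [Wmin K]. *)
Definition pencil_dominated n (X : 'I_d -> 'M[R[i]]_n) :=
  forall (q : 'I_n -> 'I_n -> R[i]) (y : 'I_d -> 'I_n -> 'I_n -> R[i]),
  (forall mu, K mu -> forall w : 'I_n -> R[i],
     Re (\sum_a \sum_b (q a b + \sum_i y i a b * mu 0 i) * (w b * (w a)^*)) <= 0) ->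
  Re (\sum_a \sum_b (q a b * (a == b)%:R + \sum_i y i a b * X i a b)) <= 0.

Section Cone.
Variable n : nat.
Notation idx := (option 'I_d * 'I_n * 'I_n)%type.
Implicit Types (mu : 'rV[R[i]^o]_d) (v : 'I_n -> R[i]) (k : idx).

Definition homog mu (o : option 'I_d) : R[i] := if o is Some i then mu 0 i else 1.

(** The coordinates of [(1, mu)] tensored with the rank-one matrix [v v^*]. A decomposition of [X]
    is a sum of such elements equal to [(I, X)]. *)
Definition cgen mu v k : R[i] := homog mu k.1.1 * (v k.1.2 * (v k.2)^*).

Definition rdim := #|{: idx * bool}|.

(** By Caratheodory's theorem one generator per real coordinate suffices, scalars being absorbed in
    [v]; a fixed number of generators is what allows limits. *)
Definition cone (c : idx -> R[i]) :=
  exists (mu : 'I_rdim -> 'rV[R[i]^o]_d) (v : 'I_rdim -> 'I_n -> R[i]),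
  (forall i : 'I_rdim, K (mu i)) /\ forall k, c k = \sum_i cgen (mu i) (v i) k.

Lemma cgenZ mu v (t : R) k : 0 <= t ->
  t%:C * cgen mu v k = cgen mu (fun a => (Num.sqrt t)%:C * v a) k.
Proof.
move=> t0; rewrite /cgen conjcM conjc_real -{1}(sqr_sqrtr t0) rmorphXn /=; ring.
Qed.

Lemma cone_sum m (mu : 'I_m -> 'rV[R[i]^o]_d) (v : 'I_m -> 'I_n -> R[i]) : K !=set0 ->
  (forall i, K (mu i)) -> cone (fun k => \sum_i cgen (mu i) (v i) k).
Proof.
move=> [mu0 K0] Kmu.
pose enc (c : idx -> R[i]) (j : idx * bool) := if j.2 then Re (c j.1) else Im (c j.1).
pose G (g : idx * bool -> R) := exists mu v, K mu /\ g = enc (cgen mu v).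
have G0 : G (fun=> 0).
  exists mu0, (fun=> 0); split=> //; apply: funext => -[k []];
  by rewrite /enc /cgen /= mul0r mulr0.
have GZ g t : 0 <= t -> G g -> G (fun j => t * g j).
  move=> t0 [mu1 [v1 [K1 ->]]]; exists mu1, (fun a => (Num.sqrt t)%:C * v1 a).
  split=> //; apply: funext => -[k []]; rewrite /enc /= -cgenZ //; first by rewrite ReMr.
  by rewrite ImMr.
have [|g' Gg' sg'] := @caratheodory R _ G G0 GZ m (fun i => enc (cgen (mu i) (v i))).
  by move=> i; exists (mu i), (v i).
have [mu' hmu'] := choice Gg'; have [v' hv'] := choice hmu'.
exists mu', v'; split=> [i|k]; first by case: (hv' i).
have := sg' (k, true); have := sg' (k, false); rewrite /enc /= => hI hR.
apply: complex_ext; rewrite !(Re_sum, Im_sum).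
  by rewrite -hR; apply: eq_bigr => i _; case: (hv' i) => _ ->.
by rewrite -hI; apply: eq_bigr => i _; case: (hv' i) => _ ->.
Qed.

Lemma cone_addZ c mu v (s t : R) : 0 <= s -> 0 <= t -> K mu -> cone c ->
  cone (fun k => s%:C * c k + t%:C * cgen mu v k).
Proof.
move=> s0 t0 Kmu [mu' [v' [K' c']]].
have := @cone_sum rdim.+1
  (fun i => if unlift ord0 i is Some i' then mu' i' else mu)
  (fun i => if unlift ord0 i is Some i' then (fun a => (Num.sqrt s)%:C * v' i' a)
            else (fun a => (Num.sqrt t)%:C * v a)) _ _.
have -> : (fun k => \sum_(i < rdim.+1) cgen
   (if unlift ord0 i is Some i' then mu' i' else mu)
   (if unlift ord0 i is Some i' then (fun a => (Num.sqrt s)%:C * v' i' a)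
            else (fun a => (Num.sqrt t)%:C * v a)) k) =
   (fun k => s%:C * c k + t%:C * cgen mu v k).
  apply: funext => k; rewrite big_ord_recl unlift_none -cgenZ // addrC; congr (_ + _).
  rewrite c' mulr_sumr; apply: eq_bigr => i _.
  by rewrite liftK -cgenZ.
apply; first by exists mu.
by move=> i; case: unliftP.
Qed.

(** Closedness of the cone, by compactness: along a minimizing sequence the points [mu] stay in [K]
    and the vectors [v] stay bounded, so that all of them have ultralimits. *)
Lemma cone_nearest (x : idx -> R[i]) : K !=set0 ->
  exists2 c, cone c & forall c', cone c' ->
    \sum_k csq (x k - c k) <= \sum_k csq (x k - c' k).
Proof.
move=> K0; have [mu0 Kmu0] := K0.
pose dist c := \sum_k csq (x k - c k).
pose D := [set dist c | c in cone].
have dist0 c : 0 <= dist c by apply: sumr_ge0 => k _; exact: csq_ge0.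
have D0 : D !=set0.
  exists (dist (fun k => \sum_(i < 0) cgen mu0 (fun=> 0) k)).
  by eexists; last reflexivity; apply: (@cone_sum 0 (fun=> mu0) (fun _ _ => 0)).
have lD : lbound D 0 by move=> _ [c _ <-].
pose q (n : nat) : R := n.+1%:R^-1.
have q0 m : 0 < q m by rewrite invr_gt0 ltr0n.
have near_inf m : exists p : ('I_rdim -> 'rV[R[i]^o]_d) * ('I_rdim -> 'I_n -> R[i]),
    (forall i, K (p.1 i)) /\ dist (fun k => \sum_i cgen (p.1 i) (p.2 i) k) < inf D + q m.
  have [_ [c [mu [v [Kmu hc]]] <-] h] := @inf_adherent R D (q m) (q0 m) (conj D0 (ex_intro _ 0 lD)).
  exists (mu, v); split=> //=.
  by have <- : c = fun k => \sum_i cgen (mu i) (v i) k by apply: funext.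
have [p hp] := choice near_inf.
have := even_ultra_ultra; set U := even_ultra => UU.
have PU : ProperFilter U := @ultra_proper _ _ UU.
have [nu Knu] : exists2 nu : 'I_rdim -> 'rV_d, (forall i, K (nu i)) &
    forall i j, ucvg U (fun m => (p m).1 i 0 j) (nu i 0 j).
  have h i : exists nu, K nu /\ forall j, ucvg U (fun m => (p m).1 i 0 j) (nu 0 j).
    have [|nu Kn hn] := @compact_ucvg _ U UU (fun m => (p m).1 i); last by exists nu.
    by move=> m; case: (hp m).
  by have [nu hnu] := choice h; exists nu => i; case: (hnu i).
move=> hnu.
have [w hw] : exists w : 'I_rdim -> 'I_n -> R[i],
    forall i a, ucvg U (fun m => (p m).2 i a) (w i a).
  suff h (ia : 'I_rdim * 'I_n) : exists w, ucvg U (fun m => (p m).2 ia.1 ia.2) w.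
    by have [w hw] := choice h; exists (fun i a => w (i, a)) => i a; exact: hw (i, a).
  case: ia => i a /=.
  (* At this coordinate a generator equals [|v a|^2]; nothing cancels in the sum, so a bound on the
     sum bounds each [v i a]. *)
  pose k : idx := (None, a, a).
  apply: (@ultra_cvg _ _ U _ _ (cabs (x k) + (inf D + q 0) + 2)); apply: filterE => m /=.
  have [_ hd] := hp m.
  have hS : cabs (\sum_i cgen ((p m).1 i) ((p m).2 i) k) <= cabs (x k) + (inf D + q 0) + 1.
    have h1 : csq (x k - \sum_i cgen ((p m).1 i) ((p m).2 i) k) <= inf D + q 0.
      apply: le_trans (_ : inf D + q m <= _).
        apply: le_trans (ltW hd); rewrite /dist (bigD1 k) //= lerDl.
        by apply: sumr_ge0 => j _; exact: csq_ge0.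
      by rewrite lerD2l /q lef_pV2 ?posrE ?ltr0n // ler_nat.
    set S := \sum_i _ in h1 *.
    have h2 : cabs (x k - S) <= inf D + q 0 + 1.
      by rewrite -sqr_cabs in h1; have := cabs_ge0 (x k - S); nra.
    rewrite -[S](subrK (x k)) addrC -addrA; apply: le_trans (cabsD _ _) _.
    by rewrite lerD2l cabsB.
  have h3 : csq ((p m).2 i a) <= cabs (\sum_i cgen ((p m).1 i) ((p m).2 i) k).
    apply: le_trans (ler_norm _) _; apply: le_trans (Re_le_cabs _).
    have e j : Re (cgen ((p m).1 j) ((p m).2 j) k) = csq ((p m).2 j a).
      by rewrite /cgen /= mul1r mulcJ.
    rewrite Re_sum (eq_bigr _ (fun j _ => e j)) !ger0_norm ?csq_ge0 //.
      by rewrite (bigD1 i) //= lerDl; apply: sumr_ge0 => j _; exact: csq_ge0.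
    by apply: sumr_ge0 => j _; exact: csq_ge0.
  have h4 := le_trans h3 hS; rewrite -sqr_cabs in h4.
  by have := cabs_ge0 ((p m).2 i a); nra.
pose c k := \sum_i cgen (nu i) (w i) k.
have cc : cone c by exists nu, w.
have hc k : ucvg U (fun m => \sum_i cgen ((p m).1 i) ((p m).2 i) k) (c k).
  apply: ucvg_sum => i; apply: ucvgM.
    by case: k.1.1 => [j|] /=; [exact: hnu|exact: ucvg_cst].
  by apply: ucvgM => //; apply: ucvgJ.
exists c => // c' hc'.
have le_dc : dist c <= inf D.
  apply/ler_addgt0Pr => e e0.
  have : ucvg U (fun m => \sum_k (x k - \sum_i cgen ((p m).1 i) ((p m).2 i) k) *
      (x k - \sum_i cgen ((p m).1 i) ((p m).2 i) k)^*) (\sum_k (x k - c k) * (x k - c k)^*).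
    apply: ucvg_sum => k; apply: ucvgM; last apply: ucvgJ.
      by apply: ucvgB; [exact: ucvg_cst|exact: hc].
    by apply: ucvgB; [exact: ucvg_cst|exact: hc].
  move=> hcv; have := @ucvg_Re_le _ _ U _ _ _ (inf D + e) hcv.
  rewrite Re_sum; under eq_bigr do rewrite mulcJ /=.
  apply; apply: filterS (even_ultra_eventually (Num.bound e^-1)) => m /= [em _].
  rewrite Re_sum; under eq_bigr do rewrite mulcJ /=.
  apply: le_trans (ltW (hp m).2) _; rewrite lerD2l /q.
  rewrite -[e]invrK lef_pV2 ?posrE ?invr_gt0 ?ltr0n //.
  apply: ltW; apply: lt_le_trans (archi_boundP _) _; first by rewrite invr_ge0 ltW.
  by rewrite ler_nat (leq_trans em).
apply: le_trans le_dc _; apply: ge_inf; first by exists 0.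
by exists c'.
Qed.

(** Separation by the nearest point [c] of the cone. The residual [y = x - c] is, up to conjugation,
    a pencil that is nonpositive on [K], so domination gives [<x, y> <= 0]; since [c] can be shrunk
    inside the cone, [<c, y> >= 0]. Hence [|y|^2 <= 0]. *)
Lemma pencil_dominated_decomposition (X : 'I_d -> 'M[R[i]]_n) : K !=set0 ->
  pencil_dominated X -> exists (m : nat) (mu : 'I_m -> 'rV[R[i]^o]_d) (v : 'I_m -> 'I_n -> R[i]),
  [/\ forall j, K (mu j),
      forall a b, \sum_j v j a * (v j b)^* = (a == b)%:R &
      forall i a b, \sum_j mu j 0 i * (v j a * (v j b)^*) = X i a b].
Proof.
move=> K0 PX.
pose x k := if k.1.1 is Some i then X i k.1.2 k.2 else (k.1.2 == k.2)%:R : R[i].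
have [c cc cmin] := cone_nearest x K0.
pose y k := x k - c k.
have polar (g : idx -> R[i]) : (forall s : R, 0 < s <= 1 -> cone (fun k => c k + s%:C * g k)) ->
    Re (\sum_k (y k)^* * g k) <= 0.
  move=> hg; apply: nearest_polar => s s01; have := cmin _ (hg s s01).
  by under [X in _ <= X]eq_bigr do rewrite opprD addrA.
have ygen mu v : K mu -> Re (\sum_k (y k)^* * cgen mu v k) <= 0.
  move=> Kmu; apply: polar => s /andP[s0 _].
  have := cone_addZ v ler01 (ltW s0) Kmu cc.
  by congr cone; apply: funext => k; rewrite mul1r.
have yc : 0 <= Re (\sum_k (y k)^* * c k).
  suff : Re (\sum_k (y k)^* * - c k) <= 0.
    by under eq_bigr do rewrite mulrN; rewrite sumrN ReN oppr_le0.
  (* [(1 - s) c] lies in the cone; a generator of weight 0 fits it into [cone_addZ]. *)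
  apply: polar => s /andP[s0 s1]; have [mu0 Kmu0] := K0.
  have s2 : 0 <= 1 - s by rewrite subr_ge0.
  have := cone_addZ (fun=> 0) s2 (lexx 0) Kmu0 cc.
  congr cone; apply: funext => k.
  by rewrite mul0r addr0 rmorphB /= mulrBl mul1r mulrN.
have flat (g : idx -> R[i]) : \sum_k g k =
    \sum_a \sum_b (g (None, a, b) + \sum_i g (Some i, a, b)).
  transitivity (\sum_a \sum_b \sum_o g (o, a, b)).
    transitivity (\sum_p \sum_b g (p, b)).
      by rewrite [RHS]pair_bigA; apply: eq_bigr => -[].
    transitivity (\sum_o \sum_a \sum_b g (o, a, b)).
      by rewrite [RHS]pair_bigA; apply: eq_bigr => -[].
    by rewrite exchange_big; apply: eq_bigr => a _; rewrite exchange_big.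
  apply: eq_bigr => a _; apply: eq_bigr => b _.
  by rewrite big_option_sum.
have xy0 : Re (\sum_k (y k)^* * x k) <= 0.
  rewrite flat; under eq_bigr do under eq_bigr do rewrite /x /=.
  apply: (PX (fun a b => (y (None, a, b))^*) (fun i a b => (y (Some i, a, b))^*)) => mu Kmu w.
  have := ygen mu (fun a => (w a)^*) Kmu; rewrite flat; congr (Re _ <= 0).
  apply: eq_bigr => a _; apply: eq_bigr => b _.
  rewrite /cgen /= conjcK mul1r mulrDl mulr_suml [w b * _]mulrC; congr (_ + _).
  by apply: eq_bigr => i _; rewrite mulrA.
have y0 k : y k = 0.
  have : \sum_k csq (y k) <= 0.
    have -> : \sum_k csq (y k) = Re (\sum_k (y k)^* * x k) - Re (\sum_k (y k)^* * c k).
      rewrite -ReB -sumrB Re_sum; apply: eq_bigr => j _.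
      by rewrite -mulrBr mulrC mulcJ.
    by rewrite subr_le0 (le_trans xy0).
  rewrite (bigD1 k) //= => h; apply/eqP; rewrite -csq_eq0 eq_le csq_ge0 andbT.
  by apply: le_trans h; rewrite lerDl; apply: sumr_ge0 => j _; exact: csq_ge0.
case: cc => mu [v [Kmu hc]]; exists rdim, mu, v; split=> // [a b|i a b].
  have /eqP := y0 (None, a, b); rewrite subr_eq0 /x /= => /eqP ->; rewrite hc.
  by apply: eq_bigr => j _; rewrite /cgen /= mul1r.
by have /eqP := y0 (Some i, a, b); rewrite subr_eq0 /x /= => /eqP ->; rewrite hc.
Qed.

End Cone.
End Duality.

(** * Diagonal dilations and their joint spectrum *)

Section CstarFacts.
Variables (R : realType) (d : nat) (H : hilbertType R) (N : 'I_d -> 'B(H)).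

Lemma Cstar_unital : unital_Cstar_subalgebra (Cstar N).
Proof.
split=> [A [[]]//|a S T hS hT A hA|S T hS hT A hA|S T ST hS A hA|T hT A hA].
- by case: (hA) => -[_ h _ _ _ _]; apply: h; [exact: hS|exact: hT].
- by case: (hA) => -[_ _ h _ _ _]; apply: h; [exact: hS|exact: hT].
- by case: (hA) => -[_ _ _ h _ _]; apply: h ST (hS _ hA).
- case: (hA) => -[_ _ _ _ h _]; apply: h => e e0.
  by have [S hS TS] := hT e e0; exists S => //; exact: hS.
Qed.

Lemma Cstar_gen i : Cstar N (N i).
Proof. by move=> A [_]; apply. Qed.

End CstarFacts.

Section Dilation.
Variables (R : realType) (d n m : nat).
Variables (mu : 'I_m -> 'rV[R[i]^o]_d) (v : 'I_m -> 'I_n -> R[i]) (j0 : 'I_m).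
Hypothesis hv : forall a b, \sum_j v j a * (v j b)^* = (a == b)%:R.

(** Coordinates from [m] on repeat [mu j0]; padding by 0 could add a point outside [K] to the
    spectrum. *)
Let nu (k : nat) : 'I_m := odflt j0 (insub k).
Let B : R := \sum_j \sum_i csq (mu j 0 i).

Let nuE (j : 'I_m) : nu j = j.
Proof. by rewrite /nu valK. Qed.

Let nu_bound i k : csq (mu (nu k) 0 i) <= B.
Proof.
have h j : 0 <= \sum_i csq (mu j 0 i) by apply: sumr_ge0 => i' _; exact: csq_ge0.
rewrite /B (bigD1 (nu k)) //= (bigD1 i) //= -addrA lerDl.
by rewrite addr_ge0 ?sumr_ge0 // => ? _; exact: csq_ge0.
Qed.

Let zero_bound (k : nat) : csq (0 : R[i]) <= B.
Proof. by rewrite csqr expr0n; do 2! apply: sumr_ge0 => ? _; exact: csq_ge0. Qed.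

Let N i : 'B(ell2 R) := blkop (nu_bound i) zero_bound.

Let NE i x k : N i x k = mu (nu k) 0 i * x k.
Proof. by rewrite blkopE mul0r addr0. Qed.

Let N_normal : normal_tuple N.
Proof.
split=> [i|i j].
  exists (adj (N i)); first exact: adjP.
  apply: bop_ext => x; apply: ell2_ext => k; rewrite !bopME NE !adj_blkopE.
  by rewrite conjc0 !mul0r !addr0 NE mulrCA.
by apply: bop_ext => x; apply: ell2_ext => k; rewrite !bopME !NE mulrCA.
Qed.

(** If [l] differs from every [mu j] at some coordinate [p j], the product of the operators
    [N (p j) - mu j 0 (p j)] is zero, because each diagonal entry contains a vanishing factor,
    whereas a character sends it to a nonzero number. *)
Let N_spectrum l : joint_spectrum N l -> exists j, l = mu j.
Proof.
move=> [chi [chi1 chiD chiM] hl]; have [C1 CD CM _ _] := Cstar_unital N.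
have C0 : Cstar N 0.
  by have := CD (-1) _ _ C1 C1; rewrite scaleN1r addNr.
have chi0 : chi 0 = 0.
  by have := chiD (-1) _ _ C1 C1; rewrite scaleN1r addNr mulN1r addNr.
have CB i (c : R[i]) : Cstar N (N i - c *: bop1 _) /\
    chi (N i - c *: bop1 _) = chi (N i) - c.
  rewrite addrC -scaleNr; split; first by apply: CD => //; exact: Cstar_gen.
  by rewrite chiD // ?chi1 ?mulr1 1?addrC //; exact: Cstar_gen.
apply: contrapT => /forallNP hne.
have ex j : exists i, l 0 i != mu j 0 i.
  apply/existsP; apply: contraT => /existsPn h.
  by case: (hne j); apply/rowP => i; apply/eqP; have := h i; rewrite negbK.
have [p hp] := choice ex.
pose P s : 'B(ell2 R) := foldr (fun j T => bopM (N (p j) - mu j 0 (p j) *: bop1 _) T) (bop1 _) s.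
have CP s : Cstar N (P s) /\ chi (P s) = \prod_(j <- s) (l 0 (p j) - mu j 0 (p j)).
  elim: s => [|j s [IH1 IH2]]; first by rewrite big_nil.
  have [h1 h2] := CB (p j) (mu j 0 (p j)).
  by split; [exact: CM|rewrite /= chiM // h2 IH2 big_cons hl].
have PE s x k : P s x k = \prod_(j <- s) (mu (nu k) 0 (p j) - mu j 0 (p j)) * x k.
  elim: s => [|j s IH]; first by rewrite big_nil mul1r.
  rewrite big_cons -[P (j :: s)]/(bopM (N (p j) - mu j 0 (p j) *: bop1 _) (P s)).
  rewrite bopME bop_subE ell2B NE bop_scaleE bop1E ell2Z IH; ring.
have P0 : P (enum 'I_m) = 0.
  apply: bop_ext => x; apply: ell2_ext => k; rewrite PE.
  by rewrite (bigD1_seq (nu k)) ?mem_enum ?enum_uniq //= subrr !mul0r.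
have [_] := CP (enum 'I_m); rewrite P0 chi0 => /esym/eqP.
apply/negP; rewrite prodf_seq_neq0; apply/allP => j _ /=.
by rewrite subr_eq0; exact: hp.
Qed.

(** The analysis operator of the family [v], which [hv] makes a Parseval frame; thus [V] is an
    isometry, and [W] is its adjoint. *)
Let V_fun (x : 'cV[R[i]]_n) : ell2 R :=
  \sum_j (\sum_a (v j a)^* * x a 0) *: ell2_basis R j.

Let V_linear : linear V_fun.
Proof.
move=> c x y; rewrite /V_fun scaler_sumr -big_split /=; apply: eq_bigr => j _.
rewrite scalerA -scalerDl mulr_sumr -big_split /=; congr (_ *: _).
by apply: eq_bigr => a _; rewrite !mxE; ring.
Qed.

Let V : {linear 'cV[R[i]]_n -> ell2 R} :=
  HB.pack V_fun (GRing.isLinear.Build _ _ _ _ V_fun V_linear).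

Let W (z : ell2 R) : 'cV[R[i]]_n := \col_a \sum_j z (j : 'I_m) * v j a.

Let VE x (j : 'I_m) : V x j = \sum_a (v j a)^* * x a 0.
Proof.
rewrite -inner_ell2_basis inner_suml (bigD1 j) // -[RHS]addr0; congr (_ + _).
  by rewrite innerZl inner_ell2_basis ell2_basisE eqxx mulr1.
apply: big1 => k kj.
by rewrite innerZl inner_ell2_basis ell2_basisE eq_sym (inj_eq val_inj) (negPf kj) mulr0.
Qed.

Let V_adjoint x z : inner (V x) z = cdot x (W z).
Proof.
rewrite inner_suml /cdot; under eq_bigr do rewrite innerZl inner_basis_ell2 mulr_suml.
rewrite exchange_big /=; apply: eq_bigr => a _.
rewrite mxE conjc_sum mulr_sumr; apply: eq_bigr => j _; rewrite conjcM; ring.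
Qed.

Lemma diagonal_dilation (X : 'I_d -> 'M[R[i]]_n) :
  (forall i a b, \sum_j mu j 0 i * (v j a * (v j b)^*) = X i a b) ->
  exists N : 'I_d -> 'B(ell2 R), [/\ normal_tuple N,
    (forall l, joint_spectrum N l -> exists j, l = mu j) & dilation N X].
Proof.
move=> hX; exists N; split; [exact: N_normal|exact: N_spectrum|].
have WV x : W (V x) = x.
  apply/colP => a; rewrite mxE; under eq_bigr do rewrite VE mulr_suml.
  rewrite exchange_big /= (bigD1 a) //= [X in _ + X]big1 => [|b ba].
    rewrite addr0; under eq_bigr do rewrite mulrAC.
    rewrite -mulr_suml; under eq_bigr do rewrite mulrC.
    by rewrite hv eqxx mul1r.
  under eq_bigr do rewrite mulrAC.
  rewrite -mulr_suml; under eq_bigr do rewrite mulrC.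
  by rewrite hv eq_sym (negPf ba) mul0r.
exists V, W; split=> [x|x z|i x].
- by rewrite sqr_normE V_adjoint WV.
- exact: V_adjoint.
- apply/colP => a; rewrite !mxE.
  under [RHS]eq_bigr do rewrite NE nuE VE mulr_sumr mulr_suml.
  rewrite exchange_big /=; apply: eq_bigr => b _.
  by rewrite -hX mulr_suml; apply: eq_bigr => j _; ring.
Qed.
End Dilation.

Section RangeOfPencils.
Variables (R : realType) (d : nat) (K : set 'rV[R[i]^o]_d).

Lemma Wmin_of_decomposition n m (X : 'I_d -> 'M[R[i]]_n.+1)
    (mu : 'I_m -> 'rV[R[i]^o]_d) (v : 'I_m -> 'I_n.+1 -> R[i]) :
  (forall j, K (mu j)) ->
  (forall a b, \sum_j v j a * (v j b)^* = (a == b)%:R) ->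
  (forall i a b, \sum_j mu j 0 i * (v j a * (v j b)^*) = X i a b) ->
  Wmin K (existT _ n X).
Proof.
(* The diagonal tuple needs some [mu j0] as padding; [m = 0] is impossible since an empty sum is not
   the identity matrix. *)
move=> Kmu hv hX; case: m => [|m] in mu v Kmu hv hX *.
  by have := hv 0 0; rewrite big_ord0 eqxx => /esym/eqP; rewrite oner_eq0.
have [N [N1 N2 N3]] := diagonal_dilation ord0 hv hX.
exists (ell2 R), N; split=> // l /N2[j ->]; exact: Kmu.
Qed.

Lemma Wmin_of_pencils n (X : 'I_d -> 'M[R[i]]_n.+1) : compact K -> K !=set0 ->
  pencil_dominated K X -> Wmin K (existT _ n X).
Proof.
move=> Kc K0 /(pencil_dominated_decomposition Kc K0)[m [mu [v [h1 h2 h3]]]].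
exact: Wmin_of_decomposition h1 h2 h3.
Qed.

End RangeOfPencils.

(** * Pencils under unital completely positive maps *)

Section UcpPencils.
Variables (R : realType) (d n : nat) (H : hilbertType R) (T : 'I_d -> 'B(H)).
Variable psi : {linear 'B(H) -> 'M[R[i]]_n}.
Hypothesis psi_ucp : ucp psi.

Definition pencil (q : 'I_n -> 'I_n -> R[i]) (y : 'I_d -> 'I_n -> 'I_n -> R[i])
    (xi : 'I_n -> H) : R[i] :=
  \sum_a \sum_b (q a b * inner (xi b) (xi a)
                 + \sum_i y i a b * inner (T i (xi b)) (xi a)).

Lemma cdot_delta (A : 'M[R[i]]_n) a b : cdot (A *m delta_mx b 0) (delta_mx a 0) = A a b.
Proof.
rewrite /cdot (bigD1 a) //= big1 => [|c ca].
  rewrite !mxE !eqxx addr0 conjc1 mulr1 (bigD1 b) //= big1 => [|e eb].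
    by rewrite !mxE !eqxx addr0 mulr1.
  by rewrite !mxE (negPf eb) mulr0.
by rewrite !mxE (negPf ca) andFb conjc0 mulr0.
Qed.

Lemma cdotZr (c : R[i]) (x y : 'cV[R[i]]_n) : cdot x (c *: y) = c^* * cdot x y.
Proof.
by rewrite /cdot mulr_sumr; apply: eq_bigr => a _; rewrite !mxE conjcM mulrCA.
Qed.
Lemma cdotZl (c : R[i]) (x y : 'cV[R[i]]_n) : cdot (c *: x) y = c * cdot x y.
Proof. by rewrite /cdot mulr_sumr; apply: eq_bigr => a _; rewrite !mxE mulrA. Qed.
Lemma cdotDr (x y z : 'cV[R[i]]_n) : cdot z (x + y) = cdot z x + cdot z y.
Proof.
by rewrite /cdot -big_split; apply: eq_bigr => a _; rewrite !mxE conjcD mulrDr.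
Qed.
Lemma cdotDl (x y z : 'cV[R[i]]_n) : cdot (x + y) z = cdot x z + cdot y z.
Proof. by rewrite /cdot -big_split; apply: eq_bigr => a _; rewrite !mxE mulrDl. Qed.

Lemma ucp_positive (S : 'B(H)) : (forall x, 0 <= inner (S x) x) ->
  forall w, 0 <= cdot (psi S *m w) w.
Proof.
move=> S0 w; have := psi_ucp.2 1%N (fun _ _ => S) _ (fun=> w).
rewrite !big_ord1; apply=> x; rewrite !big_ord1; exact: S0.
Qed.

(** A multiple of the identity makes the form of [S] nonnegative and changes the value by a real
    number only. *)
Lemma ucp_hermitian (S : 'B(H)) : (forall x, Im (inner (S x) x) = 0) ->
  forall w, Im (cdot (psi S *m w) w) = 0.
Proof.
move=> S0 w; have [M M0 hM] := bop_bounded S.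
have h : forall x, 0 <= inner ((S + M%:C *: bop1 H) x) x.
  move=> x; rewrite bop_addE innerDl bop_scaleE innerZl bop1E inner_self.
  rewrite lecE /= ImD S0 ImM /= !mul0r mulr0 !addr0 eqxx ReD ReMr /=.
  have := Re_le_cabs (inner (S x) x); have := cauchy_schwarz (S x) x.
  have := hM x; have := nrm_ge0 x; rewrite -sqr_nrm ler_norml => h1 h2 h3 /andP[h4 _].
  nra.
have h1 : forall x, 0 <= inner ((M%:C *: bop1 H) x) x.
  by move=> x; rewrite bop_scaleE innerZl bop1E inner_self -rmorphM ler0c mulr_ge0 ?nsq_ge0.
have := ucp_positive h w; have := ucp_positive h1 w.
rewrite raddfD mulmxDl cdotDl => /ger0_Im i1 /ger0_Im.
by rewrite ImD i1 addr0.
Qed.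

Lemma ucp_adjoint (S : 'B(H)) a b : psi (adj S) a b = (psi S b a)^*.
Proof.
have herm (A : 'M[R[i]]_n) : (forall w, Im (cdot (A *m w) w) = 0) -> A a b = (A b a)^*.
  move=> h.
  (* Polarization; [c = 1] and [c = i] together determine the entry. *)
  have hs c : Im (c * A a b + c^* * A b a) = 0.
    have := h (c *: delta_mx b 0 + delta_mx a 0).
    rewrite mulmxDr -scalemxAr cdotDl !cdotDr !cdotZl !cdotZr !cdot_delta !ImD.
    have := h (delta_mx b 0); have := h (delta_mx a 0); rewrite !cdot_delta => h1 h2.
    rewrite mulrA mulcJ ImMr h2 h1; lra.
  have := hs 1; have := hs 'i%C; rewrite !ImD !ImM !ReJ !ImJ /= => h1 h2.
  by apply: complex_ext; rewrite ?ReJ ?ImJ; lra.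
pose S1 := S + adj S; pose S2 := 'i%C *: (S - adj S).
have h1 : forall x, Im (inner (S1 x) x) = 0.
  by move=> x; rewrite bop_addE innerDl adjl [inner x _]innerJ ImD ImJ subrr.
have h2 : forall x, Im (inner (S2 x) x) = 0.
  move=> x; rewrite bop_scaleE bop_subE innerZl innerBl adjl [inner x _]innerJ.
  by rewrite ImM ReB ImB ReJ ImJ /=; ring.
have := herm _ (ucp_hermitian h1); have := herm _ (ucp_hermitian h2).
have p1 : psi S1 = psi S + psi (adj S) by exact: raddfD.
have p2 : psi S2 = 'i%C *: (psi S - psi (adj S)) by rewrite linearZ /= raddfB.
rewrite p1 p2 !mxE => e1 e2.
have e1r := congr1 (@complex.Re R) e1; have e1i := congr1 (@complex.Im R) e1.
have e2r := congr1 (@complex.Re R) e2; have e2i := congr1 (@complex.Im R) e2.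
rewrite !(ReD, ImD, ReN, ImN, ReM, ImM, ReJ, ImJ) /= in e1r e1i e2r e2i.
apply: complex_ext; rewrite ?ReJ ?ImJ; lra.
Qed.

(** Minus twice the real part of the operator matrix [Y] is positive, and complete positivity of
    order [n] transports it. Testing the image at the tuple of basis vectors [(e_1, ..., e_n)]
    leaves only the entries [(a, b)] of the block [(a, b)], hence the entrywise pairing in
    [pencil_dominated]. *)
Lemma ucp_pencil (q : 'I_n -> 'I_n -> R[i]) (y : 'I_d -> 'I_n -> 'I_n -> R[i]) :
  (forall xi, Re (pencil q y xi) <= 0) ->
  Re (\sum_a \sum_b (q a b * (a == b)%:R + \sum_i y i a b * psi (T i) a b)) <= 0.
Proof.
move=> hp.
pose Y a b : 'B(H) := q a b *: bop1 H + \sum_i y i a b *: T i.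
have YE a b : psi (Y a b) a b = q a b * (a == b)%:R + \sum_i y i a b * psi (T i) a b.
  rewrite /Y linearP psi_ucp.1 linear_sum !mxE summxE; congr (_ + _).
  by apply: eq_bigr => i _; rewrite linearZ_LR mxE.
have YH xi : \sum_a \sum_b inner (Y a b (xi b)) (xi a) = pencil q y xi.
  apply: eq_bigr => a _; apply: eq_bigr => b _.
  rewrite bop_addE innerDl bop_scaleE innerZl bop1E bop_sumE inner_suml; congr (_ + _).
  by apply: eq_bigr => i _; rewrite bop_scaleE innerZl.
have [P PE psiP] : exists2 P : 'I_n -> 'I_n -> 'B(H),
    (forall a b x z, inner (P a b x) z = - (inner (Y a b x) z + (inner (Y b a z) x)^*)) &
    (forall a b, psi (P a b) a b = - (psi (Y a b) a b + (psi (Y b a) b a)^*)).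
  exists (fun a b => - (Y a b + adj (Y b a))) => [a b x z|a b].
    by rewrite bop_oppE innerNl bop_addE innerDl adjl [inner x _]innerJ.
  by rewrite raddfN raddfD !mxE ucp_adjoint.
have sumJ (f : 'I_n -> 'I_n -> R[i]) : \sum_a \sum_b - (f a b + (f b a)^*) =
    - (\sum_a \sum_b f a b + (\sum_a \sum_b f a b)^*).
  rewrite conjc_sum [X in _ = - (_ + X)](eq_bigr (fun a => \sum_b (f a b)^*)).
    rewrite [X in _ = - (_ + X)]exchange_big -big_split -sumrN; apply: eq_bigr => a _.
    by rewrite -big_split -sumrN.
  by move=> a _; rewrite conjc_sum.
have P0 : bop_mx_positive P.
  move=> xi; under eq_bigr do under eq_bigr do rewrite PE.
  rewrite (sumJ (fun a b => inner (Y a b (xi b)) (xi a))) YH.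
  have -> : - (pencil q y xi + (pencil q y xi)^*) = (- 2 * Re (pencil q y xi))%:C.
    by apply: complex_ext; rewrite ?ReN ?ImN ?ReD ?ImD ?ReJ ?ImJ /=; ring.
  by rewrite ler0c mulNr oppr_ge0 mulr_ge0_le0.
have := psi_ucp.2 n P P0 (fun a => delta_mx a 0).
under eq_bigr do under eq_bigr do rewrite cdot_delta psiP.
rewrite (sumJ (fun a b => psi (Y a b) a b)).
rewrite lecE /= => /andP[_]; rewrite ReN ReD ReJ.
have -> : \sum_a \sum_b psi (Y a b) a b =
    \sum_a \sum_b (q a b * (a == b)%:R + \sum_i y i a b * psi (T i) a b).
  by apply: eq_bigr => a _; apply: eq_bigr => b _; rewrite YE.
lra.
Qed.

End UcpPencils.

(** * States and matrix ranges *)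

Section States.
Variables (R : realType) (d : nat) (H : hilbertType R) (T : 'I_d -> 'B(H)).
Implicit Types (phi : 'B(H) -> R[i]) (S : 'B(H)).

(** The last clause bounds [phi] by the numerical radius and provides the boundedness needed for
    ultralimits of states. *)
Definition state phi := [/\ phi (bop1 H) = 1,
  (forall a S S', phi (a *: S + S') = a * phi S + phi S'),
  (forall S, (forall x, 0 <= inner (S x) x) -> 0 <= phi S) &
  (forall S (M : R), (forall x, cabs (inner (S x) x) <= M * nsq x) -> cabs (phi S) <= M)].

Lemma vector_state x : nsq x = 1 -> state (fun S => inner (S x) x).
Proof.
move=> x1; split=> [|a S S'|S hS|S M hS]; last by rewrite -(mulr1 M) -x1.
- by rewrite bop1E inner_self x1.
- by rewrite bop_addE innerDl bop_scaleE innerZl.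
- exact: hS.
Qed.

Lemma convex_state phi phi' (s : R) : 0 <= s <= 1 -> state phi -> state phi' ->
  state (fun S => (1 - s)%:C * phi S + s%:C * phi' S).
Proof.
case/andP=> s0 s1 [h1 h2 h3 h4] [k1 k2 k3 k4].
have s2 : 0 <= 1 - s by rewrite subr_ge0.
split=> [|a S S'|S hS|S M hS].
- by rewrite h1 k1 !mulr1 -rmorphD subrK.
- rewrite h2 k2; ring.
- by rewrite addr_ge0 // mulr_ge0 ?ler0c ?h3 ?k3.
- apply: le_trans (cabsD _ _) _; rewrite !cabsM !cabsr !ger0_norm //.
  have -> : M = (1 - s) * M + s * M by ring.
  by apply: lerD; rewrite ler_wpM2l ?h4 ?k4.
Qed.

Lemma limit_state (U : set_system nat) (UU : UltraFilter U) (phi : nat -> 'B(H) -> R[i]) :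
  (forall n, state (phi n)) ->
  state (fun S => clim U (fun n => phi n S)) /\
  forall S, ucvg U (fun n => phi n S) (clim U (fun n => phi n S)).
Proof.
move=> hphi; have PU : ProperFilter U := @ultra_proper _ _ UU.
have hc S : ucvg U (fun n => phi n S) (clim U (fun n => phi n S)).
  have [M M0 hM] := bop_bounded S.
  apply: (@clim_cvg _ _ _ _ _ M); apply: filterE => n /=; case: (hphi n) => _ _ _; apply=> x.
  apply: le_trans (cauchy_schwarz _ _) _; rewrite -sqr_nrm expr2 mulrA.
  by rewrite ler_wpM2r ?nrm_ge0.
split=> //; split=> [|a S S'|S hS|S M hS].
- by apply: clim_eq; apply: ucvg_ext (ucvg_cst 1); apply: filterE => n /=; case: (hphi n).
- apply: clim_eq; apply: ucvg_ext (ucvgD (ucvgM (ucvg_cst a) (hc S)) (hc S')).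
  by apply: filterE => n /=; case: (hphi n) => _ ->.
- have h n : 0 <= phi n S by case: (hphi n) => _ _ + _; apply.
  have hJ : clim U (fun n => phi n S) = (clim U (fun n => phi n S))^*.
    apply: clim_eq; apply: ucvg_ext (ucvgJ (hc S)); apply: filterE => n /=.
    by apply: complex_ext; rewrite ?ReJ ?ImJ // (ger0_Im (h n)) oppr0.
  have hI := congr1 (@complex.Im R) hJ; rewrite ImJ in hI.
  rewrite lecE /=; apply/andP; split; first by apply/eqP; lra.
  apply: ucvg_Re_ge (hc S) _; apply: filterE => n /=.
  by have := h n; rewrite lecE => /andP[].
- apply: ucvg_cabs_le (hc S) _; apply: filterE => n /=.
  by case: (hphi n) => _ _ _; apply.
Qed.

Variable K : set 'rV[R[i]^o]_d.

(* Equality of the support functions of [K] and of the numerical range. *)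
Definition supports_range := forall (alpha : 'I_d -> R[i]) mu (e : R), K mu -> 0 < e ->
  exists2 x, nsq x = 1 &
    Re (\sum_i alpha i * mu 0 i) - e <= Re (\sum_i alpha i * inner (T i x) x).

Hypothesis Tsup : supports_range.

(** The joint numerical range of a tuple need be neither convex nor closed, so the point is sought
    among states. A state [phi] closest to [mu] exists as an ultralimit; optimality against vector
    states says that the residual, as a functional, is maximal at [phi] over the numerical range,
    while [Tsup] says that it comes close to its value at [mu]. So the residual vanishes. *)
Lemma state_at mu : K mu -> exists2 phi, state phi & forall i, phi (T i) = mu 0 i.
Proof.
move=> Kmu.
pose dist phi := \sum_i csq (mu 0 i - phi (T i)).
pose D := [set dist phi | phi in state].
have dist0 phi : 0 <= dist phi by apply: sumr_ge0 => k _; exact: csq_ge0.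
have D0 : D !=set0.
  have [x x1 _] := Tsup (fun=> 0) Kmu ltr01.
  by eexists; eexists; first exact: vector_state x1.
have lD : lbound D 0 by move=> _ [c _ <-].
pose q (n : nat) : R := n.+1%:R^-1.
have q0 m : 0 < q m by rewrite invr_gt0 ltr0n.
have near_inf m : exists phi, state phi /\ dist phi < inf D + q m.
  have [_ [c sc <-] h] := @inf_adherent R D (q m) (q0 m) (conj D0 (ex_intro _ 0 lD)).
  by exists c.
have [p hp] := choice near_inf.
have := even_ultra_ultra; set U := even_ultra => UU.
have PU : ProperFilter U := @ultra_proper _ _ UU.
have [sphi hc] := limit_state UU (fun m => (hp m).1).
set phi := (X in state X) in sphi.
exists phi => // i0.
have le_d : dist phi <= inf D.
  apply/ler_addgt0Pr => e e0.
  have hcv : ucvg U (fun m => \sum_k (mu 0 k - p m (T k)) * (mu 0 k - p m (T k))^*)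
     (\sum_k (mu 0 k - phi (T k)) * (mu 0 k - phi (T k))^*).
    apply: ucvg_sum => k; apply: ucvgM; last apply: ucvgJ.
      by apply: ucvgB; [exact: ucvg_cst|exact: hc].
    by apply: ucvgB; [exact: ucvg_cst|exact: hc].
  have := @ucvg_Re_le _ _ U _ _ _ (inf D + e) hcv.
  rewrite Re_sum; under eq_bigr do rewrite mulcJ /=.
  apply; apply: filterS (even_ultra_eventually (Num.bound e^-1)) => m /= [em _].
  rewrite Re_sum; under eq_bigr do rewrite mulcJ /=.
  apply: le_trans (ltW (hp m).2) _; rewrite lerD2l /q.
  rewrite -[e]invrK lef_pV2 ?posrE ?invr_gt0 ?ltr0n //.
  apply: ltW; apply: lt_le_trans (archi_boundP _) _; first by rewrite invr_ge0 ltW.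
  by rewrite ler_nat (leq_trans em).
pose y i := mu 0 i - phi (T i).
(* A segment from [phi] to a vector state consists of states, hence cannot come closer to [mu]. *)
have polar x : nsq x = 1 -> Re (\sum_i (y i)^* * (inner (T i x) x - phi (T i))) <= 0.
  move=> x1; apply: nearest_polar => s /andP[s0 s1].
  apply: le_trans le_d _; apply: ge_inf; first by exists 0.
  exists (fun S => (1 - s)%:C * phi S + s%:C * inner (S x) x).
    by apply: convex_state => //; [rewrite ltW|exact: vector_state].
  apply: eq_bigr => i _; congr csq; rewrite /y rmorphB /=; ring.
have y0 : \sum_i csq (y i) <= 0.
  apply/ler_addgt0Pr => e e0; rewrite add0r.
  have [x x1 hx] := Tsup (fun i => (y i)^*) Kmu e0.
  have := polar x x1.
  have -> : Re (\sum_i (y i)^* * (inner (T i x) x - phi (T i))) =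
     Re (\sum_i (y i)^* * inner (T i x) x) - Re (\sum_i (y i)^* * phi (T i)).
    by rewrite -ReB -sumrB; congr Re; apply: eq_bigr => i _; rewrite mulrBr.
  have -> : \sum_i csq (y i) =
     Re (\sum_i (y i)^* * mu 0 i) - Re (\sum_i (y i)^* * phi (T i)).
    by rewrite -ReB -sumrB Re_sum; apply: eq_bigr => i _; rewrite -mulrBr mulrC mulcJ.
  lra.
apply/esym/eqP; rewrite -subr_eq0 -csq_eq0 eq_le csq_ge0 andbT.
apply: le_trans y0; rewrite (bigD1 i0) //= lerDl.
by apply: sumr_ge0 => j _; exact: csq_ge0.
Qed.

(** The map is [psi S = \sum_j phi_j(S) v_j v_j^*], where the state [phi_j] takes the value [mu_j]
    at [T]. *)
Lemma matrix_range_of_decomposition n m (X : 'I_d -> 'M[R[i]]_n.+1)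
    (mu : 'I_m -> 'rV[R[i]^o]_d) (v : 'I_m -> 'I_n.+1 -> R[i]) :
  (forall j, K (mu j)) ->
  (forall a b, \sum_j v j a * (v j b)^* = (a == b)%:R) ->
  (forall i a b, \sum_j mu j 0 i * (v j a * (v j b)^*) = X i a b) ->
  matrix_range T (existT _ n X).
Proof.
move=> Kmu hv hX.
have hs j : exists phi, state phi /\ forall i, phi (T i) = mu j 0 i.
  by have [phi h1 h2] := state_at (Kmu j); exists phi.
have [phi hphi] := choice hs.
pose f (S : 'B(H)) : 'M[R[i]]_n.+1 :=
  \matrix_(a, b) \sum_j phi j S * (v j a * (v j b)^*).
have lf : linear f.
  move=> c S S'; apply/matrixP => a b; rewrite !mxE mulr_sumr -big_split.
  by apply: eq_bigr => j _; case: (hphi j) => -[_ -> _ _] _ /=; rewrite mulrDl -mulrA.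
pose psi : {linear 'B(H) -> 'M[R[i]]_n.+1} :=
  HB.pack f (GRing.isLinear.Build _ _ _ _ f lf).
exists psi => [|i]; last first.
  apply/matrixP => a b; rewrite -hX mxE; apply: eq_bigr => j _.
  by case: (hphi j) => _ ->.
split.
  apply/matrixP => a b; rewrite !mxE -hv; apply: eq_bigr => j _.
  by case: (hphi j) => -[-> _ _ _] _; rewrite mul1r.
move=> k S S0 x.
(* [c j l] is the inner product of [x l] with [v j]. The form splits over [j] into the values of
   [phi j] at the operators [Q j], which are compressions of the positive matrix [S]. *)
pose c j l := \sum_b (v j b)^* * x l b 0.
have phi_sum j (I : Type) (r : seq I) (F : I -> 'B(H)) :
    phi j (\sum_(i <- r) F i) = \sum_(i <- r) phi j (F i).
  case: (hphi j) => -[_ hl _ _] _.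
  have h0 : phi j 0 = 0 by have := hl (-1) 0 0; rewrite scaler0 addr0 mulN1r addNr.
  elim: r => [|i r IH]; first by rewrite !big_nil h0.
  by rewrite !big_cons -IH -[F i]scale1r hl mul1r scale1r.
have phiZ j a S' : phi j (a *: S') = a * phi j S'.
  case: (hphi j) => -[_ hl _ _] _.
  have h0 : phi j 0 = 0 by have := hl (-1) 0 0; rewrite scaler0 addr0 mulN1r addNr.
  by rewrite -[a *: S']addr0 hl h0 addr0.
pose Q j : 'B(H) := \sum_i \sum_l (c j l * (c j i)^*) *: S i l.
have -> : \sum_i \sum_l cdot (psi (S i l) *m x l) (x i) = \sum_j phi j (Q j).
  transitivity (\sum_i \sum_l \sum_j phi j (S i l) * (c j l * (c j i)^*)).
    apply: eq_bigr => i _; apply: eq_bigr => l _; rewrite /cdot.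
    transitivity (\sum_a \sum_j (phi j (S i l) * v j a * c j l) * (x i a 0)^*).
      apply: eq_bigr => a _; rewrite !mxE -mulr_suml; congr (_ * _).
      under eq_bigr do rewrite mxE mulr_suml.
      rewrite exchange_big /=; apply: eq_bigr => j _.
      by rewrite /c mulr_sumr; apply: eq_bigr => b _; rewrite !mulrA.
    rewrite exchange_big /=; apply: eq_bigr => j _.
    rewrite /c conjc_sum !mulr_sumr; apply: eq_bigr => a _.
    rewrite conjcM conjcK; ring.
  transitivity (\sum_i \sum_j \sum_l phi j (S i l) * (c j l * (c j i)^*)).
    by apply: eq_bigr => i _; rewrite exchange_big.
  rewrite exchange_big /=; apply: eq_bigr => j _.
  rewrite phi_sum; apply: eq_bigr => i _; rewrite phi_sum; apply: eq_bigr => l _.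
  by rewrite phiZ mulrC.
apply: sumr_ge0 => j _; case: (hphi j) => -[_ _ hpos _] _; apply: hpos => z.
have := S0 (fun l => c j l *: z); congr (0 <= _).
rewrite bop_sumE inner_suml; apply: eq_bigr => i _.
rewrite bop_sumE inner_suml; apply: eq_bigr => l _.
by rewrite bop_scaleE bopZ !innerZl innerZr mulrA.
Qed.

End States.

(** * Fuglede's theorem *)

Section CauchyEstimate.
Variable R : realType.

Lemma primitive_root_complex (n : nat) : (0 < n)%N ->
  exists w : R[i], n.-primitive_root w.
Proof.
move=> n0.
have [rs hrs] := closed_field_poly_normal ('X^n - 1 : {poly R[i]}).
have lc : lead_coef ('X^n - 1 : {poly R[i]}) = 1.
  by rewrite (monicP _) // monicXnsubC.
rewrite lc scale1r in hrs.
have urs : uniq rs.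
  by rewrite -separable.separable_prod_XsubC -hrs; apply: cyclotomic.separable_Xn_sub_1; rewrite pnatr_eq0 -lt0n.
have urt : all n.-unity_root rs.
  apply/allP => z zrs; rewrite unity_rootE -subr_eq0.
  have : root (\prod_(z <- rs) ('X - z%:P)) z by rewrite root_prod_XsubC.
  by rewrite -hrs rootE !hornerE.
have szrs : (n <= size rs)%N.
  have := size_XnsubC (1 : R[i]) n0; rewrite hrs size_prod_XsubC => -[->].
  by [].
have /hasP[w _ pw] := cyclic.has_prim_root n0 urt urs szrs.
by exists w.
Qed.

Lemma cabs_unity_root (n : nat) (w : R[i]) : (0 < n)%N -> w ^+ n = 1 -> cabs w = 1.
Proof.
move=> n0 wn; apply/eqP; rewrite -(pexpr_eq1 n0) ?cabs_ge0 //.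
have cabsX k : cabs (w ^+ k) = cabs w ^+ k.
  elim: k => [|k IH]; first by rewrite !expr0 /cabs csqr expr1n sqrtr1.
  by rewrite !exprS cabsM IH.
by rewrite -cabsX wn /cabs csqr expr1n sqrtr1.
Qed.

(** For a polynomial, the contour integral may be replaced by an average over roots of unity, which
    is exact once their number exceeds the degree. *)
Lemma cauchy_estimate (p : {poly R[i]}) (rho B : R) : 0 <= rho ->
  (forall z, cabs z = rho -> cabs p.[z] <= B) -> rho * cabs p`_1 <= B.
Proof.
(* [n] exceeds the degree and also 1, so that the exponent 1 differs from 0 modulo [n] even for
   constant [p]. *)
move=> rho0 hp; pose n := (size p).+2.
have n0 : (0 < n)%N by [].
have [w pw] := primitive_root_complex n0.
have wn := prim_expr_order pw.
have w0 : w != 0 by rewrite -cabs_eq0 (cabs_unity_root n0 wn) oner_eq0.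
have geom j : (j < n)%N -> \sum_(k < n) (w ^+ j / w) ^+ k = (n%:R * (j == 1%N)%:R : R[i]).
  move=> jn; have [->|j1] := eqVneq j 1%N.
    rewrite expr1 divff // mulr1; under eq_bigr do rewrite expr1n.
    by rewrite sumr_const card_ord.
  have z1 : w ^+ j / w != 1.
    rewrite -subr_eq0 -(mulIr_eq0 _ (mulIf w0)) mulrBl divfK // mul1r subr_eq0.
    rewrite -[X in _ == X]expr1 (eq_prim_root_expr pw) !modn_small //.
  have : (w ^+ j / w) ^+ n = 1.
    by rewrite exprMn exprVn exprAC wn expr1n invr1 mulr1.
  move/eqP; rewrite -subr_eq0 subrX1 mulf_eq0 subr_eq0 (negPf z1) /= => /eqP ->.
  by rewrite mulr0.
have key : \sum_(k < n) (w ^+ k)^-1 * p.[rho%:C * w ^+ k] = n%:R * (rho%:C * p`_1).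
  transitivity (\sum_(k < n) \sum_(j < n) p`_j * rho%:C ^+ j * (w ^+ j / w) ^+ k).
    apply: eq_bigr => k _; rewrite (@horner_coef_wide _ n) ?leqW //.
    rewrite mulr_sumr; apply: eq_bigr => j _.
    rewrite !exprMn exprVn [(w ^+ k) ^+ j]exprAC; ring.
  rewrite exchange_big /=.
  under eq_bigr => j _ do rewrite -mulr_sumr geom //.
  have n1 : (1 < n)%N by [].
  rewrite (bigD1 (Ordinal n1)) //= big1 => [|j j1].
    rewrite addr0 expr1 mulr1; ring.
  have -> : (j == 1 :> nat)%N = false by apply: negbTE; move: j1; rewrite -val_eqE.
  by rewrite !mulr0.
have nR : 0 < n%:R :> R by rewrite ltr0n.
rewrite -(ler_pM2l nR).
have -> : n%:R * (rho * cabs p`_1) = cabs (\sum_(k < n) (w ^+ k)^-1 * p.[rho%:C * w ^+ k]).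
  by rewrite key !cabsM -(rmorph_nat (real_complex R)) !cabsr !ger0_norm.
apply: le_trans (cabs_sum _ _ _) _.
rewrite mulr_natl -[X in _ *+ X](card_ord n) -sumr_const.
apply: ler_sum => k _.
have wk : cabs (w ^+ k) = 1.
  by apply: (@cabs_unity_root n) => //; rewrite exprAC wn expr1n.
have -> : cabs ((w ^+ k)^-1 * p.[rho%:C * w ^+ k]) = cabs p.[rho%:C * w ^+ k].
  have : cabs ((w ^+ k)^-1 * w ^+ k) = 1.
    by rewrite mulVf ?expf_neq0 // /cabs csqr expr1n sqrtr1.
  by rewrite !cabsM wk mulr1 => ->; rewrite mul1r.
by apply: hp; rewrite cabsM wk cabsr ger0_norm // mulr1.
Qed.
End CauchyEstimate.

Section Fuglede.
Variables (R : realType) (H : hilbertType R) (N S : 'B(H)).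
Hypothesis NS_adj : is_adjoint N S.
Hypothesis NS_comm : bopM N S = bopM S N.
Implicit Types (X : 'B(H)) (x y : H).

Definition op_bound X (M : R) := forall x, nrm (X x) <= M * nrm x.

Let der X : 'B(H) := bopM S X - bopM X S.

Let derE X x : der X x = S (X x) - X (S x). Proof. by []. Qed.

Let derP (c : R[i]) X X' : der (X + c *: X') = der X + c *: der X'.
Proof.
apply: bop_ext => x.
rewrite derE !bop_addE !bop_scaleE !derE bopD bopZ scalerBr opprD addrACA.
by rewrite -!addrA.
Qed.

Let NSx x : N (S x) = S (N x).
Proof. exact: (congr1 (fun T : 'B(H) => T x) NS_comm). Qed.

Let der_comm X : (forall x, N (X x) = X (N x)) -> forall x, N (der X x) = der X (N x).
Proof. by move=> hX x; rewrite !derE bopB NSx !hX NSx. Qed.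

Let K (z : R[i]) x := z *: S x - z^* *: N x.

Let K_antiherm z x : rip x (K z x) = 0.
Proof.
rewrite /rip /K innerBr !innerZr conjcK -NS_adj [inner (N x) x]innerJ.
rewrite ReB !ReM !ReJ !ImJ; ring.
Qed.

(** With [K] for [K z], the commutator form of [z der X] gives
    [X + z der X = (1 + K) X (1 - K) + K X K]. As [K] is skew-adjoint, [1 + K] and [1 - K] have
    squared norm at most [1 + k^2], where [k] bounds [K]; no first-order term is left. *)
Let step z X (M nu : R) : 0 <= M -> op_bound N nu -> op_bound S nu -> op_bound X M ->
  (forall x, N (X x) = X (N x)) ->
  op_bound (X + z *: der X) ((1 + 2 * (2 * cabs z * nu) ^+ 2) * M).
Proof.
move=> M0 hN hS hX cX x.
have Kb y : nrm (K z y) <= 2 * cabs z * nu * nrm y.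
  apply: le_trans (nrmD _ _) _; rewrite nrmN !nrmZ cabsJ.
  have h1 := ler_wpM2l (cabs_ge0 z) (hS y); have h2 := ler_wpM2l (cabs_ge0 z) (hN y).
  by apply: le_trans (lerD h1 h2) _; rewrite le_eqVlt; apply/orP; left; apply/eqP; ring.
move: (2 * cabs z * nu) Kb => k Kb.
have KB y y' : K z (y - y') = K z y - K z y'.
  by rewrite /K !bopB !scalerBr !opprD !opprK addrACA.
have XK y : X (K z y) = z *: X (S y) - z^* *: X (N y) by rewrite /K bopB !bopZ.
pose u := X (x - K z x).
have -> : (X + z *: der X) x = (u + K z u) + K z (X (K z x)).
  have -> : u + K z u + K z (X (K z x)) = X x - X (K z x) + K z (X x).
    by rewrite {2}/u bopB KB -addrA subrK /u bopB.
  have -> : K z (X x) = z *: S (X x) - z^* *: X (N x) by rewrite /K cX.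
  rewrite -[LHS]/(X x + z *: (S (X x) - X (S x))) XK scalerBr opprB -!addrA.
  by congr (_ + _); rewrite addrA [RHS]addrC subrKA.
have bu (y : H) : nsq (y + K z y) = nsq y + nsq (K z y).
  by rewrite nsqD K_antiherm mulr0 addr0.
have bu' (y : H) : nsq (y - K z y) = nsq y + nsq (K z y).
  by rewrite nsqB K_antiherm mulr0 subr0.
have Kb2 y : nsq (K z y) <= k ^+ 2 * nsq y.
  by rewrite -!sqr_nrm -exprMn lerXn2r ?nnegrE ?nrm_ge0 // (le_trans (nrm_ge0 _) (Kb y)).
have X2 y : nsq (X y) <= M ^+ 2 * nsq y.
  by rewrite -!sqr_nrm -exprMn lerXn2r ?nnegrE ?nrm_ge0 // (le_trans (nrm_ge0 _) (hX y)).
have k2 := sqr_ge0 k.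
have p2 : 0 <= k ^+ 2 * M * nrm x.
  by apply: mulr_ge0 (nrm_ge0 x); apply: mulr_ge0.
have p1 : 0 <= (1 + k ^+ 2) * M * nrm x.
  by apply: mulr_ge0 (nrm_ge0 x); apply: mulr_ge0 => //; apply: addr_ge0.
have b1 : nrm (u + K z u) <= (1 + k ^+ 2) * M * nrm x.
  rewrite -(@ler_pXn2r _ 2) ?nnegrE ?nrm_ge0 //.
  rewrite exprMn !sqr_nrm exprMn bu.
  apply: le_trans (_ : (1 + k ^+ 2) * nsq u <= _); first by rewrite mulrDl mul1r lerD2l.
  have h1 := X2 (x - K z x); rewrite -/u bu' in h1.
  have h2 : M ^+ 2 * (nsq x + nsq (K z x)) <= M ^+ 2 * ((1 + k ^+ 2) * nsq x).
    by rewrite ler_wpM2l ?sqr_ge0 // mulrDl mul1r lerD2l.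
  have h3 := ler_wpM2l (addr_ge0 ler01 k2) (le_trans h1 h2).
  by apply: le_trans h3 _; rewrite le_eqVlt; apply/orP; left; apply/eqP; ring.
have b2 : nrm (K z (X (K z x))) <= k ^+ 2 * M * nrm x.
  rewrite -(@ler_pXn2r _ 2) ?nnegrE ?nrm_ge0 //.
  rewrite exprMn !sqr_nrm exprMn; apply: le_trans (Kb2 _) _.
  have h3 := ler_wpM2l k2 (le_trans (X2 _) (ler_wpM2l (sqr_ge0 M) (Kb2 x))).
  by apply: le_trans h3 _; rewrite le_eqVlt; apply/orP; left; apply/eqP; ring.
apply: le_trans (nrmD _ _) _; apply: le_trans (lerD b1 b2) _.
by rewrite le_eqVlt; apply/orP; left; apply/eqP; ring.
Qed.

(* [(fpoly m T x y).[z]] is [<(1 + z der)^m T x, y>]. *)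
Let fpoly := fix fp (m : nat) X x y : {poly R[i]} :=
  if m is m'.+1 then fp m' X x y + 'X * fp m' (der X) x y else (inner (X x) y)%:P.

Let fpolyP m (c : R[i]) X X' x y :
  fpoly m (X + c *: X') x y = fpoly m X x y + c *: fpoly m X' x y.
Proof.
elim: m => [|m IH] in X X' *.
  rewrite -[LHS]/((inner (X x + c *: X' x) y)%:P) innerDl innerZl polyCD polyCM.
  by rewrite mul_polyC.
rewrite -[LHS]/(fpoly m (X + c *: X') x y + 'X * fpoly m (der (X + c *: X')) x y).
rewrite -[fpoly m.+1 X' x y]/(fpoly m X' x y + 'X * fpoly m (der X') x y).
rewrite -[fpoly m.+1 X x y]/(fpoly m X x y + 'X * fpoly m (der X) x y).
by rewrite derP !IH mulrDr -scalerAr scalerDr addrACA.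
Qed.

Let fpoly_bound m z X (M nu : R) x y : 0 <= M -> op_bound N nu -> op_bound S nu ->
  op_bound X M -> (forall x, N (X x) = X (N x)) ->
  cabs (fpoly m X x y).[z] <=
    (1 + 2 * (2 * cabs z * nu) ^+ 2) ^+ m * M * (nrm x * nrm y).
Proof.
move=> M0 hN hS; elim: m => [|m IH] in X M M0 * => hX cX.
  rewrite hornerC expr0 mul1r; apply: le_trans (cauchy_schwarz _ _) _.
  by rewrite mulrA ler_wpM2r ?nrm_ge0.
have -> : (fpoly m.+1 X x y).[z] = (fpoly m (X + z *: der X) x y).[z].
  by rewrite fpolyP !hornerE.
have M1 : 0 <= (1 + 2 * (2 * cabs z * nu) ^+ 2) * M.
  by rewrite mulr_ge0 // addr_ge0 // mulr_ge0 // sqr_ge0.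
apply: le_trans (IH _ _ M1 (step z M0 hN hS hX cX) _) _.
  move=> w; rewrite -[(X + z *: der X) (N w)]/(X (N w) + z *: der X (N w)).
  by rewrite -[(X + z *: der X) w]/(X w + z *: der X w) bopD bopZ cX der_comm.
by move: (1 + _) => c; rewrite exprSr !mulrA.
Qed.

Let fpoly_coef0 m X x y : (fpoly m X x y)`_0 = inner (X x) y.
Proof.
elim: m => [|m IH]; first by rewrite /= coefC.
rewrite -[fpoly m.+1 X x y]/(fpoly m X x y + 'X * fpoly m (der X) x y).
by rewrite coefD coefXM IH /= addr0.
Qed.

Let fpoly_coef1 m X x y : (fpoly m X x y)`_1 = m%:R * inner (der X x) y.
Proof.
elim: m => [|m IH]; first by rewrite /= coefC mul0r.
rewrite -[fpoly m.+1 X x y]/(fpoly m X x y + 'X * fpoly m (der X) x y).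
by rewrite coefD coefXM IH fpoly_coef0 -[m.+1%:R]natr1 mulrDl mul1r.
Qed.

(* For [X] commuting with [N], [z der X] is the commutator of the skew-adjoint
   operator [z S - conj(z) N] with [X], so [1 + z der] increases the norm only
   to second order in [z].  Cauchy's estimate for [(1 + z der)^m X] on a circle of
   radius of order [m^(-1/2)] bounds [m der X] by [O(m^(1/2))]. *)
Lemma fuglede X : bopM X N = bopM N X -> bopM X S = bopM S X.
Proof.
move=> cX; have cXx x : N (X x) = X (N x).
  by have := congr1 (fun T : 'B(H) => T x) cX.
have [M M0 hM] := bop_bounded X.
have [n1 n10 hn1] := bop_bounded N; have [n2 n20 hn2] := bop_bounded S.
pose nu := n1 + n2 + 1.
have nu0 : 0 < nu by rewrite ltr_wpDl // addr_ge0.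
have hN : op_bound N nu.
  move=> x; apply: le_trans (hn1 x) _; rewrite ler_wpM2r ?nrm_ge0 //.
  by rewrite /nu -addrA lerDl addr_ge0.
have hS : op_bound S nu.
  move=> x; apply: le_trans (hn2 x) _; rewrite ler_wpM2r ?nrm_ge0 //.
  by rewrite /nu addrAC lerDr addr_ge0.
suff h x y : inner (der X x) y = 0.
  apply/esym/bop_ext => x; apply: inner_ext => y; apply/eqP; rewrite -subr_eq0 -innerBl.
  by rewrite -[_ - _]/(der X x) h.
apply/eqP; rewrite -cabs_eq0; apply/eqP/le_anti; rewrite cabs_ge0 andbT.
set c := cabs _; set B := 2 * M * (nrm x * nrm y).
have key (t : nat) : (0 < t)%N -> t%:R * c <= 4 * nu * B.
  move=> t0; have tR : 0 < t%:R :> R by rewrite ltr0n.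
  (* This radius makes the growth factor of [step] equal to [1 + 1 / (2m)]; taking [m] to be a
     square avoids roots. *)
  pose m := (t ^ 2)%N; pose rho : R := (4 * nu * t%:R)^-1.
  have rho0 : 0 < rho by rewrite invr_gt0 !mulr_gt0.
  have mR : m%:R = t%:R ^+ 2 :> R by rewrite natrX.
  have m0 : 0 < m%:R :> R by rewrite mR exprn_gt0.
  have eps : 2 * (2 * rho * nu) ^+ 2 = (2 * m%:R)^-1.
    rewrite mR /rho; field; rewrite !lt0r_neq0 //.
  have := cauchy_estimate (p := fpoly m X x y) (B := B) (ltW rho0).
  rewrite fpoly_coef1 cabsM -(rmorph_nat (real_complex R)) cabsr ger0_norm ?ler0n // -/c => h.
  have hz z : cabs z = rho -> cabs (fpoly m X x y).[z] <= B.
    move=> zr; apply: le_trans (fpoly_bound m z x y M0 hN hS hM cXx) _.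
    rewrite ler_wpM2r ?mulr_ge0 ?nrm_ge0 // ler_wpM2r // zr eps.
    set e := (2 * m%:R)^-1.
    have e0 : 0 < e by rewrite invr_gt0 mulr_gt0.
    have e1 : e <= 1.
      rewrite invf_le1 ?mulr_gt0 //; have : 1 <= m%:R :> R by rewrite ler1n -(ltr0n R).
      lra.
    (* Bernoulli's inequality bounds [(1 - e)^m] below by 1/2; since [(1 + e)(1 - e) <= 1], it
       follows that [(1 + e)^m <= 2], the factor 2 in [B]. *)
    have bern k : 1 - k%:R * e <= (1 - e) ^+ k.
      elim: k => [|k IH]; first by rewrite mul0r subr0 expr0.
      rewrite exprS -natr1; have e2 : 0 <= 1 - e by rewrite subr_ge0.
      have := ler_wpM2l e2 IH; have : 0 <= k%:R :> R by rewrite ler0n.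
      nra.
    have h1 := bern m.
    have e3 : m%:R * e = 2^-1.
      by rewrite /e invfM mulrCA divff ?mulr1 // lt0r_neq0.
    have h2 : (1 + e) ^+ m * (1 - e) ^+ m <= 1.
      rewrite -exprMn exprn_ile1 //; first by nra.
      by have := sqr_ge0 e; nra.
    have h3 : 0 <= (1 + e) ^+ m by rewrite exprn_ge0 // addr_ge0 // ltW.
    rewrite e3 in h1; have := ler_wpM2l h3 h1; lra.
  have := h hz; rewrite mR /rho => h4.
  have -> : t%:R * c = 4 * nu * ((4 * nu * t%:R)^-1 * (t%:R ^+ 2 * c)).
    by field; rewrite !lt0r_neq0.
  by rewrite ler_wpM2l // mulr_ge0 // ltW.
rewrite leNgt; apply/negP => c0.
have := key (Num.bound (4 * nu * B / c)).+1 isT.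
rewrite leNgt => /negP; apply; rewrite -ltr_pdivrMr //.
apply: lt_trans (archi_boundP _) _; last by rewrite ltr_nat.
by rewrite divr_ge0 ?(ltW c0) // /B !mulr_ge0 ?nrm_ge0 // ltW.
Qed.

End Fuglede.

(** * Joint approximate eigenvectors *)

Section JointApproximateEigenvectors.
Variables (R : realType) (E : lmodType R[i]) (F : E -> E -> R[i]).
Hypothesis FP : forall a x y z, F (a *: x + y) z = a * F x z + F y z.
Hypothesis FJ : forall x y, F y x = (F x y)^*.
Hypothesis F_ge0 : forall x, 0 <= Re (F x x).
Implicit Types (x y : E) (T : E -> E) (c : E -> R).

Let q x := Re (F x x).

(** As [q] is a squared norm, [M] bounds the square of the operator norm. *)
Definition sym_bounded T (M : R) := [/\
  (forall a x y, T (a *: x + y) = a *: T x + T y),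
  (forall x y, F (T x) y = F x (T y)) & forall x, q (T x) <= M * q x].

(* [c x] measures how far [x] is from satisfying the constraints imposed so
   far, and [approximable c] says that they can be met approximately. *)
Definition approximable c := forall e : R, 0 < e -> exists2 x, 0 < q x & c x <= e * q x.

Let q_ge0 x : 0 <= q x := F_ge0 x.

Let qB x y : q (x - y) = q x + q y - 2 * Re (F x y).
Proof.
rewrite -scaleN1r /q (form_sqD FP FJ) (form_sqZ FP FJ) (formZr FP FJ).
rewrite conjcN conjc1 mulN1r ReN csqN csq1 mul1r; ring.
Qed.

Let qBr x y (r : R) : q (x - r%:C *: y) = q x + r ^+ 2 * q y - 2 * r * Re (F x y).
Proof.
rewrite qB /q (form_sqZ FP FJ) (formZr FP FJ) conjc_real ReMr csqr; ring.
Qed.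

Let q_leD x y : q (x + y) <= 2 * q x + 2 * q y.
Proof.
have := q_ge0 (x - y); rewrite qB /q (form_sqD FP FJ) -/(q x) -/(q y); lra.
Qed.

(** [r^2] is the largest ratio [q (T x) / q x] reached by vectors that nearly satisfy the
    constraint. At such an [x] the vector [(T^2 - r^2) x] is small, and [T + r] is bounded below by
    [r], so [(T - r) x] is small too. The last conclusion lets a caller bound the eigenvalue from
    below. *)
Lemma positive_step c T (M Mc : R) : (forall x, 0 <= c x) -> 0 <= M -> 0 <= Mc ->
  sym_bounded T M -> (forall x, 0 <= Re (F (T x) x)) ->
  (forall x, c (T x) <= Mc * c x) -> approximable c ->
  exists r : R, [/\ 0 <= r, approximable (fun x => c x + q (T x - r%:C *: x)) &
    forall rho : R, (forall e : R, 0 < e ->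
      exists x, [/\ 0 < q x, c x <= e * q x & rho * q x <= q (T x)]) -> rho <= r ^+ 2].
Proof.
move=> c0 M0 Mc0 [Tlin Tsym Tbnd] Tpos Tc hc.
pose D (rho : R) := forall e : R, 0 < e ->
  exists x, [/\ 0 < q x, c x <= e * q x & rho * q x <= q (T x)].
have D0 : D 0.
  by move=> e e0; have [x x0 cx] := hc e e0; exists x; rewrite mul0r q_ge0.
have ubD : ubound (D : set R) M.
  move=> rho hrho; have [x [x0 _ h]] := hrho 1 ltr01.
  by rewrite -(ler_pM2r x0); apply: le_trans h (Tbnd x).
have supD : has_sup (D : set R) by split; [exists 0|exists M].
pose s := sup (D : set R).
have s0 : 0 <= s by apply: ub_le_sup => //; exists M.
have below (h : R) : 0 < h -> D (s - h).
  move=> h0; have [rho Drho hr] := sup_adherent h0 supD.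
  move=> e e0; have [x [x0 cx hx]] := Drho e e0; exists x; split=> //.
  by apply: le_trans hx; rewrite ler_pM2r // ltW.
have above (h : R) : 0 < h -> exists2 e : R, 0 < e &
    forall x, 0 < q x -> c x <= e * q x -> q (T x) <= (s + h) * q x.
  move=> h0; have : ~ D (s + h).
    move=> /(ub_le_sup (ex_intro _ M ubD)); rewrite -/s; lra.
  move=> /existsNP[e /not_implyP[e0 he]]; exists e => // x x0 cx.
  rewrite leNgt; apply/negP => hx; apply: he; exists x; split=> //; exact: ltW.
exists (Num.sqrt s); split; first exact: sqrtr_ge0.
  have [sz|sn] := eqVneq s 0.
    move=> e e0; have e2 : 0 < e / 2 by rewrite divr_gt0.
    have [e1 e10 he1] := above _ e2.
    pose e3 := Num.min e1 (e / 2); have e30 : 0 < e3 by rewrite lt_min e10.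
    have [x x0 cx] := hc _ e30; exists x => //.
    rewrite sz sqrtr0 scale0r subr0.
    have h1 : c x <= e1 * q x by apply: le_trans cx _; rewrite ler_pM2r // ge_min lexx.
    have h2 : c x <= e / 2 * q x by apply: le_trans cx _; rewrite ler_pM2r // ge_min lexx orbT.
    have := he1 x x0 h1; rewrite sz add0r => h3.
    have -> : e * q x = e / 2 * q x + e / 2 * q x by field.
    exact: lerD.
  have sp : 0 < s by rewrite lt_def sn.
  move=> e e0.
  (* [h] is the tolerance on the ratio [q (T x) / q x] *)
  pose h := Num.min (s / 2) (Num.min 1 (e * s / 2 / (4 * s + 1))).
  have s41 : 0 < 4 * s + 1 by rewrite ltr_wpDl ?mulr_ge0.
  have h0 : 0 < h by rewrite !lt_min ltr01 !divr_gt0 ?mulr_gt0.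
  have hs : h <= s / 2 by rewrite ge_min lexx.
  have h1 : h <= 1 by rewrite !ge_min lexx orbT.
  have h2 : h * (4 * s + 1) <= e * s / 2.
    by rewrite -ler_pdivlMr // !ge_min lexx !orbT.
  have [e1 e10 he1] := above _ h0.
  have M1 : 0 < Mc + 1 by rewrite ltr_wpDl.
  pose e2 := Num.min e1 (Num.min (e / 2) (e1 * (s / 2) / (Mc + 1))).
  have s2 : 0 < s / 2 by rewrite divr_gt0.
  have e20 : 0 < e2.
    by rewrite !lt_min e10 divr_gt0 //= divr_gt0 // mulr_gt0.
  have [x [x0 cx hx]] := below _ h0 _ e20.
  exists x => //.
  have cx1 : c x <= e1 * q x by apply: le_trans cx _; rewrite ler_pM2r // ge_min lexx.
  have cx2 : c x <= e / 2 * q x by apply: le_trans cx _; rewrite ler_pM2r // !ge_min lexx orbT.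
  have cx3 : (Mc + 1) * c x <= e1 * (s / 2) * q x.
    rewrite mulrC -ler_pdivlMr // mulrAC; apply: le_trans cx _.
    by rewrite ler_pM2r // !ge_min lexx !orbT.
  have sh : s / 2 <= s - h by lra.
  have qT : s / 2 * q x <= q (T x) by apply: le_trans hx; rewrite ler_pM2r.
  have qT0 : 0 < q (T x) by apply: lt_le_trans qT; rewrite mulr_gt0 // divr_gt0.
  (* [T x] is again a competitor, because [T] nearly preserves the constraint and does not shrink
     [x] too much; thus [above] also bounds [q (T (T x))]. *)
  have cTx : c (T x) <= e1 * q (T x).
    apply: le_trans (Tc x) _; apply: le_trans (_ : (Mc + 1) * c x <= _).
      by rewrite ler_wpM2r // lerDl.
    by apply: le_trans cx3 _; rewrite -mulrA ler_pM2l.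
  have u1 := he1 _ x0 cx1; have u2 := he1 _ qT0 cTx.
  set r := Num.sqrt s.
  have rr : r ^+ 2 = s by rewrite sqr_sqrtr.
  have r0 : 0 < r by rewrite sqrtr_gt0.
  have TB u v : T (u - v) = T u - T v by rewrite -scaleN1r addrC Tlin scaleN1r addrC.
  have TZ a u : T (a *: u) = a *: T u.
    have T0 : T 0 = 0 by have := TB 0 0; rewrite !subrr.
    by rewrite -[a *: u]addr0 Tlin T0 addr0.
  pose y := T x - r%:C *: x.
  have bound1 : q (T (T x) - (r ^+ 2)%:C *: x) <= (4 * s + 1) * h * q x.
    rewrite qBr rr Tsym -/(q (T x)).
    have u3 : q (T (T x)) <= (s + h) * ((s + h) * q x).
      by apply: le_trans u2 _; rewrite ler_pM2l // addr_gt0.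
    have h4 : h * h <= h by rewrite ler_piMr // ltW.
    have h5 : h * h * q x <= h * q x by rewrite ler_pM2r.
    have h6 := ler_wpM2l (ltW sp) hx; nra.
  (* [T^2 - r^2 = (T + r)(T - r)], and positivity of [T] gives [|(T + r) y| >= r |y|]. *)
  have bound2 : s * q y <= q (T (T x) - (r ^+ 2)%:C *: x).
    have -> : T (T x) - (r ^+ 2)%:C *: x = T y - (- r)%:C *: y.
      rewrite /y TB TZ rmorphN scaleNr opprK scalerBr scalerA -rmorphM -expr2.
      by rewrite addrA subrK.
    rewrite (qBr (T y)) sqrrN rr.
    have := q_ge0 (T y); have := mulr_ge0 (ltW r0) (Tpos y); lra.
  have : s * q y <= s * (e / 2 * q x).
    apply: le_trans bound2 _; apply: le_trans bound1 _.
    have h7 : h * (4 * s + 1) * q x <= e * s / 2 * q x by rewrite ler_pM2r.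
    by apply: le_trans (_ : _ <= e * s / 2 * q x) _; [lra|lra].
  rewrite ler_pM2l // => h8.
  have -> : e * q x = e / 2 * q x + e / 2 * q x by field.
  exact: lerD.
move=> rho hrho; rewrite sqr_sqrtr //.
by apply: ub_le_sup => //; exists M.
Qed.

(** Shifting [T] by [m = M + 1], which exceeds its norm, makes it positive and reduces to
    [positive_step]. *)
Lemma eigen_step c T (M Mc : R) : (forall x, 0 <= c x) -> 0 <= M -> 0 <= Mc ->
  sym_bounded T M -> (forall x y, c (x + y) <= 2 * c x + 2 * c y) ->
  (forall a x, c (a *: x) = csq a * c x) ->
  (forall x, c (T x) <= Mc * c x) -> approximable c ->
  exists l : R, approximable (fun x => c x + q (T x - l%:C *: x)).
Proof.
move=> c0 M0 Mc0 [Tlin Tsym Tbnd] cD cZ Tc hc.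
have TN x : Re (F (T x) x) ^+ 2 <= (M + 1) ^+ 2 * q x ^+ 2.
  apply: le_trans (_ : csq (F (T x) x) <= _); first by rewrite /csq lerDl sqr_ge0.
  apply: le_trans (form_cauchy_schwarz FP FJ F_ge0 _ _) _; rewrite -/(q x) -/(q (T x)).
  apply: le_trans (ler_wpM2r (q_ge0 x) (Tbnd x)) _.
  by rewrite -mulrA -expr2 ler_wpM2r ?sqr_ge0 //; nra.
pose m := M + 1; have m0 : 0 <= m by rewrite addr_ge0.
pose T' x := m%:C *: x + T x.
have T'sb : sym_bounded T' (2 * m ^+ 2 + 2 * M).
  split=> [a x y|x y|x].
  - by rewrite /T' Tlin !scalerDr addrACA !scalerA [m%:C * a]mulrC.
  - by rewrite /T' FP (formDr FP FJ) (formZr FP FJ) conjc_real Tsym.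
  - apply: le_trans (q_leD _ _) _; rewrite {1}/q (form_sqZ FP FJ) csqr -/(q x).
    by have := Tbnd x; lra.
have T'pos x : 0 <= Re (F (T' x) x).
  rewrite /T' FP ReD ReMr -/(q x); have := TN x; rewrite -exprMn => h.
  have h1 : `|Re (F (T x) x)| <= m * q x.
    by rewrite -(@ler_pXn2r _ 2) ?nnegrE ?mulr_ge0 // real_normK ?num_real.
  by move: h1; rewrite ler_norml => /andP[]; lra.
have T'c x : c (T' x) <= (2 * m ^+ 2 + 2 * Mc) * c x.
  apply: le_trans (cD _ _) _; rewrite cZ csqr.
  by have := Tc x; lra.
have MM : 0 <= 2 * m ^+ 2 + 2 * M by rewrite addr_ge0 // mulr_ge0 // sqr_ge0.
have MMc : 0 <= 2 * m ^+ 2 + 2 * Mc by rewrite addr_ge0 // mulr_ge0 // sqr_ge0.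
have [r [_ hr _]] := positive_step c0 MM MMc T'sb T'pos T'c hc.
exists (r - m) => e e0; have [x x0 hx] := hr e e0; exists x => //.
congr (_ <= _): hx; congr (_ + q _).
by rewrite /T' rmorphB scalerBl opprB addrA [_ + T x]addrC.
Qed.

Definition family_defect c (Ts : nat -> E -> E) (l : nat -> R) k x : R :=
  c x + \sum_(j < k) q (Ts j x - (l j)%:C *: x).

Lemma family_defectZ c Ts l k a x : (forall a x, c (a *: x) = csq a * c x) ->
  (forall j, exists M, sym_bounded (Ts j) M) ->
  family_defect c Ts l k (a *: x) = csq a * family_defect c Ts l k x.
Proof.
move=> cZ Tsb; rewrite /family_defect cZ mulrDr mulr_sumr; congr (_ + _).
apply: eq_bigr => j _; have [M [Tlin _ _]] := Tsb j.
have T0 : Ts j 0 = 0.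
  by have := Tlin (-1) 0 0; rewrite scaler0 addr0 scaleN1r addNr.
have := Tlin a x 0; rewrite T0 !addr0 => ->.
by rewrite scalerA mulrC -scalerA -scalerBr /q (form_sqZ FP FJ).
Qed.

(** Induction on [k]. Because the operators commute, [T_k] maps the defect of each earlier
    eigenvalue equation at [x] to the defect at [T_k x]; so the accumulated defect is a constraint
    that [eigen_step] accepts. *)
Lemma joint_eigen_step c (Ts : nat -> E -> E) k :
  (forall x, 0 <= c x) ->
  (forall j, exists2 M, 0 <= M & sym_bounded (Ts j) M) ->
  (forall j j' x, Ts j (Ts j' x) = Ts j' (Ts j x)) ->
  (forall x y, c (x + y) <= 2 * c x + 2 * c y) ->
  (forall a x, c (a *: x) = csq a * c x) ->
  (forall j, exists2 Mc, 0 <= Mc & forall x, c (Ts j x) <= Mc * c x) ->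
  approximable c ->
  exists l : nat -> R, forall e : R, 0 < e -> exists2 x, q x = 1 & family_defect c Ts l k x <= e.
Proof.
move=> c0 Tsb Tcomm cD cZ Tc hc.
have Tsb' j : exists M, sym_bounded (Ts j) M by have [M _ hM] := Tsb j; exists M.
suff [l hl] : exists l : nat -> R, approximable (family_defect c Ts l k).
  exists l => e e0; have [x x0 hx] := hl e e0.
  pose t : R := (Num.sqrt (q x))^-1.
  have tq : t ^+ 2 * q x = 1.
    by rewrite /t exprVn sqr_sqrtr ?q_ge0 // mulVf // lt0r_neq0.
  exists (t%:C *: x); first by rewrite /q (form_sqZ FP FJ) csqr.
  rewrite family_defectZ // csqr -[e]mulr1 -tq mulrCA.
  by rewrite ler_wpM2l // sqr_ge0.
elim: k => [|k [l IH]].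
  exists (fun=> 0) => e e0; have [x x0 hx] := hc e e0; exists x => //.
  by rewrite /family_defect big_ord0 addr0.
have [M M0 Tk] := Tsb k; have [Mc Mc0 Tck] := Tc k.
have [] := @eigen_step (family_defect c Ts l k) (Ts k) M (Mc + M) _ M0 _ Tk.
- by move=> x; rewrite addr_ge0 // sumr_ge0.
- exact: addr_ge0.
- move=> x y; rewrite /family_defect !mulrDr addrACA !mulr_sumr -big_split /=.
  apply: lerD => //; apply: ler_sum => j _; apply: le_trans (q_leD _ _).
  have [Mj [Tlin _ _]] := Tsb' j.
  have := Tlin 1 x y; rewrite !scale1r => ->.
  by rewrite scalerDr opprD addrACA.
- by move=> a x; exact: family_defectZ.
- move=> x; rewrite /family_defect mulrDr.
  apply: lerD.
    by apply: le_trans (Tck x) _; rewrite ler_wpM2r // lerDl.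
  rewrite mulr_sumr; apply: ler_sum => j _; have [Tlin _ Tb] := Tk.
  have -> : Ts j (Ts k x) - (l j)%:C *: Ts k x = Ts k (Ts j x - (l j)%:C *: x).
    by rewrite [in RHS]addrC -[in RHS]scaleNr Tlin (Tcomm j k) scaleNr addrC.
  by apply: le_trans (Tb _) _; rewrite ler_wpM2r // lerDr.
- exact: IH.
move=> lk hlk; exists (fun j => if j == k then lk else l j) => e e0.
have [x x0 hx] := hlk e e0; exists x => //; congr (_ <= _): hx.
rewrite /family_defect big_ord_recr /= eqxx addrA; congr (_ + _ + _).
by apply: eq_bigr => j _; rewrite ltn_eqF.
Qed.

End JointApproximateEigenvectors.

(** * Approximate eigenvectors as characters *)

Section ApproximateCharacter.
Variables (R : realType) (L : hilbertType R) (n : nat).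
Variables (U : set_system nat) (UU : UltraFilter U).
Variable x : nat -> 'I_n -> L.
Hypothesis x1 : forall m, \sum_a nsq (x m a) = 1.
Let PU : ProperFilter U := @ultra_proper _ _ UU.
Local Existing Instance PU.
Implicit Types (S T : 'B(L)) (c : R[i]).

(* The weak half of the definition replaces a bound on [T^*]. *)
Definition approx_eigen T c := forall e : R, 0 < e -> U [set m | forall a,
  nrm (T (x m a) - c *: x m a) <= e /\
  forall y, cabs (inner (T y - c *: y) (x m a)) <= e * nrm y].

Lemma nrm_x_le1 m a : nrm (x m a) <= 1.
Proof.
rewrite -(@ler_pXn2r _ 2) ?nnegrE ?nrm_ge0 // sqr_nrm expr1n -(x1 m).
by rewrite (bigD1 a) //= lerDl sumr_ge0 // => b _; exact: nsq_ge0.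
Qed.

Lemma approx_eigen1 : approx_eigen (bop1 L) 1.
Proof.
move=> e e0; apply: filterE => m a; rewrite scale1r subrr nrm0; split; first exact: ltW.
by move=> y; rewrite scale1r subrr inner0l cabs0 mulr_ge0 ?nrm_ge0 // ltW.
Qed.

Lemma approx_eigenP b S T c c' : approx_eigen S c -> approx_eigen T c' ->
  approx_eigen (b *: S + T) (b * c + c').
Proof.
move=> hS hT e e0.
have b0 : 0 < cabs b + 1 by rewrite ltr_wpDl ?cabs_ge0.
have e1 : 0 < e / (cabs b + 1) by rewrite divr_gt0.
have e2 : 0 < e / 2 by rewrite divr_gt0.
have e3 : 0 < e / 2 / (cabs b + 1) by rewrite !divr_gt0.
have he : cabs b * (e / 2 / (cabs b + 1)) <= e / 2.
  rewrite mulrA ler_pdivrMr // mulrC ler_wpM2l ?(ltW e2) // lerDl //.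
have key y : (b *: S + T) y - (b * c + c') *: y = b *: (S y - c *: y) + (T y - c' *: y).
  rewrite -[(b *: S + T) y]/(b *: S y + T y) scalerDl opprD addrACA -scalerA.
  by rewrite scalerBr.
apply: filterS2 (hS _ e3) (hT _ e2) => m h1 h2 a; have [h3 h4] := h1 a; have [h5 h6] := h2 a.
split=> [|y]; rewrite key.
  apply: le_trans (nrmD _ _) _; rewrite (splitr e); apply: lerD => //.
  by rewrite nrmZ; apply: le_trans (ler_wpM2l (cabs_ge0 b) h3) he.
rewrite innerDl innerZl; apply: le_trans (cabsD _ _) _.
rewrite (splitr e) mulrDl; apply: lerD => //.
rewrite cabsM; apply: le_trans (ler_wpM2l (cabs_ge0 b) (h4 y)) _.
by rewrite mulrA ler_wpM2r ?nrm_ge0.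
Qed.

Lemma approx_eigen_sum I (r : seq I) (T : I -> 'B(L)) (l c : I -> R[i]) :
  (forall i, approx_eigen (T i) (l i)) ->
  approx_eigen (\sum_(i <- r) c i *: T i) (\sum_(i <- r) c i * l i).
Proof.
move=> hT; elim: r => [|i r IH]; last by rewrite !big_cons; exact: approx_eigenP.
have := approx_eigenP (-1) approx_eigen1 approx_eigen1.
by rewrite !big_nil mulr1 addNr scaleN1r addNr.
Qed.

Lemma approx_eigenM S T c c' : approx_eigen S c -> approx_eigen T c' ->
  approx_eigen (bopM S T) (c * c').
Proof.
move=> hS hT e e0.
have [B B0 hB] := bop_bounded S; have [B' B'0 hB'] := bop_bounded T.
pose D := B + B' + cabs c + cabs c' + 1.
have D0 : 0 < D by rewrite ltr_wpDl // !addr_ge0 ?cabs_ge0.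
have e1 : 0 < e / 2 / D by rewrite !divr_gt0.
have le_eD t : 0 <= t -> t <= D -> t * (e / 2 / D) <= e / 2.
  move=> t0 tD; rewrite mulrA ler_pdivrMr // mulrC.
  by rewrite ler_wpM2l // divr_ge0 // ltW.
have hBD : B <= D.
  by rewrite /D -!addrA lerDl !addr_ge0 ?cabs_ge0.
have hB'D : B' <= D.
  by rewrite /D -!addrA addrCA lerDl !addr_ge0 ?cabs_ge0.
have hcD : cabs c <= D.
  by rewrite /D -!addrA addrA addrCA lerDl !addr_ge0 ?cabs_ge0.
have hc'D : cabs c' <= D.
  by rewrite /D addrAC lerDr !addr_ge0 ?cabs_ge0.
have key y : bopM S T y - (c * c') *: y = S (T y - c' *: y) + c' *: (S y - c *: y).
  by rewrite bopME bopB bopZ scalerBr scalerA [c' * c]mulrC addrA subrK.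
have key2 y : bopM S T y - (c * c') *: y = (S (T y) - c *: T y) + c *: (T y - c' *: y).
  by rewrite bopME scalerBr scalerA addrA subrK.
apply: filterS2 (hS _ e1) (hT _ e1) => m h1 h2 a; have [h3 h4] := h1 a; have [h5 h6] := h2 a.
split=> [|y].
  rewrite key; apply: le_trans (nrmD _ _) _; rewrite (splitr e); apply: lerD.
    by apply: le_trans (hB _) _; apply: le_trans (ler_wpM2l B0 h5) (le_eD _ B0 hBD).
  rewrite nrmZ; apply: le_trans (ler_wpM2l (cabs_ge0 _) h3) _.
  exact: le_eD (cabs_ge0 _) hc'D.
rewrite key2 innerDl innerZl; apply: le_trans (cabsD _ _) _.
rewrite (splitr e) mulrDl; apply: lerD.
  apply: le_trans (h4 _) _; rewrite mulrC.
  apply: le_trans (ler_wpM2r (ltW e1) (hB' y)) _.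
  by rewrite mulrAC ler_wpM2r ?nrm_ge0 // le_eD.
rewrite cabsM; apply: le_trans (ler_wpM2l (cabs_ge0 _) (h6 y)) _.
by rewrite mulrA ler_wpM2r ?nrm_ge0 // le_eD ?cabs_ge0.
Qed.

Lemma approx_eigen_adjoint S T c : is_adjoint S T -> approx_eigen S c ->
  approx_eigen T c^*.
Proof.
move=> ST hS e e0; apply: filterS (hS _ e0) => m h a; have [h1 h2] := h a.
have TS u v : inner (T u) v = inner u (S v) by rewrite innerJ -ST -innerJ.
split=> [|y].
  set z := T (x m a) - c^* *: x m a.
  have [->|z0] := eqVneq z 0; first by rewrite nrm0 ltW.
  have nz : 0 < nrm z by rewrite lt_def nrm_eq0 z0 nrm_ge0.
  rewrite -(ler_pM2r nz) -expr2 sqr_nrm.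
  apply: le_trans (h2 z); apply: le_trans (ler_norm _) _.
  apply: le_trans (Re_le_cabs _) _.
  have -> : inner z z = inner (x m a) (S z - c *: z).
    by rewrite {1}/z innerBl innerZl TS innerBr innerZr.
  by rewrite innerJ cabsJ.
have -> : inner (T y - c^* *: y) (x m a) = inner y (S (x m a) - c *: x m a).
  by rewrite innerBl innerZl TS innerBr innerZr.
apply: le_trans (cauchy_schwarz _ _) _; rewrite mulrC.
by rewrite ler_wpM2r ?nrm_ge0.
Qed.

Definition ultra_state T : R[i] := clim U (fun m => \sum_a inner (T (x m a)) (x m a)).

Lemma ultra_stateP T :
  ucvg U (fun m => \sum_a inner (T (x m a)) (x m a)) (ultra_state T).
Proof.
have [B B0 hB] := bop_bounded T.
apply: (@clim_cvg _ _ _ _ _ B); apply: filterE => m /=.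
apply: le_trans (cabs_sum _ _ _) _; rewrite -[B]mulr1 -(x1 m) mulr_sumr.
apply: ler_sum => a _; apply: le_trans (cauchy_schwarz _ _) _.
by rewrite -sqr_nrm expr2 mulrA ler_wpM2r ?nrm_ge0.
Qed.

Lemma approx_eigen_state T c : approx_eigen T c -> ultra_state T = c.
Proof.
move=> hT; apply: (ucvg_uniq (ultra_stateP T)) => e e0.
have n1 : 0 < n%:R + 1 :> R by rewrite ltr_wpDl.
have e1 : 0 < e / 2 / (n%:R + 1) by rewrite !divr_gt0.
apply: filterS (hT _ e1) => m h /=.
have -> : \sum_a inner (T (x m a)) (x m a) - c =
    \sum_a inner (T (x m a) - c *: x m a) (x m a).
  under [RHS]eq_bigr do rewrite innerBl innerZl inner_self.
  by rewrite sumrB -mulr_sumr -rmorph_sum /= x1 mulr1.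
apply: le_lt_trans (cabs_sum _ _ _) _.
apply: le_lt_trans (_ : n%:R * (e / 2 / (n%:R + 1)) < e); last first.
  apply: le_lt_trans (_ : e / 2 < e); last by rewrite ltr_pdivrMr // mulr_natr mulr2n ltrDl.
  rewrite mulrA ler_pdivrMr // mulrC ler_wpM2l ?lerDl //.
  by rewrite divr_ge0 // ltW.
rewrite mulr_natl -[X in _ *+ X](card_ord n) -sumr_const; apply: ler_sum => a _.
apply: le_trans (cauchy_schwarz _ _) _; have [h1 _] := h a.
apply: le_trans (ler_wpM2l (nrm_ge0 _) (nrm_x_le1 m a)) _.
by rewrite mulr1.
Qed.

(** [ultra_state] is contractive, so the eigenvalues of the approximants of [T] lie close to
    [ultra_state T], which can therefore serve as eigenvalue of [T]. *)
Lemma approx_eigen_closed T :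
  (forall e : R, 0 < e -> exists S c, approx_eigen S c /\
     forall y, nrm (T y - S y) <= e * nrm y) -> approx_eigen T (ultra_state T).
Proof.
move=> h e e0; have e3 : 0 < e / 3 by rewrite divr_gt0.
have [S [c [hS TS]]] := h _ e3.
have cT : cabs (c - ultra_state T) <= e / 3.
  rewrite cabsB.
  have hc : ucvg U (fun m => \sum_a inner (T (x m a)) (x m a) -
      \sum_a inner (S (x m a)) (x m a)) (ultra_state T - c).
    by apply: ucvgB (ultra_stateP T) _; rewrite -(approx_eigen_state hS); exact: ultra_stateP.
  apply: ucvg_cabs_le hc _; apply: filterE => m /=.
  rewrite -sumrB; apply: le_trans (cabs_sum _ _ _) _.
  rewrite -[leRHS]mulr1 -[X in _ <= _ * X](x1 m) mulr_sumr; apply: ler_sum => a _.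
  rewrite -innerBl; apply: le_trans (cauchy_schwarz _ _) _.
  rewrite -sqr_nrm expr2 mulrA; apply: ler_wpM2r; [exact: nrm_ge0|exact: TS].
have key y : T y - ultra_state T *: y =
    (T y - S y) + (S y - c *: y) + (c - ultra_state T) *: y.
  by rewrite scalerBl !subrKA.
have ee : e = e / 3 + e / 3 + e / 3 by field.
apply: filterS (hS _ e3) => m hm a; have [h1 h2] := hm a; split=> [|y]; rewrite key.
  apply: le_trans (nrmD _ _) _; rewrite {1}ee; apply: lerD.
    apply: le_trans (nrmD _ _) _; apply: lerD => //.
    apply: le_trans (TS _) _.
    by rewrite -[X in _ <= X]mulr1 ler_wpM2l ?nrm_x_le1 // ltW.
  rewrite nrmZ; apply: le_trans (ler_wpM2l (cabs_ge0 _) (nrm_x_le1 m a)) _.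
  by rewrite mulr1.
rewrite (innerDl (T y - S y + (S y - c *: y))) (innerDl (T y - S y)).
apply: le_trans (cabsD _ _) _; rewrite {1}ee mulrDl; apply: lerD.
  apply: le_trans (cabsD _ _) _; rewrite mulrDl; apply: lerD => //.
  apply: le_trans (cauchy_schwarz _ _) _.
  apply: le_trans (ler_wpM2l (nrm_ge0 _) (nrm_x_le1 m a)) _.
  by rewrite mulr1.
apply: le_trans (cauchy_schwarz _ _) _.
apply: le_trans (ler_wpM2l (nrm_ge0 _) (nrm_x_le1 m a)) _.
by rewrite mulr1 nrmZ ler_wpM2r ?nrm_ge0.
Qed.

(** The operators with an approximate eigenvalue along [x] form a unital C*-algebra that contains
    the [N i], hence contains [Cstar N]; there the eigenvalue is a character. *)
Lemma approx_eigen_spectrum d (N : 'I_d -> 'B(L)) (l : 'rV[R[i]^o]_d) :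
  (forall i, approx_eigen (N i) (l 0 i)) -> joint_spectrum N l.
Proof.
move=> hN; pose A : set 'B(L) := [set T | exists c, approx_eigen T c].
have NA : Cstar N `<=` A.
  move=> T; apply; split; last by move=> i; exists (l 0 i).
  split.
  - by exists 1; exact: approx_eigen1.
  - by move=> a S S' [c hc] [c' hc']; exists (a * c + c'); exact: approx_eigenP.
  - by move=> S S' [c hc] [c' hc']; exists (c * c'); exact: approx_eigenM.
  - by move=> S S' SS' [c hc]; exists c^*; exact: approx_eigen_adjoint SS' hc.
  - move=> S hS; exists (ultra_state S); apply: approx_eigen_closed => e e0.
    have [|S' [c hc] SS'] := hS e%:C; first by rewrite ltcR.
    exists S', c; split=> // y; have := SS' y.
    by rewrite !norm_nrm -rmorphM lecR.
exists ultra_state; last by move=> i; rewrite (approx_eigen_state (hN i)).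
split.
- by rewrite (approx_eigen_state approx_eigen1).
- move=> a S T /NA[c hc] /NA[c' hc'].
  by rewrite (approx_eigen_state (approx_eigenP a hc hc')) (approx_eigen_state hc) (approx_eigen_state hc').
- move=> S T /NA[c hc] /NA[c' hc'].
  by rewrite (approx_eigen_state (approx_eigenM hc hc')) (approx_eigen_state hc) (approx_eigen_state hc').
Qed.

End ApproximateCharacter.

(** * Pencils of normal tuples *)

Section NormalPencils.
Variables (R : realType) (d n : nat) (L : hilbertType R) (N : 'I_d -> 'B(L)).
Hypothesis Nnormal : normal_tuple N.
Variables (K : set 'rV[R[i]^o]_d) (q : 'I_n -> 'I_n -> R[i]).
Variable y : 'I_d -> 'I_n -> 'I_n -> R[i].
Hypothesis NK : joint_spectrum N `<=` K.
Hypothesis yK : forall mu, K mu -> forall w : 'I_n -> R[i],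
  Re (\sum_a \sum_b (q a b + \sum_i y i a b * mu 0 i) * (w b * (w a)^*)) <= 0.

Definition commuting (S T : 'B(L)) := forall x, S (T x) = T (S x).

Lemma commuting_sym S T : commuting S T -> commuting T S.
Proof. by move=> h x; rewrite h. Qed.
Lemma commutingP S a T T' : commuting S T -> commuting S T' -> commuting S (a *: T + T').
Proof.
move=> h h' x; rewrite -[(a *: T + T') x]/(a *: T x + T' x).
by rewrite bopD bopZ h h'.
Qed.
Lemma commuting_sum S I (r : seq I) (F : I -> 'B(L)) (c : I -> R[i]) T0 :
  commuting S T0 -> (forall i, commuting S (F i)) ->
  commuting S (T0 + \sum_(i <- r) c i *: F i).
Proof.
move=> h0 hF; elim: r => [|i r IH]; first by rewrite big_nil addr0.
by rewrite big_cons addrCA; apply: commutingP.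
Qed.

Local Notation Ns i := (adj (N i)).

Lemma normal_adj i : commuting (N i) (Ns i).
Proof.
have [S NS h] := Nnormal.1 i; move=> x; rewrite -(adj_uniq NS).
exact: (congr1 (fun T : 'B(L) => T x) h).
Qed.

Lemma normal_commN i j : commuting (N i) (N j).
Proof. by move=> x; exact: (congr1 (fun T : 'B(L) => T x) (Nnormal.2 i j)). Qed.

Lemma normal_comm_adj i j : commuting (N i) (Ns j).
Proof.
move=> x; have NNs : bopM (N j) (Ns j) = bopM (Ns j) (N j).
  by apply: bop_ext => z; exact: normal_adj.
have := fuglede (@adjP _ _ (N j)) NNs (Nnormal.2 i j).
by move/(congr1 (fun T : 'B(L) => T x)).
Qed.

Lemma normal_adj_adj i j : commuting (Ns i) (Ns j).
Proof. by move=> x; apply: inner_ext => z; rewrite !adjl normal_commN. Qed.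

(* Real and imaginary parts of [N_i], up to a factor 2. *)
Let Sre i : 'B(L) := N i + Ns i.
Let Sim i : 'B(L) := 'i%C *: (Ns i - N i).

(** A single sequence of commuting Hermitian operators, the form that [joint_eigen_step] expects:
    positions [2i] and [2i+1] hold the two parts of [N i], and 0 follows. *)
Let part (j : nat) : 'B(L) :=
  if insub j./2 is Some i then if odd j then Sim i else Sre i else 0.

Let partP (P : 'B(L) -> Prop) j : P 0 -> (forall i, P (Sre i)) -> (forall i, P (Sim i)) ->
  P (part j).
Proof. by move=> h0 h1 h2; rewrite /part; case: insub => // i; case: ifP. Qed.

Let commuting0 S : commuting S 0.
Proof. by move=> x; rewrite !bop_zeroE bop0. Qed.

Let comm_Sre S i : commuting S (N i) -> commuting S (Ns i) -> commuting S (Sre i).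
Proof.
move=> h h' x; rewrite -[Sre i x]/(N i x + Ns i x).
by rewrite bopD h h'.
Qed.
Let comm_Sim S i : commuting S (N i) -> commuting S (Ns i) -> commuting S (Sim i).
Proof.
move=> h h' x; rewrite -[Sim i x]/('i%C *: (Ns i x - N i x)).
by rewrite bopZ bopB h h'.
Qed.

Let comm_part S j : (forall i, commuting S (N i)) -> (forall i, commuting S (Ns i)) ->
  commuting S (part j).
Proof.
move=> h h'; apply: (partP (P := commuting S)); first exact: commuting0.
  by move=> i; exact: comm_Sre.
by move=> i; exact: comm_Sim.
Qed.

Let part_N j i : commuting (part j) (N i).
Proof.
apply/commuting_sym/comm_part => k; first exact: normal_commN.
exact: normal_comm_adj.
Qed.
Let part_Ns j i : commuting (part j) (Ns i).
Proof.
apply/commuting_sym/comm_part => k; last exact: normal_adj_adj.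
by apply/commuting_sym; exact: normal_comm_adj.
Qed.
Let part_part j k : commuting (part j) (part k).
Proof. by apply: comm_part => i; [exact: part_N|exact: part_Ns]. Qed.

Let part_sym j u v : inner (part j u) v = inner u (part j v).
Proof.
apply: (partP (P := fun T : 'B(L) => inner (T u) v = inner u (T v))).
- by rewrite !bop_zeroE inner0l inner0r.
- move=> i; rewrite -[Sre i u]/(N i u + Ns i u) -[Sre i v]/(N i v + Ns i v).
  by rewrite innerDl innerDr (adjP (N i)) (adjl (N i)) addrC.
- move=> i; rewrite -[Sim i u]/('i%C *: (Ns i u - N i u)).
  rewrite -[Sim i v]/('i%C *: (Ns i v - N i v)).
  rewrite innerZl innerZr innerBl innerBr (adjP (N i)) (adjl (N i)).
  have -> : ('i%C : R[i])^* = - 'i%C by apply: complex_ext; rewrite /= ?oppr0.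
  ring.
Qed.

Let Y a b : 'B(L) := q a b *: bop1 L + \sum_i y i a b *: N i.
Let Ys a b : 'B(L) := (q b a)^* *: bop1 L + \sum_i (y i b a)^* *: Ns i.

Let YYs a b u v : inner (Y b a u) v = inner u (Ys a b v).
Proof.
rewrite -[Y b a u]/(q b a *: u + (\sum_i y i b a *: N i) u).
rewrite -[Ys a b v]/((q b a)^* *: v + (\sum_i (y i b a)^* *: Ns i) v).
rewrite innerDl innerDr innerZl innerZr conjcK; congr (_ + _).
rewrite !bop_sumE inner_suml inner_sumr; apply: eq_bigr => i _.
by rewrite !bop_scaleE innerZl innerZr conjcK adjP.
Qed.

Let part_Y j a b : commuting (part j) (Y a b).
Proof.
apply: commuting_sum => [x|i]; last exact: part_N.
by rewrite -[RHS]/(q a b *: part j x) -bopZ.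
Qed.
Let part_Ys j a b : commuting (part j) (Ys a b).
Proof.
apply: commuting_sum => [x|i]; last exact: part_Ns.
by rewrite -[RHS]/((q b a)^* *: part j x) -bopZ.
Qed.

Notation E := {ffun 'I_n -> L}.
Implicit Types (xi eta : E).

Let F xi eta : R[i] := \sum_a inner (xi a) (eta a).
Let FP c xi eta zeta : F (c *: xi + eta) zeta = c * F xi zeta + F eta zeta.
Proof.
rewrite /F mulr_sumr -big_split; apply: eq_bigr => a _.
by rewrite !ffunE innerDl innerZl.
Qed.
Let FJ xi eta : F eta xi = (F xi eta)^*.
Proof. by rewrite /F conjc_sum; apply: eq_bigr => a _; exact: innerJ. Qed.
Let FE xi : Re (F xi xi) = \sum_a nsq (xi a).
Proof. exact: Re_sum. Qed.
Let F_ge0 xi : 0 <= Re (F xi xi).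
Proof. by rewrite FE; apply: sumr_ge0 => a _; exact: nsq_ge0. Qed.

Let nsq_sum (I : Type) (r : seq I) (f : I -> L) :
  nsq (\sum_(i <- r) f i) <= 2 ^+ size r * \sum_(i <- r) nsq (f i).
Proof.
elim: r => [|i r IH]; first by rewrite !big_nil nsq0 mulr0.
rewrite !big_cons /=.
apply: le_trans (_ : 2 * nsq (f i) + 2 * nsq (\sum_(j <- r) f j) <= _).
  have := nsq_ge0 (f i - \sum_(j <- r) f j); rewrite nsqB nsqD; lra.
rewrite exprS mulrDr -!mulrA; apply: lerD; last by rewrite ler_pM2l.
rewrite ler_wpM2l // -[leLHS]mul1r ler_wpM2r ?nsq_ge0 //.
by rewrite exprn_ege1 // ler1n.
Qed.

Let hat (T : 'B(L)) xi : E := [ffun a => T (xi a)].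

Let hat_bounded (T : 'B(L)) : exists2 M, 0 <= M &
  forall xi, Re (F (hat T xi) (hat T xi)) <= M * Re (F xi xi).
Proof.
have [B B0 hB] := bop_bounded T; exists (B ^+ 2); first exact: sqr_ge0.
move=> xi; rewrite !FE mulr_sumr; apply: ler_sum => a _; rewrite ffunE.
by rewrite -!sqr_nrm -exprMn lerXn2r ?nnegrE ?nrm_ge0 ?mulr_ge0 ?nrm_ge0.
Qed.

(** Twice the real part of the pencil, acting on the sum of [n] copies of [L]: [Ys] is the adjoint
    of [Y] as an operator matrix. *)
Let G xi : E := [ffun a => \sum_b (Y a b (xi b) + Ys a b (xi b))].

Let GP c xi eta : G (c *: xi + eta) = c *: G xi + G eta.
Proof.
apply/ffunP => a; rewrite !ffunE scaler_sumr -big_split; apply: eq_bigr => b _.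
by rewrite !ffunE !bopD !bopZ addrACA -scalerDr.
Qed.

Let G_sym xi eta : F (G xi) eta = F xi (G eta).
Proof.
rewrite /F.
transitivity (\sum_a \sum_b (inner (Y a b (xi b)) (eta a) + inner (Ys a b (xi b)) (eta a))).
  apply: eq_bigr => a _; rewrite ffunE inner_suml; apply: eq_bigr => b _.
  by rewrite innerDl.
rewrite exchange_big; apply: eq_bigr => a _; rewrite ffunE inner_sumr.
apply: eq_bigr => b _; rewrite innerDr addrC -YYs YYs; congr (_ + _).
by rewrite innerJ -YYs -innerJ.
Qed.

Let G_bounded : exists2 M, 0 <= M & forall xi, Re (F (G xi) (G xi)) <= M * Re (F xi xi).
Proof.
have hB a b : exists B, 0 <= B /\ forall x, nrm ((Y a b + Ys a b) x) <= B * nrm x.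
  by have [B B0 hB] := bop_bounded (Y a b + Ys a b); exists B.
have [B hB'] := choice (fun ab : 'I_n * 'I_n => hB ab.1 ab.2).
have B0 a b : 0 <= B (a, b) by case: (hB' (a, b)).
have Bb a b x : nsq (Y a b x + Ys a b x) <= B (a, b) ^+ 2 * nsq x.
  rewrite -!sqr_nrm -exprMn lerXn2r ?nnegrE ?nrm_ge0 ?mulr_ge0 ?nrm_ge0 ?B0 //.
  by case: (hB' (a, b)) => _; apply.
pose s := size (index_enum 'I_n).
exists (\sum_a 2 ^+ s * \sum_b B (a, b) ^+ 2) => [|xi].
  apply: sumr_ge0 => a _; rewrite mulr_ge0 ?exprn_ge0 // sumr_ge0 // => b _.
  exact: sqr_ge0.
rewrite FE mulr_suml; apply: ler_sum => a _; rewrite ffunE.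
apply: le_trans (nsq_sum _ _) _; rewrite -/s -mulrA ler_wpM2l ?exprn_ge0 //.
rewrite mulr_suml; apply: ler_sum => b _; apply: le_trans (Bb _ _ _) _.
rewrite ler_wpM2l ?sqr_ge0 // FE (bigD1 b) //= lerDl sumr_ge0 // => c _.
exact: nsq_ge0.
Qed.

Let G_hat j xi : G (hat (part j) xi) = hat (part j) (G xi).
Proof.
apply/ffunP => a; rewrite !ffunE bop_sum; apply: eq_bigr => b _.
by rewrite !ffunE bopD part_Y part_Ys.
Qed.

Let G_pencil xi : Re (F (G xi) xi) = 2 * Re (pencil N q y xi).
Proof.
have e : pencil N q y xi = \sum_a \sum_b inner (Y a b (xi b)) (xi a).
  apply: eq_bigr => a _; apply: eq_bigr => b _.
  rewrite -[Y a b (xi b)]/(q a b *: xi b + (\sum_i y i a b *: N i) (xi b)).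
  rewrite innerDl innerZl bop_sumE inner_suml; congr (_ + _).
  by apply: eq_bigr => i _; rewrite bop_scaleE innerZl.
have -> : F (G xi) xi = pencil N q y xi + (pencil N q y xi)^*.
  rewrite e conjc_sum.
  rewrite [X in _ = _ + X](eq_bigr (fun a => \sum_b (inner (Y a b (xi b)) (xi a))^*)); last first.
    by move=> a _; rewrite conjc_sum.
  rewrite [X in _ = _ + X]exchange_big -big_split; apply: eq_bigr => a _.
  rewrite ffunE inner_suml -big_split; apply: eq_bigr => b _.
  by rewrite innerDl; congr (_ + _); rewrite YYs -innerJ.
by rewrite ReD ReJ; ring.
Qed.

(* A positive value would give joint approximate eigenvectors of the symmetrized
   pencil, for a positive eigenvalue, and of the [N i]; their eigenvalues form a
   point of the spectrum at which the pencil is positive. *)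
Lemma normal_pencil_nonpos (xi0 : 'I_n -> L) : Re (pencil N q y xi0) <= 0.
Proof.
rewrite leNgt; apply/negP => pos.
pose xi : E := [ffun a => xi0 a].
have {}pos : 0 < Re (F (G xi) xi).
  rewrite G_pencil mulr_gt0 //; congr (0 < Re _): pos.
  by apply: eq_bigr => a _; apply: eq_bigr => b _; rewrite !ffunE.
have [M M0 hM] := G_bounded.
pose qE xi := Re (F xi xi).
(* The shift by [m] turns [G] into a positive operator [T], to which [positive_step] applies. *)
pose m := M + 1; have m0 : 0 < m by rewrite ltr_wpDl.
pose T xi : E := m%:C *: xi + G xi.
have TP c xi1 eta : T (c *: xi1 + eta) = c *: T xi1 + T eta.
  by rewrite /T GP !scalerDr addrACA !scalerA [m%:C * c]mulrC.
have Gb z : `|Re (F (G z) z)| <= m * qE z.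
  rewrite -(@ler_pXn2r _ 2) ?nnegrE ?mulr_ge0 ?F_ge0 ?(ltW m0) // real_normK ?num_real //.
  apply: le_trans (_ : csq (F (G z) z) <= _); first by rewrite /csq lerDl sqr_ge0.
  apply: le_trans (form_cauchy_schwarz FP FJ F_ge0 _ _) _.
  apply: le_trans (ler_wpM2r (F_ge0 z) (hM z)) _.
  have h : M <= m ^+ 2 by rewrite /m; nra.
  by rewrite exprMn -mulrA -expr2; apply: ler_wpM2r h; exact: sqr_ge0.
have Tpos z : 0 <= Re (F (T z) z).
  rewrite /T FP ReD ReMr; have := Gb z; rewrite ler_norml => /andP[]; rewrite /qE; lra.
have Tsb : sym_bounded F T (2 * m ^+ 2 + 2 * M).
  split=> [//|z w|z].
    by rewrite /T FP (formDr FP FJ) (formZr FP FJ) conjc_real G_sym.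
  have := F_ge0 (m%:C *: z - G z); have := hM z.
  rewrite /T -scaleN1r !(form_sqD FP FJ) !(form_sqZ FP FJ) csqr csqN csq1.
  rewrite [F _ (-1 *: _)](formZr FP FJ) conjcN conjc1 mulN1r ReN mul1r; lra.
have TM0 : 0 <= 2 * m ^+ 2 + 2 * M by rewrite addr_ge0 // mulr_ge0 // sqr_ge0.
have xi_pos : 0 < qE xi.
  rewrite lt_def F_ge0 andbT; apply: contraTneq pos => z.
  have := Gb xi; rewrite /qE in z *; rewrite z mulr0 normr_le0 => /eqP ->.
  by rewrite ltxx.
have [] := @positive_step _ _ F FP FJ F_ge0 (fun=> 0) T _ 0 (fun=> lexx _) TM0 (lexx _) Tsb Tpos.
- by move=> z; rewrite mul0r.
- by move=> e e0; exists xi => //; rewrite mulr_ge0 // ltW.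
move=> r [r0 hr rmax].
pose g := Re (F (G xi) xi) / qE xi; have g0 : 0 < g by rewrite divr_gt0.
(* [xi] itself is a competitor, so [r] is at least [m] plus the Rayleigh quotient [g] of [G] at
   [xi]. Thus [gam = r - m] is a positive approximate eigenvalue of [G]. *)
have rg : m + g <= r.
  rewrite -(@ler_pXn2r _ 2) ?nnegrE ?addr_ge0 ?(ltW m0) ?(ltW g0) //.
  apply: rmax => e e0; exists xi; split=> //.
    by rewrite mulr_ge0 // ltW.
  rewrite -(ler_pM2r xi_pos).
  apply: le_trans (form_cauchy_schwarz FP FJ F_ge0 (T xi) xi).
  apply: le_trans (_ : Re (F (T xi) xi) ^+ 2 <= _); last by rewrite /csq lerDl sqr_ge0.
  rewrite /T FP ReD ReMr -/(qE xi) le_eqVlt; apply/orP; left; apply/eqP.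
  by rewrite /g; field; exact: lt0r_neq0.
pose gam := r - m; have gam0 : 0 < gam by rewrite subr_gt0; lra.
pose c z := qE (G z - gam%:C *: z).
have cT z : c z = 0 + qE (T z - r%:C *: z).
  rewrite /c add0r; congr qE; rewrite /T /gam rmorphB scalerBl opprB.
  by rewrite addrA [G z + _]addrC.
have lin_c a u v : G (a *: u + v) - gam%:C *: (a *: u + v) =
    a *: (G u - gam%:C *: u) + (G v - gam%:C *: v).
  by rewrite GP scalerDr opprD addrACA scalerBr !scalerA [gam%:C * a]mulrC.
have hat_sb j : exists2 M', 0 <= M' & sym_bounded F (hat (part j)) M'.
  have [M' M'0 hM'] := hat_bounded (part j); exists M' => //; split=> // [a u v|u v].
    by apply/ffunP => b; rewrite !ffunE bopD bopZ.
  by apply: eq_bigr => b _; rewrite !ffunE part_sym.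
have hat_c j z : G (hat (part j) z) - gam%:C *: hat (part j) z =
    hat (part j) (G z - gam%:C *: z).
  by apply/ffunP => a; rewrite G_hat !ffunE bopB bopZ.
(* The defect [c] of the eigenvalue [gam] is the initial constraint, so the vectors found for the
   parts remain approximate eigenvectors of [G]. *)
have [] := @joint_eigen_step _ _ F FP FJ F_ge0 c (fun j => hat (part j)) d.*2.
- by move=> z; exact: F_ge0.
- exact: hat_sb.
- by move=> j k z; apply/ffunP => a; rewrite !ffunE part_part.
- move=> u v; rewrite /c.
  have -> : G (u + v) - gam%:C *: (u + v) = (G u - gam%:C *: u) + (G v - gam%:C *: v).
    by have := lin_c 1 u v; rewrite !scale1r.
  move: (G u - _) (G v - _) => s t.
  have := F_ge0 (s - t); rewrite /qE -scaleN1r !(form_sqD FP FJ) (form_sqZ FP FJ) (formZr FP FJ).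
  rewrite csqN csq1 conjcN conjc1 mulN1r ReN mul1r; lra.
- move=> a u; rewrite /c.
  have -> : G (a *: u) - gam%:C *: (a *: u) = a *: (G u - gam%:C *: u).
    have := lin_c a u 0; rewrite !addr0 => ->.
    have -> : G 0 = 0 by have := GP (-1) 0 0; rewrite scaler0 addr0 scaleN1r addNr.
    by rewrite scaler0 subrr addr0.
  exact: (form_sqZ FP FJ).
- move=> j; have [M' M'0 hM'] := hat_bounded (part j); exists M' => // z.
  by rewrite /c hat_c; exact: hM'.
- by move=> e e0; have [z z0 hz] := hr e e0; exists z => //; rewrite cT.
move=> l hl.
have seq_ex (k : nat) : exists z : E, qE z = 1 /\
    family_defect F c (fun j => hat (part j)) l d.*2 z <= k.+1%:R^-1.
  by have [|z z1 hz] := hl k.+1%:R^-1; [rewrite invr_gt0 ltr0n|exists z].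
have [z hz] := choice seq_ex.
pose x k a := z k a.
have x1 k : \sum_a nsq (x k a) = 1 by rewrite -FE; case: (hz k).
have UU := even_ultra_ultra; set U := even_ultra in UU.
have PU : ProperFilter U := @ultra_proper _ _ UU.
have small (e : R) : 0 < e -> U [set k | k.+1%:R^-1 <= e ^+ 2].
  move=> e0; have e2 : 0 < e ^+ 2 by rewrite exprn_gt0.
  apply: filterS (even_ultra_eventually (Num.bound (e ^+ 2)^-1)) => k /= [ek _].
  rewrite -[e ^+ 2]invrK lef_pV2 ?posrE ?invr_gt0 ?ltr0n //.
  apply: ltW; apply: lt_le_trans (archi_boundP _) _; first by rewrite invr_ge0 ltW.
  by rewrite ler_nat (leq_trans ek).
have nrm_le (u : E) (e : R) a : 0 < e -> qE u <= e ^+ 2 -> nrm (u a) <= e.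
  move=> e0; rewrite /qE FE (bigD1 a) //= => h.
  rewrite -(@ler_pXn2r _ 2) ?nnegrE ?nrm_ge0 ?(ltW e0) // sqr_nrm.
  by apply: le_trans h; rewrite lerDl sumr_ge0 // => b _; exact: nsq_ge0.
have Gsmall (e : R) : 0 < e -> U [set k | forall a, nrm (G (z k) a - gam%:C *: x k a) <= e].
  move=> e0; apply: filterS (small e e0) => k /= hk a.
  have -> : G (z k) a - gam%:C *: x k a = (G (z k) - gam%:C *: z k) a by rewrite !ffunE.
  apply: nrm_le => //; apply: le_trans hk; case: (hz k) => _; apply: le_trans.
  by rewrite /family_defect lerDl sumr_ge0.
have Psmall (e : R) : 0 < e -> U [set k | forall j a, (j < d.*2)%N ->
    nrm (part j (x k a) - (l j)%:C *: x k a) <= e].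
  move=> e0; apply: filterS (small e e0) => k /= hk j a jd.
  have -> : part j (x k a) - (l j)%:C *: x k a = (hat (part j) (z k) - (l j)%:C *: z k) a.
    by rewrite !ffunE.
  apply: nrm_le => //; apply: le_trans hk; case: (hz k) => _; apply: le_trans.
  rewrite /family_defect (bigD1 (Ordinal jd)) //= addrCA lerDl; apply: addr_ge0; first exact: F_ge0.
  by apply: sumr_ge0 => j' _; exact: F_ge0.
pose lam : 'rV[R[i]^o]_d := \row_i (2^-1%:C * ((l i.*2)%:C + 'i%C * (l i.*2.+1)%:C)).
have partE (i : 'I_d) : part i.*2 = Sre i /\ part i.*2.+1 = Sim i.
  by rewrite /part /= odd_double doubleK uphalf_double valK.
have half_add (u : L) : (2^-1 : R)%:C *: (u + u) = u.
  rewrite scalerDr -scalerDl -rmorphD /= (_ : 2^-1 + 2^-1 = 1 :> R) ?scale1r //.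
  by field.
have NE i u : N i u = (2^-1 : R)%:C *: (Sre i u + 'i%C *: Sim i u).
  rewrite -[Sre i u]/(N i u + Ns i u) -[Sim i u]/('i%C *: (Ns i u - N i u)).
  rewrite scalerA -expr2 sqr_i scaleN1r opprB addrACA subrr addr0.
  by rewrite half_add.
have NsE i u : Ns i u = (2^-1 : R)%:C *: (Sre i u - 'i%C *: Sim i u).
  rewrite -[Sre i u]/(N i u + Ns i u) -[Sim i u]/('i%C *: (Ns i u - N i u)).
  rewrite scalerA -expr2 sqr_i scaleN1r opprK [N i u + _]addrC addrACA subrr addr0.
  by rewrite half_add.
have cabs2 : cabs ((2^-1 : R)%:C) = 2^-1 by rewrite cabsr ger0_norm ?invr_ge0 ?ler0n.
have cabsi : cabs ('i%C : R[i]) = 1 by rewrite /cabs /csq /= expr0n expr1n add0r sqrtr1.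
have bound (e : R) (s t : L) : nrm s <= e -> nrm t <= e ->
    nrm ((2^-1 : R)%:C *: (s + 'i%C *: t)) <= e.
  move=> hs ht; rewrite nrmZ cabs2; have := nrmD s ('i%C *: t).
  rewrite nrmZ cabsi mul1r; lra.
have combine (s t u : L) (h k : R) :
    (2^-1 : R)%:C *: (s + 'i%C *: t) - ((2^-1 : R)%:C * (h%:C + 'i%C * k%:C)) *: u =
    (2^-1 : R)%:C *: ((s - h%:C *: u) + 'i%C *: (t - k%:C *: u)).
  by rewrite -scalerA -scalerBr scalerDl opprD addrACA [in RHS]scalerBr scalerA.
have hN i : approx_eigen U x (N i) (lam 0 i).
  move=> e e0; apply: filterS (Psmall e e0) => k hk a.
  have [p1 p2] := partE i.
  have id2 : (i.*2 < d.*2)%N by rewrite ltn_double.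
  have id2' : (i.*2.+1 < d.*2)%N by have := ltn_ord i; lia.
  have := hk _ a id2; have := hk _ a id2'; rewrite p1 p2 => h2 h1.
  split=> [|w].
    have -> : N i (x k a) - lam 0 i *: x k a = (2^-1 : R)%:C *:
       ((Sre i (x k a) - (l i.*2)%:C *: x k a) + 'i%C *: (Sim i (x k a) - (l i.*2.+1)%:C *: x k a)).
      by rewrite NE mxE combine.
    exact: bound.
  (* The weak half is moved to the adjoint of [N i], a combination of the same two parts. *)
  have -> : inner (N i w - lam 0 i *: w) (x k a) = inner w ((2^-1 : R)%:C *:
       ((Sre i (x k a) - (l i.*2)%:C *: x k a) + 'i%C *: (- (Sim i (x k a) - (l i.*2.+1)%:C *: x k a)))).
    rewrite innerBl innerZl (adjP (N i)) -[lam 0 i]conjcK -innerZr -innerBr; congr (inner w _).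
    have -> : (lam 0 i)^* = (2^-1 : R)%:C * ((l i.*2)%:C + 'i%C * (- l i.*2.+1)%:C).
      by rewrite mxE; apply: complex_ext; rewrite ?ReJ ?ImJ !(ReM, ImM, ReD, ImD) /=; ring.
    rewrite NsE -scalerN combine; congr (_ *: (_ + _ *: _)).
    by rewrite rmorphN scaleNr opprK opprB addrC.
  apply: le_trans (cauchy_schwarz _ _) _; rewrite mulrC ler_wpM2r ?nrm_ge0 //.
  by apply: bound; rewrite ?nrmN.
have hNs i : approx_eigen U x (Ns i) (lam 0 i)^*.
  exact: approx_eigen_adjoint (@adjP _ _ (N i)) (hN i).
have Klam : K lam by apply: NK; exact: (approx_eigen_spectrum UU x1 hN).
pose cf a b : R[i] := q a b + \sum_i y i a b * lam 0 i.
have hY a b : approx_eigen U x (Y a b) (cf a b).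
  have := approx_eigenP UU (q a b) (approx_eigen1 UU x) (approx_eigen_sum UU (index_enum _) (fun i => y i a b) hN).
  by rewrite mulr1.
have hYs a b : approx_eigen U x (Ys a b) (cf b a)^*.
  have := approx_eigenP UU (q b a)^* (approx_eigen1 UU x) (approx_eigen_sum UU (index_enum _) (fun i => (y i b a)^*) hNs).
  rewrite mulr1 /cf conjcD conjc_sum.
  by under [X in _ -> approx_eigen _ _ _ (_ + X)]eq_bigr do rewrite conjcM.
have n0 : (0 < n)%N.
  rewrite lt0n; apply: contraTneq (oner_neq0 R) => n0; rewrite negbK -(x1 0) big1 // => a _.
  by have := ltn_ord a; rewrite {2}n0.
have nR : 0 < n%:R :> R by rewrite ltr0n.
pose D : R := n%:R * (2 * n%:R + 1).
have D0 : 0 < D by rewrite mulr_gt0 // addr_gt0 // mulr_gt0.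
(* With this tolerance [D * e] is half of [gam / n^2], which [hge] shows to be a lower bound. *)
pose e : R := gam / n%:R ^+ 2 / D / 2.
have n2 : 0 < n%:R ^+ 2 :> R by rewrite exprn_gt0.
have e0 : 0 < e by rewrite !divr_gt0.
have UY : U [set k | forall ab : 'I_n * 'I_n, forall a,
    nrm (Y ab.1 ab.2 (x k a) - cf ab.1 ab.2 *: x k a) <= e /\
    nrm (Ys ab.1 ab.2 (x k a) - (cf ab.2 ab.1)^* *: x k a) <= e].
  apply: (filter_forall (F := U)) => -[a b] /=.
  apply: filterS2 (hY a b e e0) (hYs a b e e0) => k h1 h2 a'.
  by split; [case: (h1 a')|case: (h2 a')].
have [k [/= hYk hGk]] := proper_meet UY (Gsmall e e0).
pose v a := \sum_b (cf a b + (cf b a)^*) *: x k b - gam%:C *: x k a.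
have hv a : nrm (v a) <= (2 * n%:R + 1) * e.
  have -> : v a = (G (z k) a - gam%:C *: x k a) -
      \sum_b ((Y a b (x k b) - cf a b *: x k b) + (Ys a b (x k b) - (cf b a)^* *: x k b)).
    rewrite ffunE /v addrAC; congr (_ - _); rewrite -sumrB; apply: eq_bigr => b _.
    by rewrite [X in _ = _ - X]addrACA -opprD opprB addrCA subrr addr0 scalerDl.
  apply: le_trans (nrmD _ _) _; rewrite nrmN mulrDl mul1r addrC; apply: lerD => //.
  apply: le_trans (nrm_sum _ _ _) _.
  rewrite mulrAC mulr_natr -[X in _ *+ X](card_ord n) -sumr_const; apply: ler_sum => b _.
  apply: le_trans (nrmD _ _) _; have [h1 h2] := hYk (a, b) b; rewrite mulr2n mulrDl !mul1r.
  exact: lerD.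
(* Testing against the largest component [x k a0] turns vectors into the scalars [w a], and
   [w a0 = |x k a0|^2 >= 1/n] keeps them away from 0. *)
have [a0 ha0] : exists a0, n%:R^-1 <= nsq (x k a0).
  case: (@arg_maxP _ _ _ (Ordinal n0) xpredT (fun a => nsq (x k a))) => // a0 _ hmax.
  exists a0; rewrite -(ler_pM2l nR) divff ?lt0r_neq0 // -[X in X <= _](x1 k).
  rewrite mulr_natl -[X in _ *+ X](card_ord n) -sumr_const; apply: ler_sum => a _.
  exact: hmax.
pose w a := inner (x k a) (x k a0).
have w1 a : cabs (w a) <= 1.
  apply: le_trans (cauchy_schwarz _ _) _.
  by rewrite -[X in _ <= X]mulr1 ler_pM ?nrm_ge0 ?nrm_x_le1.
have hform : \sum_a inner (v a) (x k a0) * (w a)^* =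
    \sum_a \sum_b (cf a b + (cf b a)^*) * (w b * (w a)^*) - (gam * \sum_a csq (w a))%:C.
  rewrite rmorphM rmorph_sum /= mulr_sumr -sumrB; apply: eq_bigr => a _.
  rewrite /v innerBl innerZl inner_suml mulrBl -mulrA -[inner (x k a) _]/(w a) mulcJ.
  rewrite mulr_suml; congr (_ - _); apply: eq_bigr => b _.
  by rewrite innerZl mulrA.
have hre : Re (\sum_a \sum_b (cf a b + (cf b a)^*) * (w b * (w a)^*)) <= 0.
  have := yK Klam w; rewrite -/(cf _ _).
  set Q := \sum_a \sum_b _ => hQ.
  have -> : \sum_a \sum_b (cf a b + (cf b a)^*) * (w b * (w a)^*) = Q + Q^*.
    rewrite {2}/Q conjc_sum.
    rewrite [X in _ = _ + X](eq_bigr (fun a => \sum_b (cf a b * (w b * (w a)^*))^*)); last first.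
      by move=> a _; rewrite conjc_sum.
    rewrite [X in _ = _ + X]exchange_big -big_split; apply: eq_bigr => a _.
    rewrite -big_split; apply: eq_bigr => b _ /=.
    by rewrite mulrDl !conjcM conjcK [w b * _]mulrC.
  by rewrite ReD ReJ; lra.
have hle : gam * \sum_a csq (w a) <= D * e.
  have : Re (\sum_a inner (v a) (x k a0) * (w a)^*) <= - (gam * \sum_a csq (w a)).
    by rewrite hform ReB /=; lra.
  have : - (D * e) <= Re (\sum_a inner (v a) (x k a0) * (w a)^*).
    have h1 : cabs (\sum_a inner (v a) (x k a0) * (w a)^*) <= D * e.
      apply: le_trans (cabs_sum _ _ _) _.
      rewrite /D -mulrA mulr_natl -[X in _ *+ X](card_ord n) -sumr_const; apply: ler_sum => a _.
      rewrite cabsM cabsJ -[leRHS]mulr1; apply: ler_pM; rewrite ?cabs_ge0 ?w1 //.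
      apply: le_trans (cauchy_schwarz _ _) _.
      by rewrite -[leRHS]mulr1; apply: ler_pM; rewrite ?nrm_ge0 ?nrm_x_le1.
    have := Re_le_cabs (\sum_a inner (v a) (x k a0) * (w a)^*).
    rewrite ler_norml => /andP[]; lra.
  lra.
have hge : gam * (n%:R ^+ 2)^-1 <= gam * \sum_a csq (w a).
  rewrite ler_pM2l // (bigD1 a0) //=.
  apply: le_trans (_ : csq (w a0) <= _); last by rewrite lerDl sumr_ge0 // => a _; exact: csq_ge0.
  rewrite /w inner_self csqr -exprVn lerXn2r ?nnegrE ?nsq_ge0 // invr_ge0 ltW //.
have := le_trans hge hle.
have -> : D * e = gam / n%:R ^+ 2 / 2 by rewrite /e; field; rewrite !lt0r_neq0.
have : 0 < gam / n%:R ^+ 2 by rewrite divr_gt0.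
lra.
Qed.

End NormalPencils.

Section WminPencils.
Variables (R : realType) (d : nat) (K : set 'rV[R[i]^o]_d).

Lemma cdot_deltal n (z : 'cV[R[i]]_n) a : cdot (delta_mx a 0) z = (z a 0)^*.
Proof.
rewrite /cdot (bigD1 a) //= big1 => [|b ba].
  by rewrite mxE !eqxx mul1r addr0.
by rewrite mxE (negPf ba) mul0r.
Qed.

Lemma isometry_inner (L : hilbertType R) n (V : {linear 'cV[R[i]]_n -> L}) :
  (forall x, `|V x| ^+ 2 = cdot x x) -> forall x z, inner (V x) (V z) = cdot x z.
Proof.
move=> hV x z; pose B u w := inner (V u) (V w) - cdot u w.
have B0 u : B u u = 0 by rewrite /B -sqr_normE hV subrr.
have BD u w v : B (u + w) v = B u v + B w v.
  by rewrite /B linearD innerDl cdotDl opprD addrACA.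
have BDr u w v : B v (u + w) = B v u + B v w.
  by rewrite /B linearD innerDr cdotDr opprD addrACA.
have BZ c u v : B (c *: u) v = c * B u v.
  by rewrite /B linearZ /= innerZl cdotZl mulrBr.
have BZr c u v : B v (c *: u) = c^* * B v u.
  by rewrite /B linearZ /= innerZr cdotZr mulrBr.
have h c : c^* * B x z + c * B z x = 0.
  have := B0 (x + c *: z); rewrite BD !BDr !BZ !BZr !B0.
  by rewrite !mulr0 add0r addr0.
have := h 1; have := h 'i%C; rewrite conjc1 !mul1r => h1 h2.
have hi : ('i%C : R[i])^* = - 'i%C by apply: complex_ext; rewrite /= ?oppr0.
rewrite hi mulNr addrC -mulrBr in h1.
have i0 : ('i%C : R[i]) != 0 by rewrite eq_complex /= oner_eq0 andbF.
move/eqP: h1; rewrite mulf_eq0 (negPf i0) subr_eq0 => /eqP h1.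
move: h2; rewrite h1 -mulr2n => /eqP; rewrite mulrn_eq0 /= subr_eq0 => /eqP.
by [].
Qed.

(** At the vectors [V e_a] the pencil of [N] becomes the entrywise pairing with the compression
    [X]. *)
Lemma Wmin_pencil_dominated n (X : 'I_d -> 'M[R[i]]_n.+1) :
  Wmin K (existT _ n X) -> pencil_dominated K X.
Proof.
move=> [L [N [Nn NK [V [W [hV hW hX]]]]]] q y yK.
have := normal_pencil_nonpos Nn NK yK (fun a => V (delta_mx a 0)).
congr (Re _ <= 0); apply: eq_bigr => a _; apply: eq_bigr => b _.
rewrite (isometry_inner hV) cdot_deltal !mxE eqxx andbT conjc_nat eq_sym; congr (_ + _).
apply: eq_bigr => i _; rewrite innerJ hW cdot_deltal conjcK -hX /=.
congr (_ * _).
by rewrite mxE (bigD1 b) //= big1 => [|c cb]; rewrite !mxE ?eqxx ?mulr1 ?addr0 // (negPf cb) mulr0.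
Qed.

End WminPencils.

(** * Geometry of the compact convex set *)

Section ConvexGeometry.
Variables (R : realType) (d : nat) (K : set 'rV[R[i]^o]_d).
Hypotheses (Kcompact : compact K) (Kconvex : convex_set K).
Notation vec := 'rV[R[i]^o]_d.
Implicit Types (x y : vec) (alpha : 'I_d -> R[i]).

Definition rfun alpha x : R := Re (\sum_i alpha i * x 0 i).

Lemma rfunD alpha x y : rfun alpha (x + y) = rfun alpha x + rfun alpha y.
Proof.
rewrite /rfun -ReD -big_split; congr Re; apply: eq_bigr => i _.
by rewrite mxE mulrDr.
Qed.
Lemma rfunZ alpha (t : R) x : rfun alpha (t%:C *: x) = t * rfun alpha x.
Proof.
rewrite /rfun -ReMr mulr_sumr; congr Re; apply: eq_bigr => i _.
by rewrite mxE mulrCA.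
Qed.
Lemma rfunN alpha x : rfun alpha (- x) = - rfun alpha x.
Proof.
rewrite /rfun -ReN -sumrN; congr Re; apply: eq_bigr => i _.
by rewrite mxE mulrN.
Qed.
Lemma rfunB alpha x y : rfun alpha (x - y) = rfun alpha x - rfun alpha y.
Proof. by rewrite rfunD rfunN. Qed.

Lemma rfun_Lipschitz alpha x y : 
  `|rfun alpha x - rfun alpha y| <= \sum_i cabs (alpha i) * cabs (x 0 i - y 0 i).
Proof.
rewrite -rfunB /rfun; apply: le_trans (Re_le_cabs _) _.
apply: le_trans (cabs_sum _ _ _) _; apply: ler_sum => i _.
by rewrite cabsM !mxE.
Qed.

Lemma convex_comb x y (t : R) : 0 <= t <= 1 -> K x -> K y ->
  K (t%:C *: x + (1 - t)%:C *: y).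
Proof.
case/andP=> t0 t1 Kx Ky.
have h0 : 0 <= t%:C :> R[i] by rewrite ler0c.
have h1 : t%:C <= 1 :> R[i] by rewrite -[1]/(1%:C) lecR.
have := Kconvex (interval_inference.Itv01 h0 h1) (mem_set Kx) (mem_set Ky).
by move/set_mem; rewrite rmorphB.
Qed.

Lemma compact_coord_bounded : exists2 B : R, 0 <= B &
  forall x i, K x -> cabs (x 0 i) <= B.
Proof.
have h i : exists B : R, forall x, K x -> cabs (x 0 i) <= B.
  apply: contrapT => /forallNP hB.
  have ex (n : nat) : exists x, K x /\ n%:R < cabs (x 0 i).
    have /existsNP[x /not_implyP[Kx hx]] := hB n%:R.
    by exists x; split=> //; rewrite ltNge; apply/negP.
  have [s hs] := choice ex.
  have UU := even_ultra_ultra.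
  have PU : ProperFilter even_ultra := @ultra_proper _ _ UU.
  have [nu _ hnu] := compact_ucvg Kcompact UU (fun n => (hs n).1).
  have [n [/= h1 [h2 _]]] :=
    proper_meet (ucvg_near (hnu i)) (even_ultra_eventually (Num.bound (cabs (nu 0 i) + 1))).
  have := (hs n).2; rewrite ltNge (le_trans h1) //.
  apply: ltW; apply: lt_le_trans (archi_boundP _) _; last by rewrite ler_nat.
  by rewrite addr_ge0 ?cabs_ge0.
have [B hB] := choice h.
exists (\sum_i `|B i|) => [|x i Kx]; first exact: sumr_ge0.
apply: le_trans (hB i x Kx) _; apply: le_trans (ler_norm _) _.
by rewrite (bigD1 i) //= lerDl sumr_ge0.
Qed.

Lemma compact_net (e : R) : 0 < e -> exists s : seq vec,
  (forall x, x \in s -> K x) /\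
  forall y, K y -> exists2 x, x \in s & forall i, cabs (x 0 i - y 0 i) < e.
Proof.
move=> e0; have := Kcompact; rewrite compact_cover => /(_ vec K (fun x => (ball x e%:C)°)).
case=> [x _|y Ky|D DK hD].
- exact: open_interior.
- by exists y => //; apply: nbhsx_ballx; rewrite ltcR.
exists (finmap.enum_fset D); split=> [x xD|y Ky].
  by apply: set_mem; apply: DK.
have [x /= xD xy] := hD y Ky; exists x => // i.
have := (interior_subset xy).2 0 i; rewrite -ball_normE /ball_ /= norm_cabs ltcR.
by [].
Qed.

(** Every point must be approached at arbitrarily late indices, because block [n] represents [s n]
    only up to order [eps n]. Each precision contributes a code of its own, so infinitely many
    indices give good approximations. *)
Lemma compact_dense_sequence : K !=set0 -> exists s : nat -> vec, (forall n, K (s n)) /\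
  forall y, K y -> forall (e : R) (N : nat), 0 < e ->
  exists2 n, (N <= n)%N & forall i, cabs (s n 0 i - y 0 i) < e.
Proof.
move=> [x0 Kx0].
have ex (m : nat) : exists s : seq vec, (forall x, x \in s -> K x) /\
  forall y, K y -> exists2 x, x \in s & forall i, cabs (x 0 i - y 0 i) < m.+1%:R^-1.
  by apply: compact_net; rewrite invr_gt0 ltr0n.
have [net hnet] := choice ex.
pose s n := if unpickle n is Some (m, j) then nth x0 (net m) j else x0.
exists s; split=> [n|y Ky e N e0].
  rewrite /s; case: unpickle => // -[m j]; case: (ltnP j (size (net m))) => hj.
    by apply: (hnet m).1; exact: mem_nth.
  by rewrite nth_default.
have hj m : exists j, forall i, cabs (nth x0 (net m) j 0 i - y 0 i) < m.+1%:R^-1.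
  have [x xs hx] := (hnet m).2 y Ky; exists (index x (net m)) => i.
  by rewrite nth_index.
have [j hj'] := choice hj.
pose m0 := Num.bound e^-1.
pose code k : nat := pickle (m0 + k, j (m0 + k))%N.
have code_inj : injective code.
  by move=> k k' /(pcan_inj pickleK)[] /addnI.
have [k hk] : exists k, (N <= code k)%N.
  apply: contrapT => /forallNP h.
  have : (size (map code (iota 0 N.+1)) <= size (iota 0 N))%N.
    apply: uniq_leq_size; first by rewrite map_inj_uniq ?iota_uniq.
    move=> _ /mapP[k _ ->]; rewrite mem_iota /= add0n ltnNge.
    by apply/negP; exact: h.
  by rewrite size_map !size_iota ltnn.
exists (code k) => // i; rewrite /s /code pickleK.
apply: lt_trans (hj' _ i) _.
rewrite -[e]invrK ltf_pV2 ?posrE ?invr_gt0 ?ltr0n //.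
apply: lt_le_trans (archi_boundP _) _; first by rewrite invr_ge0 ltW.
by rewrite ler_nat leqW // leq_addr.
Qed.

(* [c] plays the role of a relative interior point: it is
   [\sum_j 2^(-j-1) s_j] for a dense sequence [s]. *)
Lemma relative_interior_point : K !=set0 -> exists2 c, K c &
  forall alpha, (forall x, K x -> rfun alpha x <= rfun alpha c) ->
    forall x, K x -> rfun alpha x = rfun alpha c.
Proof.
move=> K0; have [s [Ks sdense]] := compact_dense_sequence K0.
(* [C N s] truncates the series; the remaining weight [2^-N] goes to [s N], so that it stays a
   convex combination. *)
pose C := fix C (N : nat) (s : nat -> vec) :=
  if N is N'.+1 then (2^-1)%:C *: s 0%N + (1 - 2^-1)%:C *: C N' (fun n => s n.+1)
  else s 0%N.
have KC N : forall s, (forall n, K (s n)) -> K (C N s).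
  elim: N => [|N IH] t Kt //=; apply: convex_comb => //; last by apply: IH.
  by rewrite invr_ge0 ler0n /= invf_le1 // ler1n.
have fC alpha M N : forall s, (forall n, rfun alpha (s n) <= M) ->
    rfun alpha (C N s) <= M /\
    forall j, (j < N)%N -> rfun alpha (C N s) <= M - 2^-1 ^+ j.+1 * (M - rfun alpha (s j)).
  elim: N => [|N IH] t ht; first by split=> //=.
  have [h1 h2] := IH (fun n => t n.+1) (fun n => ht n.+1).
  have e2 : 1 - 2^-1 = 2^-1 :> R by field.
  rewrite /= rfunD !rfunZ e2; split=> [|[|j] jN].
  - by have := ht 0%N; lra.
  - by rewrite expr1; lra.
  - by have := h2 j jN; have := ht 0%N; rewrite [2^-1 ^+ j.+2]exprS; lra.
have UU := even_ultra_ultra.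
have PU : ProperFilter even_ultra := @ultra_proper _ _ UU.
have [c Kc hc] := compact_ucvg Kcompact UU (fun N => KC N s Ks).
exists c => // alpha hmax x Kx; set M := rfun alpha c.
have hcf : ucvg even_ultra (fun N => \sum_i alpha i * C N s 0 i) (\sum_i alpha i * c 0 i).
  by apply: ucvg_sum => i; apply: ucvgM => //; exact: ucvg_cst.
(* Every [s j] carries a fixed positive weight in [c], so a value below the maximum [M] there would
   pull [c] below [M]. *)
have sM j : M <= rfun alpha (s j).
  have : M <= M - 2^-1 ^+ j.+1 * (M - rfun alpha (s j)).
    apply: ucvg_Re_le hcf _; apply: filterS (even_ultra_eventually j.+1) => N /= [jN _].
    have [_ h] := fC alpha M N s (fun n => hmax _ (Ks n)).
    exact: h.
  have : 0 < 2^-1 ^+ j.+1 :> R by rewrite exprn_gt0 // invr_gt0.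
  nra.
apply: le_anti; rewrite hmax //=; apply/ler_addgt0Pr => e e0.
pose A := \sum_i cabs (alpha i) + 1.
have A0 : 0 < A by rewrite ltr_wpDl // sumr_ge0 // => i _; exact: cabs_ge0.
have [n _ hn] := sdense x Kx (e / A) 0%N (divr_gt0 e0 A0).
have : `|rfun alpha (s n) - rfun alpha x| <= e.
  apply: le_trans (rfun_Lipschitz _ _ _) _.
  apply: le_trans (_ : \sum_i cabs (alpha i) * (e / A) <= _).
    by apply: ler_sum => i _; rewrite ler_wpM2l ?cabs_ge0 // ltW.
  rewrite -mulr_suml mulrA ler_pdivrMr // mulrC ler_wpM2l ?(ltW e0) //.
  by rewrite lerDl.
by rewrite ler_norml => /andP[_]; have := sM n; lra.
Qed.

(* Three extreme points are not collinear, so Gram-Schmidt applies to their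
   differences. *)
Lemma separating_functionals : `I_3 #<= extreme_points K ->
  exists e1 e2 e3 alpha1 alpha2, [/\ K e1, K e2 & K e3] /\
  [/\ rfun alpha1 (e2 - e3) = 0, rfun alpha1 (e1 - e3) = 1 & rfun alpha2 (e2 - e3) = 1].
Proof.
move=> h3.
have [f fK finj] : exists2 f : nat -> vec, set_fun `I_3 (extreme_points K) f & set_inj `I_3 f.
  by have /pcard_leP[g] := h3; exists g => //; exact: funS.
have ext n : (n < 3)%N -> extreme_points K (f n) by move=> n3; exact: fK.
have ne n m : (n < 3)%N -> (m < 3)%N -> n != m -> f n != f m.
  move=> n3 m3; apply: contra => /eqP fnm; apply/eqP; apply: finj => //;
  by rewrite inE.
pose e1 := f 0%N; pose e2 := f 1%N; pose e3 := f 2%N.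
pose w := e2 - e3; pose u := e1 - e3.
pose ip (x y : vec) := rfun (fun i => (y 0 i)^*) x.
have ipp x : ip x x = \sum_i csq (x 0 i).
  by rewrite /ip /rfun Re_sum; apply: eq_bigr => i _; rewrite mulrC mulcJ.
have ip_gt0 x : x != 0 -> 0 < ip x x.
  move=> x0; rewrite lt_def ipp sumr_ge0 ?andbT; last by move=> i _; exact: csq_ge0.
  apply: contra x0 => /eqP h; apply/eqP/rowP => i; rewrite mxE.
  have : csq (x 0 i) <= 0.
    by rewrite -h (bigD1 i) //= lerDl sumr_ge0 // => j _; exact: csq_ge0.
  by move=> hi; apply/eqP; rewrite -csq_eq0 eq_le hi csq_ge0.
have w0 : w != 0 by rewrite subr_eq0; exact: ne.
have rfunZa (t : R) alpha x : rfun (fun i => t%:C * alpha i) x = t * rfun alpha x.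
  rewrite /rfun -ReMr mulr_sumr; congr Re; apply: eq_bigr => i _; by rewrite mulrA.
pose t := ip u w / ip w w.
pose u' := u - t%:C *: w.
have wu' : ip w u' = 0.
  have ipC x y : ip x y = ip y x.
    rewrite /ip /rfun -[LHS]ReJ conjc_sum; congr Re; apply: eq_bigr => i _.
    by rewrite conjcM conjcK mulrC.
  rewrite ipC /ip rfunB rfunZ -/(ip u w) -/(ip w w) /t divfK ?subrr //.
  by rewrite lt0r_neq0 // ip_gt0.
have between (x y z : vec) (r : R) : 0 < r < 1 -> extreme_points K x -> K y -> K z ->
    x = r%:C *: y + (1 - r)%:C *: z -> y = z.
  by move=> r01 [Kx hx] Ky Kz xe; have [-> ->] := hx y z r Ky Kz r01 xe.
have [E1 E2 E3] : [/\ extreme_points K e1, extreme_points K e2 & extreme_points K e3].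
  by split; exact: ext.
have [K1 K2 K3] : [/\ K e1, K e2 & K e3] by split; [case: E1|case: E2|case: E3].
have u'0 : u' != 0.
  apply/eqP => /eqP; rewrite subr_eq0 => /eqP utw.
  have e1E : e1 = t%:C *: e2 + (1 - t)%:C *: e3.
    rewrite rmorphB scalerBl scale1r addrCA -scalerBr -/w -utw /u addrC subrK.
    by [].
  (* On a common line one of the three points would lie between the other two, or two would
     coincide; the position of [t] relative to 0 and 1 tells which. *)
  have [t0|t0|t0] := ltgtP t 0.
  - (* [e3] lies between [e1] and [e2] *)
    have s0 : 0 < 1 - t by lra.
    have : e3 = ((1 - t)^-1)%:C *: e1 + (1 - (1 - t)^-1)%:C *: e2.
      rewrite e1E scalerDr !scalerA -!rmorphM addrAC -scalerDl -rmorphD.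
      rewrite mulVf ?lt0r_neq0 // scale1r.
      have -> : (1 - t)^-1 * t + (1 - (1 - t)^-1) = 0 by field; exact: lt0r_neq0.
      by rewrite scale0r add0r.
    move/between => h; have := ne 0%N 1%N isT isT isT; rewrite -/e1 -/e2 => /eqP; apply.
    apply: h => //; rewrite invr_gt0 s0 /= invf_lt1 //; lra.
  - have [t1|t1|t1] := ltgtP t 1.
    + move: e1E => /between h; have := ne 1%N 2%N isT isT isT; rewrite -/e2 -/e3 => /eqP; apply.
      by apply: h => //; rewrite t0 t1.
    + (* [e2] lies between [e1] and [e3] *)
      have : e2 = (t^-1)%:C *: e1 + (1 - t^-1)%:C *: e3.
        rewrite e1E scalerDr !scalerA -!rmorphM -addrA -scalerDl -rmorphD.
        rewrite mulVf ?lt0r_neq0 // scale1r.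
        have -> : t^-1 * (1 - t) + (1 - t^-1) = 0 by field; exact: lt0r_neq0.
        by rewrite scale0r addr0.
      move/between => h; have := ne 0%N 2%N isT isT isT; rewrite -/e1 -/e3 => /eqP; apply.
      by apply: h => //; rewrite invr_gt0 t0 /= invf_lt1.
    + have := ne 0%N 1%N isT isT isT; rewrite -/e1 -/e2 e1E t1 subrr scale1r scale0r addr0.
      by rewrite eqxx.
  - have := ne 0%N 2%N isT isT isT; rewrite -/e1 -/e3 e1E t0 subr0 scale0r add0r scale1r.
    by rewrite eqxx.
have p1 := ip_gt0 _ u'0; have p2 := ip_gt0 _ w0.
exists e1, e2, e3, (fun i => ((ip u' u')^-1)%:C * (u' 0 i)^*), (fun i => ((ip w w)^-1)%:C * (w 0 i)^*).
have iuu : ip u u' = ip u' u' + t * ip w u'.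
  by rewrite /ip -rfunZ -rfunD /u' subrK.
split=> //; split; rewrite rfunZa.
- by rewrite -[rfun _ _]/(ip w u') wu' mulr0.
- by rewrite -[rfun _ _]/(ip u u') iuu wu' mulr0 addr0 mulVf // lt0r_neq0.
- by rewrite -[rfun _ _]/(ip w w) mulVf // lt0r_neq0.
Qed.

End ConvexGeometry.

(** * The block model *)

Section WeightedSums.
Variables (R : realType) (d m : nat).
Variables (q : 'I_m -> 'I_m -> R[i]) (y : 'I_d -> 'I_m -> 'I_m -> R[i]).
Implicit Types g h : 'I_m -> 'I_m -> option 'I_d -> R[i].

(** Being linear in [g], this pairing reduces identities between pencils to identities of
    coordinates. *)
Definition wsum g : R[i] :=
  \sum_a \sum_b (q a b * g a b None + \sum_i y i a b * g a b (Some i)).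

Lemma eq_wsum g h : (forall a b o, g a b o = h a b o) -> wsum g = wsum h.
Proof.
move=> e; apply: eq_bigr => a _; apply: eq_bigr => b _; rewrite e; congr (_ + _).
by apply: eq_bigr => i _; rewrite e.
Qed.

Lemma wsumD g h : wsum (fun a b o => g a b o + h a b o) = wsum g + wsum h.
Proof.
rewrite /wsum -big_split; apply: eq_bigr => a _ /=; rewrite -big_split; apply: eq_bigr => b _ /=.
rewrite mulrDr addrACA -big_split; congr (_ + _); apply: eq_bigr => i _ /=.
by rewrite mulrDr.
Qed.

Lemma wsumZ c g : wsum (fun a b o => c * g a b o) = c * wsum g.
Proof.
rewrite /wsum mulr_sumr; apply: eq_bigr => a _; rewrite mulr_sumr; apply: eq_bigr => b _.
by rewrite mulrDr mulr_sumr mulrCA; congr (_ + _); apply: eq_bigr => i _; rewrite mulrCA.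
Qed.

Lemma wsum0 g : (forall a b o, g a b o = 0) -> wsum g = 0.
Proof.
move=> e; rewrite /wsum big1 // => a _; rewrite big1 // => b _.
by rewrite e mulr0 add0r big1 // => i _; rewrite e mulr0.
Qed.

Lemma wsum_ucvg (U : set_system nat) {FU : ProperFilter U}
    (g : nat -> 'I_m -> 'I_m -> option 'I_d -> R[i]) h :
  (forall a b o, ucvg U (fun N => g N a b o) (h a b o)) ->
  ucvg U (fun N => wsum (g N)) (wsum h).
Proof.
move=> gh; apply: ucvg_sum => a; apply: ucvg_sum => b; apply: ucvgD.
  by apply: ucvgM; [exact: ucvg_cst|exact: gh].
by apply: ucvg_sum => i; apply: ucvgM; [exact: ucvg_cst|exact: gh].
Qed.

Lemma wsum_sum N (g : nat -> 'I_m -> 'I_m -> option 'I_d -> R[i]) :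
  wsum (fun a b o => \sum_(k < N) g k a b o) = \sum_(k < N) wsum (g k).
Proof.
elim: N => [|N IH]; first by rewrite big_ord0 wsum0 // => a b o; rewrite big_ord0.
rewrite big_ord_recr /= -IH -wsumD; apply: eq_wsum => a b o.
by rewrite big_ord_recr.
Qed.

Definition wpoint (mu : 'rV[R[i]^o]_d) (w : 'I_m -> R[i]) : R[i] :=
  \sum_a \sum_b (q a b + \sum_i y i a b * mu 0 i) * (w b * (w a)^*).

Lemma wpointE mu w :
  wpoint mu w = wsum (fun a b o => homog mu o * (w b * (w a)^*)).
Proof.
apply: eq_bigr => a _; apply: eq_bigr => b _ /=.
rewrite mul1r mulrDl mulr_suml; congr (_ + _); apply: eq_bigr => i _.
by rewrite -mulrA.
Qed.

End WeightedSums.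

Section BlockModel.
Variables (R : realType) (d : nat) (K : set 'rV[R[i]^o]_d).
Notation vec := 'rV[R[i]^o]_d.
Variables (e1 e2 e3 c : vec) (s : nat -> vec) (alpha1 : 'I_d -> R[i]) (G : R).
Hypotheses (Kcompact : compact K) (G0 : 0 <= G).

(** Besides separating the blocks, the factor 4 gives [eps n <= 1/4], which keeps [1 - 2 eps n] at
    least 1/2. *)
Definition eps (n : nat) : R := (4 * (G + 1))^-1 ^+ n.+1.
(** [alpha1] will differ by 1 between [e1] and [e3], so its value at one of them is at distance at
    least 1/2 from its value at [s n]. *)
Definition side n : vec :=
  if 2^-1 <= `|rfun alpha1 (s n) - rfun alpha1 e1| then e1 else e3.
Definition point k : vec := if odd k then side k./2 else s k./2.
(** [e2 P_+ + e3 P_-] has diagonal [(e2 + e3) / 2], which enters here, and off-diagonal entry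
    [(e2 - e3) / 2], which enters [ocoef]. *)
Definition drift : vec := (2^-1)%:C *: (e2 + e3) + c.
Definition dcoef k : vec :=
  (1 - 2 * eps k./2)%:C *: point k + (eps k./2)%:C *: drift.
Definition ocoef k : vec := (eps k./2 / 2)%:C *: (e2 - e3).

Lemma eps_gt0 n : 0 < eps n.
Proof. by rewrite exprn_gt0 // invr_gt0 mulr_gt0 // ltr_wpDl. Qed.

Lemma epsS n : 4 * (G + 1) * eps n.+1 = eps n.
Proof.
rewrite /eps [_ ^+ n.+2]exprS mulrA mulfV ?mul1r // lt0r_neq0 //.
by rewrite mulr_gt0 // ltr_wpDl.
Qed.

Lemma eps_le n : eps n <= 4^-1.
Proof.
have h : (4 * (G + 1))^-1 <= 4^-1.
  by rewrite lef_pV2 ?posrE ?mulr_gt0 ?ltr_wpDl //; have := G0; lra.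
elim: n => [|n IH]; first by rewrite /eps expr1.
have := epsS n; have := eps_gt0 n.+1; have := G0; nra.
Qed.

Lemma eps_lt m n : (m < n)%N -> 4 * (G + 1) * eps n <= eps m.
Proof.
elim: n => // n IH; rewrite ltnS leq_eqVlt => /orP[/eqP->|mn]; first by rewrite epsS.
apply: le_trans (IH mn); rewrite epsS.
have := eps_gt0 n; have := G0; nra.
Qed.

Lemma eps_small (e : R) : 0 < e -> exists N, forall n, (N <= n)%N -> eps n < e.
Proof.
move=> e0; have hn n : n.+1%:R * eps n <= 1.
  elim: n => [|n IH]; first by have := eps_le 0; rewrite mul1r; lra.
  have := epsS n; have := eps_gt0 n.+1; have := G0 => g0 h1 h2.
  have h3 : eps n.+1 <= eps n / 4.
    by rewrite -h2 ler_pdivlMr // mulrC -mulrA ler_wpM2l //; nra.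
  have h4 : 1 <= n.+1%:R :> R by rewrite ler1n.
  rewrite -natr1 mulrDl mul1r.
  have h5 : n.+1%:R * eps n.+1 <= n.+1%:R * (eps n / 4) by rewrite ler_wpM2l.
  have h6 := eps_le n.+1; rewrite mulrA in h5.
  move: IH h5 h6; set t := _ * eps n; set t' := _ * eps n.+1; lra.
exists (Num.bound e^-1) => n Nn.
have h : e^-1 < n.+1%:R.
  apply: lt_le_trans (archi_boundP _) _; first by rewrite invr_ge0 ltW.
  by rewrite ler_nat leqW.
rewrite ltNge; apply/negP => he.
have : 1 < n.+1%:R * e by rewrite -ltr_pdivrMr // mul1r.
have := ler_wpM2l (ler0n R n.+1) he; have := hn n; lra.
Qed.

Hypotheses (Ke1 : K e1) (Ke2 : K e2) (Ke3 : K e3) (Kc : K c) (Ks : forall n, K (s n)).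

Lemma Kside n : K (side n). Proof. by rewrite /side; case: ifP. Qed.
Lemma Kpoint k : K (point k). Proof. by rewrite /point; case: ifP => // _; exact: Kside. Qed.

Lemma coef_bounded : exists B : R,
  forall i k, csq (dcoef k 0 i) <= B /\ csq (ocoef k 0 i) <= B.
Proof.
have [B B0 hB] := compact_coord_bounded Kcompact.
pose S (v : vec) := \sum_i csq (v 0 i).
have hS (v : vec) i : csq (v 0 i) <= S v.
  by rewrite /S (bigD1 i) //= lerDl sumr_ge0 // => j _; exact: csq_ge0.
have S0 (v : vec) : 0 <= S v by apply: sumr_ge0 => j _; exact: csq_ge0.
exists (2 * B ^+ 2 + 2 * S drift + S (e2 - e3)) => i k.
have e0 := eps_gt0 k./2; have e4 := eps_le k./2.
have eM (t u : R) : 0 <= t <= 1 -> 0 <= u -> t ^+ 2 * u <= u.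
  move=> /andP[t0 t1] u0; rewrite -[leRHS]mul1r ler_wpM2r // expr_le1 //.
have hp : csq (point k 0 i) <= B ^+ 2.
  by rewrite -sqr_cabs lerXn2r ?nnegrE ?cabs_ge0 // hB //; exact: Kpoint.
split.
  have -> : dcoef k 0 i = (1 - 2 * eps k./2)%:C * point k 0 i + (eps k./2)%:C * drift 0 i.
    by rewrite /dcoef; move: (point k) drift => p t; rewrite !mxE.
  apply: le_trans (csqD_le _ _) _; rewrite !csqM !csqr.
  have h1 := eM (1 - 2 * eps k./2) _ _ (csq_ge0 (point k 0 i)).
  have h2 := eM (eps k./2) _ _ (csq_ge0 (drift 0 i)).
  have h4 := h1 ltac:(lra); have h5 := h2 ltac:(lra).
  have := hS drift i; have := S0 (e2 - e3); lra.
have -> : ocoef k 0 i = (eps k./2 / 2)%:C * (e2 - e3) 0 i.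
  by rewrite /ocoef; move: (e2 - e3) => p; rewrite !mxE.
rewrite csqM csqr.
have := eM (eps k./2 / 2) _ _ (csq_ge0 ((e2 - e3) 0 i)); have := hS (e2 - e3) i.
have := S0 drift; have := sqr_ge0 B => h1 h2 h3 h4.
by have := h4 ltac:(lra); lra.
Qed.

Let B := projT1 (cid coef_bounded).
Let dbound i k : csq (dcoef k 0 i) <= B.
Proof. by rewrite /B; case: cid => B' h; case: (h i k). Qed.
Let obound i k : csq (ocoef k 0 i) <= B.
Proof. by rewrite /B; case: cid => B' h; case: (h i k). Qed.

Definition model i : 'B(ell2 R) := blkop (dbound i) (obound i).

Lemma modelE i x k : model i x k = dcoef k 0 i * x k + ocoef k 0 i * x (flip k).
Proof. by []. Qed.

Lemma adj_modelE i x k :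
  adj (model i) x k = (dcoef k 0 i)^* * x k + (ocoef k 0 i)^* * x (flip k).
Proof. by rewrite adj_blkopE /ocoef flip_half. Qed.

Section Pencil.
Variables (m : nat) (q : 'I_m -> 'I_m -> R[i]) (y : 'I_d -> 'I_m -> 'I_m -> R[i]).
Implicit Types xi : 'I_m -> ell2 R.

Definition mterm xi (k : nat) (a b : 'I_m) (o : option 'I_d) : R[i] :=
  (homog (dcoef k) o * xi b k
   + (if o is Some i then ocoef k 0 i else 0) * xi b (flip k)) * (xi a k)^*.

Definition block_value xi n : R[i] :=
  wsum q y (mterm xi n.*2) + wsum q y (mterm xi n.*2.+1).

(** Each block averages scalar forms at points of [K]: [e2] and [e3] act on [u + v] and [u - v],
    whose rank-one forms are twice those of [P_+] and [P_-]; hence the weight [eps n / 2]. *)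
Lemma block_valueE xi n (u := fun b => xi b n.*2) (v := fun b => xi b n.*2.+1) :
  block_value xi n = (1 - 2 * eps n)%:C * (wpoint q y (s n) u + wpoint q y (side n) v)
    + (eps n / 2)%:C * (wpoint q y e2 (fun b => u b + v b)
                        + wpoint q y e3 (fun b => u b - v b))
    + (eps n)%:C * (wpoint q y c u + wpoint q y c v).
Proof.
have E1 : (1 - 2 * eps n)%:C = 1 - 2 * (eps n)%:C by rewrite rmorphB rmorphM rmorph_nat.
have E3 : (2^-1)%:C = 2^-1 :> R[i] by rewrite fmorphV rmorph_nat.
have E2 : (eps n / 2)%:C = (eps n)%:C / 2 by rewrite rmorphM /= E3.
rewrite /block_value !wpointE -!(wsumD, wsumZ); apply: eq_wsum => a b o.
rewrite /mterm flip_double flip_doubleS -/(u b) -/(u a) -/(v b) -/(v a).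
case: o => [i|] /=; rewrite /dcoef /ocoef /point /drift /= ?odd_double ?doubleK ?uphalf_double ?mxE.
  by rewrite !(conjcD, conjcN) E1 E2 E3; field.
by rewrite !(conjcD, conjcN) E1 E2; field.
Qed.

Lemma model_pencil_cvg xi :
  ucvg even_ultra (fun N => \sum_(k < N) wsum q y (mterm xi k)) (pencil model q y xi).
Proof.
have h : ucvg even_ultra (fun N => wsum q y (fun a b o => \sum_(k < N) mterm xi k a b o))
   (wsum q y (fun a b o => if o is Some i then inner (model i (xi b)) (xi a)
                           else inner (xi b) (xi a))).
  apply: wsum_ucvg => a b [i|].
    apply: (ucvg_ext _ (ell2_cvg (model i (xi b)) (xi a))).
    by apply: filterE => N; apply: eq_bigr => k _; congr (_ * _).
  apply: (ucvg_ext _ (ell2_cvg (xi b) (xi a))); apply: filterE => N /=; apply: eq_bigr => k _.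
  by rewrite /mterm mul1r mul0r addr0.
apply: ucvg_ext h; apply: filterE => N /=.
exact: wsum_sum.
Qed.

Lemma sum_blocks xi M :
  \sum_(k < M.*2) wsum q y (mterm xi k) = \sum_(n < M) block_value xi n.
Proof.
elim: M => [|M IH]; first by rewrite !big_ord0.
by rewrite doubleS !big_ord_recr /= IH -addrA.
Qed.

Definition block_cut n0 xi xi' := forall a k,
  xi' a k = if k./2 == n0 then 0 else xi a k.

(** The pencil is additive over blocks, since no coefficient couples two of them. *)
Lemma block_cut_pencil n0 xi xi' : block_cut n0 xi xi' ->
  pencil model q y xi' = pencil model q y xi - block_value xi n0.
Proof.
move=> cut; apply: (ucvg_uniq (model_pencil_cvg xi')).
apply: ucvg_ext (ucvgB (model_pencil_cvg xi) (ucvg_cst (block_value xi n0))).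
(* For even [N] beyond [2 n0 + 1] the partial sum splits no block and contains block [n0]. *)
apply: filterS (even_ultra_eventually n0.*2.+2) => N /= [hN evN].
have -> : N = N./2.*2 by rewrite -[LHS]odd_double_half (negPf evN).
rewrite !sum_blocks.
have n0N : (n0 < N./2)%N by lia.
have half1 n : n.*2./2 = n by rewrite doubleK.
have half2 n : n.*2.+1./2 = n by rewrite /= uphalf_double.
rewrite (bigD1 (Ordinal n0N)) //= [RHS](bigD1 (Ordinal n0N)) //=.
rewrite addrC addrK [X in _ = X + _](_ : _ = 0) ?add0r.
  apply: eq_bigr => n nn0.
  have nE : ((n : nat) == n0) = false by apply/negbTE; move: nn0; rewrite -val_eqE.
  by congr (_ + _); apply: eq_wsum => a b o;
    rewrite /mterm !cut !flip_half ?half1 ?half2 nE.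
by rewrite /block_value !wsum0 ?addr0 // => a b o;
  rewrite /mterm !cut ?half1 ?half2 eqxx conjc0 mulr0.
Qed.

Hypothesis yK : forall mu, K mu -> forall w, Re (wpoint q y mu w) <= 0.

(** All terms of [block_valueE] are nonpositive. The one at [c] is kept, because it measures how far
    the block stays from a face. *)
Lemma block_value_le xi n : Re (block_value xi n) <=
  eps n * (Re (wpoint q y c (fun b => xi b n.*2)) + Re (wpoint q y c (fun b => xi b n.*2.+1))).
Proof.
rewrite block_valueE !ReD !ReMr !ReD.
have e0 := eps_gt0 n; have e4 := eps_le n.
set u := fun b => xi b _; set v := fun b => xi b _.
have h1 := yK (Ks n) u; have h2 := yK (Kside n) v.
have h3 := yK Ke2 (fun b => u b + v b); have h4 := yK Ke3 (fun b => u b - v b).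
have k1 : (1 - 2 * eps n) * (Re (wpoint q y (s n) u) + Re (wpoint q y (side n) v)) <= 0.
  by rewrite mulr_ge0_le0 //; lra.
have k2 : eps n / 2 * (Re (wpoint q y e2 (fun b => u b + v b)) +
    Re (wpoint q y e3 (fun b => u b - v b))) <= 0.
  by rewrite mulr_ge0_le0 ?divr_ge0 ?(ltW e0) //; lra.
lra.
Qed.

Lemma block_value_le0 xi n : Re (block_value xi n) <= 0.
Proof.
apply: le_trans (block_value_le xi n) _.
rewrite mulr_ge0_le0 ?(ltW (eps_gt0 n)) //.
by have := yK Kc (fun b => xi b n.*2); have := yK Kc (fun b => xi b n.*2.+1); lra.
Qed.

(** Since no block value is positive, each single one bounds the sum from above. *)
Lemma model_pencil_le xi n : Re (pencil model q y xi) <= Re (block_value xi n).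
Proof.
apply: ucvg_Re_le (model_pencil_cvg xi) _.
apply: filterS (even_ultra_eventually n.*2.+2) => N /= [hN evN].
have -> : N = N./2.*2 by rewrite -[LHS]odd_double_half (negPf evN).
have nN : (n < N./2)%N by lia.
rewrite sum_blocks Re_sum (bigD1 (Ordinal nN)) //= gerDl.
by rewrite -oppr_ge0 -sumrN; apply: sumr_ge0 => j _; rewrite oppr_ge0 block_value_le0.
Qed.

Lemma model_pencil_le0 xi : Re (pencil model q y xi) <= 0.
Proof. exact: le_trans (model_pencil_le xi 0) (block_value_le0 xi 0). Qed.

End Pencil.

Hypothesis sdense : forall y, K y -> forall (e : R) (N : nat), 0 < e ->
  exists2 n, (N <= n)%N & forall i, cabs (s n 0 i - y 0 i) < e.

Lemma nsq_ell2_basis k : nsq (ell2_basis R k) = 1.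
Proof. by rewrite /nsq inner_ell2_basis ell2_basisE eqxx. Qed.

Lemma model_basis i k : inner (model i (ell2_basis R k)) (ell2_basis R k) = dcoef k 0 i.
Proof.
rewrite inner_ell2_basis modelE !ell2_basisE eqxx (negPf (flip_neq k)).
by rewrite mulr1 mulr0 addr0.
Qed.

Lemma model_supports : supports_range model K.
Proof.
move=> alpha mu e Kmu e0.
pose A := \sum_i cabs (alpha i) + 1.
have A0 : 0 < A by rewrite ltr_wpDl // sumr_ge0 // => i _; exact: cabs_ge0.
have e2' : 0 < e / 2 by rewrite divr_gt0.
pose D := `|rfun alpha drift| + 2 * `|rfun alpha mu| + e + 1.
have D0 : 0 < D by rewrite /D; have := normr_ge0 (rfun alpha drift); have := normr_ge0 (rfun alpha mu); lra.
have [N hN] := eps_small (divr_gt0 e2' D0).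
have [n Nn hn] := sdense Kmu N (divr_gt0 e2' A0).
(* The even basis vector of block [n] sees [s n] up to an error of order [eps n], and [D] bounds the
   factor of [eps n]. *)
exists (ell2_basis R n.*2); first exact: nsq_ell2_basis.
under [X in _ <= Re X]eq_bigr do rewrite model_basis.
rewrite -/(rfun alpha mu) -/(rfun alpha (dcoef n.*2)).
rewrite /dcoef /point odd_double doubleK rfunD !rfunZ.
have h1 : `|rfun alpha (s n) - rfun alpha mu| <= e / 2.
  apply: le_trans (rfun_Lipschitz _ _ _) _.
  apply: le_trans (_ : \sum_i cabs (alpha i) * (e / 2 / A) <= _).
    by apply: ler_sum => i _; rewrite ler_wpM2l ?cabs_ge0 // ltW.
  rewrite -mulr_suml mulrA ler_pdivrMr // mulrC ler_wpM2l ?(ltW e2') //.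
  by rewrite lerDl.
have h2 := hN n Nn; rewrite ltr_pdivlMr // in h2.
have e3' := eps_gt0 n.
move: h1; rewrite ler_norml => /andP[h3 h4].
have h5 : eps n * (2 * rfun alpha (s n) - rfun alpha drift) <= eps n * D.
  rewrite ler_wpM2l ?(ltW e3') // /D.
  have := ler_norm (rfun alpha mu); have := ler_norm (- rfun alpha drift); rewrite normrN.
  have := normr_ge0 (rfun alpha mu); lra.
lra.
Qed.

End BlockModel.

(** * Reducing subspaces *)

Section SubspaceOperations.
Variables (R : realType) (d : nat) (H : hilbertType R) (T : 'I_d -> 'B(H)).
Variables (M : closedSubspace H) (redTM : reducing T M).

Lemma reducing_adj i x : csub_set M x -> csub_set M (adj (T i) x).
Proof.
move=> Mx; apply: orthogonal_complementK => y My.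
by rewrite adjl innerJ ((redTM i).2 y My x Mx) conjc0.
Qed.

Lemma reducing_adj_orthogonal i x :
  orthogonal_complement M x -> orthogonal_complement M (adj (T i) x).
Proof. by move=> Mx y My; rewrite adjl Mx //; exact: (redTM i).1. Qed.

Lemma val_adj_restr i (x : subspace_type M) : val (adj (restr redTM i) x) = adj (T i) (val x).
Proof.
have Mx : csub_set M (val x) by case: x => x /= /asboolP.
have Ax : adj (T i) (val x) \in csub_pred M by apply/asboolP; exact: reducing_adj.
suff -> : adj (restr redTM i) x = Subsp Ax by [].
apply: inner_ext => z; rewrite adjl.
by rewrite -[LHS]/(inner (val x) (T i (val z))) -adjl.
Qed.

(** Twice the real part of the operator [\sum_i alpha_i S_i]. *)
Definition real_part (S : 'I_d -> 'B(H)) (alpha : 'I_d -> R[i]) x : H :=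
  \sum_i (alpha i *: S i x + (alpha i)^* *: adj (S i) x).

Lemma real_part_linear S alpha : linear (real_part S alpha).
Proof.
move=> a x y; rewrite /real_part scaler_sumr -big_split; apply: eq_bigr => i _ /=.
rewrite !bop_linear !scalerDr !scalerA addrACA.
by rewrite [alpha i * a]mulrC [(alpha i)^* * a]mulrC.
Qed.

Lemma real_part_stable alpha (P : set H) :
  P 0 -> (forall (a : R[i]) x y, P x -> P y -> P (a *: x + y)) ->
  (forall i x, P x -> P (T i x)) -> (forall i x, P x -> P (adj (T i) x)) ->
  forall x, P x -> P (real_part T alpha x).
Proof.
move=> P0 PP PT PA x Px; rewrite /real_part; apply: (big_rec P) => // i y _ Py.
by rewrite -addrA; apply: (PP); [exact: PT|apply: PP => //; exact: PA].
Qed.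

End SubspaceOperations.

(** Fuglede's theorem makes the adjoints commute as well; the model is designed to violate this
    identity. *)
Lemma normal_real_part_comm (R : realType) (d : nat) (H : hilbertType R)
    (N : 'I_d -> 'B(H)) (alpha beta : 'I_d -> R[i]) x : normal_tuple N ->
  real_part N alpha (real_part N beta x) = real_part N beta (real_part N alpha x).
Proof.
move=> Nn.
have key (S : 'B(H)) (gamma : 'I_d -> R[i]) : (forall i, commuting S (N i)) ->
    (forall i, commuting S (adj (N i))) -> forall z,
    S (real_part N gamma z) = real_part N gamma (S z).
  move=> h1 h2 z; rewrite /real_part.
  elim/big_ind2: _ => [|u u' w w' <- <-|i _]; rewrite ?bop0 ?bopD ?bopZ //.
  by rewrite h1 h2.
have kN i z : N i (real_part N beta z) = real_part N beta (N i z).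
  by apply: key => j; [exact: normal_commN|exact: normal_comm_adj].
have kA i z : adj (N i) (real_part N beta z) = real_part N beta (adj (N i) z).
  by apply: key => j; [exact/commuting_sym/normal_comm_adj|exact: normal_adj_adj].
rewrite {1}/real_part; under eq_bigr do rewrite kN kA.
have L := real_part_linear N beta.
have L0 : real_part N beta 0 = 0.
  by have := L (-1) 0 0; rewrite scaler0 addr0 scaleN1r addNr.
have LZ a u : real_part N beta (a *: u) = a *: real_part N beta u.
  by have := L a u 0; rewrite !addr0 L0 addr0.
have LD u v : real_part N beta (u + v) = real_part N beta u + real_part N beta v.
  by have := L 1 u v; rewrite !scale1r.
rewrite [real_part N alpha x]/real_part (big_morph _ LD L0); apply: eq_bigr => i _.
by rewrite LD !LZ.
Qed.

Section ReducingBlocks.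
Variables (R : realType) (d : nat) (A : 'I_d -> 'B(ell2 R)).
Variables (dco oco : nat -> 'rV[R[i]^o]_d) (alpha1 alpha2 : 'I_d -> R[i]).
Hypotheses (AE : forall i x k, A i x k = dco k 0 i * x k + oco k 0 i * x (flip k))
  (adjAE : forall i x k,
     adj (A i) x k = (dco k 0 i)^* * x k + (oco k 0 i)^* * x (flip k)).
Let beta k := rfun alpha2 (oco k).
Let delta k := rfun alpha1 (dco k) - rfun alpha1 (dco (flip k)).
Hypotheses (oco0 : forall k, rfun alpha1 (oco k) = 0)
  (oco_flip : forall k, oco (flip k) = oco k)
  (beta_neq0 : forall k, beta k != 0)
  (delta_neq0 : forall k, delta k != 0)
  (sep : forall j k, (beta j * delta j) ^+ 2 = (beta k * delta k) ^+ 2 -> j./2 = k./2).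

Lemma real_partE alpha x k : real_part A alpha x k =
  (2 * rfun alpha (dco k))%:C * x k + (2 * rfun alpha (oco k))%:C * x (flip k).
Proof.
have h (v : 'rV[R[i]^o]_d) (z : R[i]) : (2 * rfun alpha v)%:C * z =
    \sum_i (alpha i * (v 0 i * z) + (alpha i)^* * ((v 0 i)^* * z)).
  rewrite /rfun Re_sum mulr_sumr (big_morph _ (raddfD (real_complex R)) (rmorph0 (real_complex R))).
  rewrite mulr_suml; apply: eq_bigr => i _.
  rewrite !mulrA -conjcM -mulrDl; congr (_ * _); apply: complex_ext.
    by rewrite ReD ReJ /= mulr2n mulrDl !mul1r.
  by rewrite ImD ImJ /= subrr.
rewrite !h -big_split /real_part /=.
elim/big_ind2: _ => // [u a w b <- <-//|i _].
rewrite ell2D !ell2Z AE adjAE !mulrDr addrACA; congr (_ + _).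
Qed.

Let C x := real_part A alpha1 (real_part A alpha2 x) - real_part A alpha2 (real_part A alpha1 x).

(** One real part is diagonal, so the commutator only swaps the two entries of each block. As
    [delta] changes sign under [flip], its square is diagonal and constant on blocks. *)
Lemma commutatorE x k : C x k = (4 * (beta k * delta k))%:C * x (flip k).
Proof.
rewrite /C ell2B !real_partE oco0 oco_flip flipK !oco0 mulr0 -/(beta k) /delta.
rewrite !(rmorphM, rmorphB) /= rmorph0 !mul0r !addr0 ; ring.
Qed.


Section Subspace.
Variables (M : closedSubspace (ell2 R)) (redAM : reducing A M).

Let real_part_in alpha x : csub_set M x -> csub_set M (real_part A alpha x).
Proof.
apply: real_part_stable; [exact: csub0|exact: csubP| |exact: reducing_adj].
by move=> i z; exact: (redAM i).1.
Qed.

Let real_part_orthogonal alpha x :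
  orthogonal_complement M x -> orthogonal_complement M (real_part A alpha x).
Proof.
apply: real_part_stable.
- by move=> y _; rewrite inner0l.
- by move=> a u v hu hv y My; rewrite innerDl innerZl hu ?hv // mulr0 addr0.
- by move=> i z; exact: (redAM i).2.
- exact: reducing_adj_orthogonal.
Qed.

(** [F p - f j *: p] lies in [M]. Since [ell2_basis R j] is an eigenvector, it is also minus the
    same expression for [ell2_basis R j - p], which lies in the orthogonal complement. So it
    vanishes, and [p] is supported where [f] equals [f j]. *)
Let eigenvector_projection (F : ell2 R -> ell2 R) (f : nat -> R[i]) j p :
  (forall x k, F x k = f k * x k) ->
  (forall x, csub_set M x -> csub_set M (F x)) ->
  (forall x, orthogonal_complement M x -> orthogonal_complement M (F x)) ->
  csub_set M p -> orthogonal_complement M (ell2_basis R j - p) ->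
  forall k, f k != f j -> p k = 0.
Proof.
move=> FE FM FMo Mp Mop k fkj.
pose r := F p - f j *: p.
have Mr : csub_set M r.
  by rewrite /r addrC -scaleNr; apply: csubP => //; exact: FM.
have rE : r = - (F (ell2_basis R j - p) - f j *: (ell2_basis R j - p)).
  have alg (a b z : R[i]) (t : bool) : (t -> a = b) ->
      a * z - b * z = - (a * (t%:R - z) - b * (t%:R - z)).
    case: t => [/(_ isT) ->|_]; first by rewrite !subrr oppr0.
    by rewrite !sub0r !mulrN opprB opprK addrC.
  apply: ell2_ext => n; rewrite ell2N !(ell2B, ell2Z, FE) ell2_basisE.
  by apply: alg => /eqP ->.
have Mor : orthogonal_complement M r.
  move=> y My; rewrite rE -scaleN1r innerZl innerBl innerZl (FMo _ Mop) // Mop //.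
  by rewrite mulr0 subrr mulr0.
have r0 : r = 0 by apply/eqP; rewrite -nsq_eq0 /nsq Mor.
have := congr1 (fun x : ell2 R => x k) r0.
rewrite /r ell2B ell2Z FE ell20 -mulrBl => /eqP; rewrite mulf_eq0 subr_eq0 (negPf fkj).
by move/eqP.
Qed.

(** The squared commutator confines the projection [p] of the basis vector to its block, and the
    diagonal real part for [alpha1] confines it to [j]. So [p] is a multiple of the basis vector. *)
Lemma basis_in_or_orthogonal j :
  csub_set M (ell2_basis R j) \/ orthogonal_complement M (ell2_basis R j).
Proof.
have [p Mp Mop] := exists_projection M (ell2_basis R j).
have two : 2 != 0 :> R by rewrite pnatr_eq0.
have four : 4 != 0 :> R by rewrite pnatr_eq0.
have Re_inj (a b : R) : a%:C = b%:C -> a = b by move=> /(congr1 (@complex.Re R)).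
have CM x : csub_set M x -> csub_set M (C x).
  move=> Mx; rewrite /C addrC -scaleN1r; apply: csubP; by do 2 apply: real_part_in.
have CMo x : orthogonal_complement M x -> orthogonal_complement M (C x).
  move=> Mx y My; rewrite /C innerBl.
  by rewrite !(real_part_orthogonal _ (real_part_orthogonal _ Mx)) // subrr.
have delta_flip k : delta (flip k) = - delta k by rewrite /delta flipK opprB.
have beta_flip k : beta (flip k) = beta k by rewrite /beta oco_flip.
have CCE x k : C (C x) k = (- 16 * (beta k * delta k) ^+ 2)%:C * x k.
  rewrite !commutatorE flipK delta_flip beta_flip mulrA -rmorphM; congr (_%:C * _); ring.
have p_half k : k./2 != j./2 -> p k = 0.
  move=> kj; apply: (eigenvector_projection CCE _ _ Mp Mop) => [x Mx|x Mx|].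
  - exact: (CM _ (CM _ Mx)).
  - exact: (CMo _ (CMo _ Mx)).
  apply: contra kj => /eqP/Re_inj h; apply/eqP/sep.
  by apply: (mulfI _ h); rewrite oppr_eq0 pnatr_eq0.
have D1 x k : real_part A alpha1 x k = (2 * rfun alpha1 (dco k))%:C * x k.
  by rewrite real_partE oco0 mulr0 mul0r addr0.
have p_flip : p (flip j) = 0.
  apply: (eigenvector_projection D1 _ _ Mp Mop) => [x|x|].
  - exact: real_part_in.
  - exact: real_part_orthogonal.
  apply: contra (delta_neq0 j) => /eqP/Re_inj/(mulfI two) h.
  by rewrite /delta h subrr.
have pE : p = p j *: ell2_basis R j.
  apply: ell2_ext => k; rewrite ell2Z ell2_basisE.
  have [->|kj] := eqVneq k j; first by rewrite mulr1.
  have [h|h] := eqVneq k./2 j./2; last by rewrite p_half // mulr0.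
  by move/eqP: h; rewrite half_eq (negPf kj) /= => /eqP ->; rewrite p_flip mulr0.
have [pj0|pj0] := eqVneq (p j) 0.
  by right; move: Mop; rewrite pE pj0 scale0r subr0.
left; have -> : ell2_basis R j = (p j)^-1 *: p + 0.
  by rewrite addr0 [X in _ *: X]pE scalerA mulVf // scale1r.
by apply: csubP => //; exact: csub0.
Qed.

(** The real part for [alpha2] mixes the two basis vectors of a block with the nonzero coefficient
    [2 * beta j]. *)
Lemma basis_flip_in j : csub_set M (ell2_basis R j) -> csub_set M (ell2_basis R (flip j)).
Proof.
move=> Mj; have -> : ell2_basis R (flip j) = (2 * beta j)%:C^-1 *:
    (- (2 * rfun alpha2 (dco j))%:C *: ell2_basis R j
     + real_part A alpha2 (ell2_basis R j)) + 0.
  have b0 : (2 * beta j)%:C != 0 :> R[i].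
    by rewrite (fmorph_eq0 (real_complex R)) mulf_neq0 // pnatr_eq0.
  apply: ell2_ext => k; rewrite !(ell2D, ell2Z, ell20) real_partE !ell2_basisE addr0.
  have -> : (k == flip j) = (flip k == j) by rewrite -(inv_eq flipK).
  have [->|kj] := eqVneq k j.
    rewrite (negPf (flip_neq j)) !mulr1 !mulr0 addr0 addNr mulr0 //.
  have [fk|fk] := eqVneq (flip k) j; last by rewrite !mulr0 !addr0 mulr0.
  have -> : rfun alpha2 (oco k) = beta j by rewrite /beta -fk oco_flip.
  by rewrite !mulr0 !add0r !mulr1 mulVf.
apply: csubP; last exact: csub0.
by apply: csubP => //; exact: real_part_in.
Qed.

Hypothesis M0 : (M : set (ell2 R)) != [set 0].

Lemma exists_basis_in : exists j, csub_set M (ell2_basis R j).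
Proof.
have [x Mx x0] : exists2 x, csub_set M x & x != 0.
  apply: contrapT => h; move/eqP: M0; apply; apply/seteqP; split=> [x Mx|_ ->].
    by apply: contrapT => /eqP x0; apply: h; exists x.
  exact: csub0.
have [j xj] : exists j, x j != 0.
  apply: contrapT => h; move/eqP: x0; apply; apply: ell2_ext => k; rewrite ell20.
  by apply/eqP; apply: contrapT => /negP xk; apply: h; exists k.
exists j; have [//|Mo] := basis_in_or_orthogonal j.
by move/eqP: (Mo x Mx); rewrite inner_basis_ell2 conjc_eq0 (negPf xj).
Qed.

Lemma restr_not_normal : ~ normal_tuple (restr redAM).
Proof.
move=> Nn; have [j Mj] := exists_basis_in.
have ej : ell2_basis R j \in csub_pred M by apply/asboolP.
have h alpha (z : subspace_type M) :
    val (real_part (restr redAM) alpha z) = real_part A alpha (val z).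
  rewrite /real_part raddf_sum; apply: eq_bigr => i _.
  by rewrite raddfD -val_adj_restr.
have := congr1 val (normal_real_part_comm alpha1 alpha2 (Subsp ej) Nn).
rewrite !h => /eqP; rewrite -subr_eq0 => /eqP/(congr1 (fun x : ell2 R => x (flip j))).
rewrite commutatorE flipK ell20 ell2_basisE eqxx mulr1 => /eqP.
by rewrite (fmorph_eq0 (real_complex R)) !mulf_eq0 pnatr_eq0 (negPf (beta_neq0 _)) (negPf (delta_neq0 _)).
Qed.

End Subspace.
End ReducingBlocks.

(** * Support functions and matrix ranges *)

Section SupportFunctions.
Variables (R : realType) (d : nat) (K : set 'rV[R[i]^o]_d).
Variables (H : hilbertType R) (T : 'I_d -> 'B(H)).

Lemma supports_rangeP :
  (forall alpha mu (e : R), K mu -> 0 < e -> exists2 x, x != 0 &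
    (rfun alpha mu - e) * nsq x <= Re (\sum_i alpha i * inner (T i x) x)) ->
  supports_range T K.
Proof.
move=> h alpha mu e Kmu e0; have [x x0 hx] := h alpha mu e Kmu e0.
have nx : 0 < nsq x by rewrite nsq_gt0.
pose t : R := (Num.sqrt (nsq x))^-1.
have tt : t ^+ 2 = (nsq x)^-1 by rewrite exprVn sqr_sqrtr // ltW.
exists (t%:C *: x); first by rewrite nsqZ csqr tt mulVf // lt0r_neq0.
have -> : \sum_i alpha i * inner (T i (t%:C *: x)) (t%:C *: x) =
    (t ^+ 2)%:C * \sum_i alpha i * inner (T i x) x.
  rewrite mulr_sumr; apply: eq_bigr => i _.
  by rewrite bopZ innerZl innerZr conjc_real rmorphXn /= expr2; ring.
by rewrite ReMr tt mulrC ler_pdivlMr.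
Qed.

(** All levels follow from the first: [X] decomposes over points of [K], and each of them is the
    value of a state at [T]. *)
Lemma Wmin_sub_range : compact K -> K !=set0 -> supports_range T K ->
  Wmin K `<=` matrix_range T.
Proof.
move=> Kc K0 Tsup [n X] /Wmin_pencil_dominated/(pencil_dominated_decomposition Kc K0).
by move=> [m [mu [v [h1 h2 h3]]]]; exact: matrix_range_of_decomposition h1 h2 h3.
Qed.

Lemma scalar_pencil alpha (r : R) (xi : 'I_1 -> H) :
  Re (pencil T (fun _ _ => r%:C) (fun i _ _ => alpha i) xi) =
  r * nsq (xi 0) + Re (\sum_i alpha i * inner (T i (xi 0)) (xi 0)).
Proof. by rewrite /pencil !big_ord1 ReD ReMr. Qed.

(** A point [mu] of [K] is a 1x1 member of [Wmin K], so a unital completely positive map sends [T]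
    to [mu] and carries the scalar pencil [alpha(T) - r] along. *)
Lemma support_of_matrix_range alpha (r : R) : compact K -> K !=set0 ->
  Wmin K `<=` matrix_range T ->
  (forall x, Re (\sum_i alpha i * inner (T i x) x) <= r * nsq x) ->
  forall mu, K mu -> rfun alpha mu <= r.
Proof.
move=> Kc K0 WT hr mu Kmu.
have /WT[psi upsi hpsi] : Wmin K (existT _ 0%N (fun i => (mu 0 i)%:M)).
  apply: Wmin_of_pencils => // q y yK.
  have := yK mu Kmu (fun _ => 1); rewrite !big_ord1 eqxx conjc1 !mulr1.
  by congr (Re (_ + _) <= 0); apply: eq_bigr => i _; rewrite mxE eqxx mulr1n.
have := @ucp_pencil _ _ _ _ T psi upsi (fun _ _ => (- r)%:C) (fun i _ _ => alpha i).
have h0 (xi : 'I_1 -> H) : Re (pencil T (fun _ _ => (- r)%:C) (fun i _ _ => alpha i) xi) <= 0.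
  by rewrite scalar_pencil mulNr addrC subr_le0.
move=> /(_ h0); rewrite !big_ord1 eqxx mulr1 ReD /=.
under [X in Re X]eq_bigr => i _ do rewrite -hpsi /= !mxE eqxx mulr1n.
by rewrite -/(rfun alpha mu) addrC subr_le0.
Qed.

End SupportFunctions.

Lemma rfun_bounded (R : realType) (d : nat) (K : set 'rV[R[i]^o]_d) alpha :
  compact K -> exists2 G : R, 0 <= G &
    forall x y, K x -> K y -> `|rfun alpha x - rfun alpha y| <= G.
Proof.
move=> Kc; have [B B0 hB] := compact_coord_bounded Kc.
exists (\sum_i cabs (alpha i) * (B + B)) => [|x y Kx Ky].
  by apply: sumr_ge0 => i _; rewrite mulr_ge0 ?cabs_ge0 ?addr_ge0.
apply: le_trans (rfun_Lipschitz _ _ _) _; apply: ler_sum => i _.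
rewrite ler_wpM2l ?cabs_ge0 //; apply: le_trans (_ : cabs (x 0 i) + cabs (y 0 i) <= _).
  by rewrite -[X in _ <= _ + X]cabsN; exact: cabsD.
by rewrite lerD // hB.
Qed.

(** * Removal of a block *)

Section RealArithmetic.
Variable R : realType.
Implicit Types a b p t : R.

Lemma sqrM_eq_norm a b a' b' : (a * b) ^+ 2 = (a' * b') ^+ 2 ->
  `|a| * `|b| = `|a'| * `|b'|.
Proof. by move=> /(congr1 Num.sqrt); rewrite !sqrtr_sqr !normrM. Qed.

(** The ratio [4 (G + 1)] between the weights beats the ratio [t / t'], which is at most [4 G]. *)
Lemma weight_lt (G : R) p p' t t' : 0 <= G -> 0 < p -> 4 * (G + 1) * p <= p' ->
  t <= G -> 4^-1 <= t' -> p / 2 * t < p' / 2 * t'.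
Proof.
move=> G0 p0 pp tG t4.
have p'0 : 0 < p' by apply: lt_le_trans pp; rewrite !mulr_gt0 // ltr_wpDl.
have h1 : p / 2 * t <= p / 2 * G by rewrite ler_wpM2l // divr_ge0 // ltW.
have h2 : p' / 2 * 4^-1 <= p' / 2 * t' by rewrite ler_wpM2l // divr_ge0 // ltW.
lra.
Qed.

End RealArithmetic.

Lemma cabs_ell2 (R : realType) (x : ell2 R) k : cabs (x k) <= nrm x.
Proof. by rewrite -lecR -norm_nrm ell2_normE lecR ler_wsqrtr // csq_ell2. Qed.

Lemma nrm_val (R : realType) (H : hilbertType R) (M : closedSubspace H) (x : subspace_type M) :
  nrm x = nrm (val x).
Proof. by []. Qed.

Section FinalModel.
Variables (R : realType) (d : nat) (K : set 'rV[R[i]^o]_d).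
Notation vec := 'rV[R[i]^o]_d.
Variables (e1 e2 e3 c : vec) (s : nat -> vec) (alpha1 alpha2 : 'I_d -> R[i]) (G : R).
Hypotheses (Kcompact : compact K) (G0 : 0 <= G).
Hypotheses (Ke1 : K e1) (Ke2 : K e2) (Ke3 : K e3) (Kc : K c) (Ks : forall n, K (s n)).
Hypotheses (sdense : forall y, K y -> forall (e : R) (N : nat), 0 < e ->
  exists2 n, (N <= n)%N & forall i, cabs (s n 0 i - y 0 i) < e).
Hypotheses (f23 : rfun alpha1 (e2 - e3) = 0) (f13 : rfun alpha1 (e1 - e3) = 1)
  (g23 : rfun alpha2 (e2 - e3) = 1).
Hypothesis GK : forall x y, K x -> K y -> `|rfun alpha1 x - rfun alpha1 y| <= G.
Hypothesis cmax : forall alpha, (forall x, K x -> rfun alpha x <= rfun alpha c) ->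
  forall x, K x -> rfun alpha x = rfun alpha c.

Let K0 : K !=set0. Proof. by exists c. Qed.
Let A := model e2 c alpha1 Kcompact G0 Ke1 Ke3 Ks.
Let dco := dcoef e1 e2 e3 c s alpha1 G.
Let oco := ocoef e2 e3 G.
Let ep := eps G.

Lemma model_matrix_range : matrix_range A = Wmin K.
Proof.
apply/seteqP; split; last first.
  by apply: Wmin_sub_range => //; exact: model_supports.
move=> [n X] [psi upsi hX]; apply: Wmin_of_pencils => // q y yK.
have := ucp_pencil upsi (model_pencil_le0 alpha1 Kcompact G0 Ke1 Ke2 Ke3 Kc Ks yK).
congr (Re _ <= 0); apply: eq_bigr => a _; apply: eq_bigr => b _; congr (_ + _).
by apply: eq_bigr => i _; rewrite -hX.
Qed.

Let beta k := rfun alpha2 (oco k).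
Let delta k := rfun alpha1 (dco k) - rfun alpha1 (dco (flip k)).

Let betaE k : beta k = ep k./2 / 2.
Proof. by rewrite /beta /oco /ocoef rfunZ g23 mulr1. Qed.

Let oco0 k : rfun alpha1 (oco k) = 0.
Proof. by rewrite /oco /ocoef rfunZ f23 mulr0. Qed.

Let oco_flip k : oco (flip k) = oco k.
Proof. by rewrite /oco /ocoef flip_half. Qed.

Lemma side_gap n : 2^-1 <= `|rfun alpha1 (s n) - rfun alpha1 (side e1 e3 s alpha1 n)|.
Proof.
rewrite /side; case: ifP => // /negbT; rewrite -ltNge; move: f13; rewrite rfunB.
rewrite ltr_norml => h1 /andP[h2 h3]; apply: le_trans (ler_norm _); lra.
Qed.

Let deltaE k : `|delta k| = (1 - 2 * ep k./2) *
  `|rfun alpha1 (s k./2) - rfun alpha1 (side e1 e3 s alpha1 k./2)|.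
Proof.
have e4 := eps_le G0 k./2.
rewrite /delta /dco /dcoef !rfunD !rfunZ flip_half.
set p := rfun _ (point _ _ _ _ _); set p' := rfun _ (point _ _ _ _ _).
have -> : (1 - 2 * eps G k./2) * p + eps G k./2 * rfun alpha1 (drift e2 e3 c) -
    ((1 - 2 * eps G k./2) * p' + eps G k./2 * rfun alpha1 (drift e2 e3 c)) =
    (1 - 2 * ep k./2) * (p - p') by rewrite /ep; ring.
rewrite normrM ger0_norm; last by rewrite /ep; lra.
congr (_ * _); rewrite /p /p' /point flip_half.
have -> : odd (flip k) = ~~ odd k by rewrite /flip; case: ifP => //; case: (k) => //= n; case: (odd n).
by case: (odd k) => //=; rewrite distrC.
Qed.

Let delta_ge k : 4^-1 <= `|delta k|.
Proof.
rewrite deltaE; have := side_gap k./2; have := eps_le G0 k./2; rewrite -/(ep _).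
set t := `|_| => h1 h2.
have : 2^-1 * 2^-1 <= (1 - 2 * ep k./2) * t by rewrite ler_pM ?invr_ge0 //; lra.
lra.
Qed.

Let delta_le k : `|delta k| <= G.
Proof.
rewrite deltaE; have := eps_gt0 G0 k./2; have := eps_le G0 k./2; rewrite -/(ep _).
have := GK (Ks k./2) (Kside s alpha1 Ke1 Ke3 k./2).
have := normr_ge0 (rfun alpha1 (s k./2) - rfun alpha1 (side e1 e3 s alpha1 k./2)).
set t := `|_|; nra.
Qed.

Let beta_neq0 k : beta k != 0.
Proof. by rewrite betaE lt0r_neq0 // divr_gt0 // eps_gt0. Qed.

Let delta_neq0 k : delta k != 0.
Proof. by rewrite -normr_gt0; have := delta_ge k; lra. Qed.

Let beta_delta_lt j k : (j./2 < k./2)%N ->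
  ep k./2 / 2 * `|delta k| < ep j./2 / 2 * `|delta j|.
Proof.
move=> jk; apply: weight_lt G0 _ (eps_lt G0 jk) (delta_le k) (delta_ge j).
exact: eps_gt0.
Qed.

Let sep j k : (beta j * delta j) ^+ 2 = (beta k * delta k) ^+ 2 -> j./2 = k./2.
Proof.
have hb i : `|beta i| = ep i./2 / 2.
  by rewrite betaE ger0_norm // divr_ge0 // ltW // eps_gt0.
move=> /sqrM_eq_norm; rewrite !hb => h.
by have [jk|kj|//] := ltngtP j./2 k./2;
  [have := beta_delta_lt jk|have := beta_delta_lt kj]; rewrite h ltxx.
Qed.

Let AE i x k : A i x k = dco k 0 i * x k + oco k 0 i * x (flip k).
Proof. exact: modelE. Qed.

Let adjAE i x k : adj (A i) x k = (dco k 0 i)^* * x k + (oco k 0 i)^* * x (flip k).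
Proof. exact: adj_modelE. Qed.

Lemma model_not_normal (M : closedSubspace (ell2 R)) (redAM : reducing A M) :
  (M : set (ell2 R)) != [set 0] -> ~ normal_tuple (restr redAM).
Proof. exact: (restr_not_normal AE adjAE oco0 oco_flip beta_neq0 delta_neq0 sep). Qed.

Section Removal.
Variables (M : closedSubspace (ell2 R)) (redAM : reducing A M).
Hypothesis rangeM : matrix_range (restr redAM) = matrix_range A.

Let WM : Wmin K `<=` matrix_range (restr redAM).
Proof. by rewrite rangeM model_matrix_range. Qed.

Let form alpha (x : ell2 R) := Re (\sum_i alpha i * inner (A i x) x).

(** Otherwise [r - eta] would bound the form on [M], and thus [alpha] on [K]. *)
Let exists_near_sup alpha (r eta : R) : 0 < eta ->
  (exists2 mu, K mu & r - eta < rfun alpha mu) ->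
  exists2 x, csub_set M x & (r - eta) * nsq x < form alpha x.
Proof.
move=> eta0 [mu Kmu hmu]; apply: contrapT => h.
suff : rfun alpha mu <= r - eta by lra.
apply: (support_of_matrix_range Kcompact K0 WM) Kmu => z.
have Mz : csub_set M (val z) by case: z => z /= /asboolP.
by rewrite leNgt; apply/negP => hz; apply: h; exists (val z).
Qed.

Lemma reducing_nontrivial : (M : set (ell2 R)) != [set 0].
Proof.
apply/eqP => M0.
have [x] := @exists_near_sup alpha1 (rfun alpha1 c) 1 ltr01 ltac:(exists c => //; lra).
by rewrite M0 => /= ->; rewrite nsq0 mulr0 /form big1 ?ltxx // => i _; rewrite inner0r mulr0.
Qed.

Variable n0 : nat.
Hypotheses (Mn0 : csub_set M (ell2_basis R n0.*2)) (Mn1 : csub_set M (ell2_basis R n0.*2.+1)).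

Let cut (x : ell2 R) : ell2 R :=
  (- x n0.*2) *: ell2_basis R n0.*2 + ((- x n0.*2.+1) *: ell2_basis R n0.*2.+1 + x).

Let cutE x k : cut x k = if k./2 == n0 then 0 else x k.
Proof.
rewrite !(ell2D, ell2Z) !ell2_basisE.
have [->|k0] := eqVneq k n0.*2.
  rewrite doubleK eqxx (_ : (_ == _.+1) = false) ?mulr0 ?mulr1 ?add0r ?addNr //; lia.
have [->|k1] := eqVneq k n0.*2.+1.
  by rewrite /= uphalf_double eqxx mulr0 add0r mulr1 addNr.
by rewrite !mulr0 !add0r ifF //; apply/negbTE; lia.
Qed.

Let cut_in x : csub_set M x -> csub_set M (cut x).
Proof. by move=> Mx; apply: csubP => //; exact: csubP. Qed.

Let nsq_cut x : nsq x = nsq (cut x) + csq (x n0.*2) + csq (x n0.*2.+1).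
Proof.
have h k : k./2 = n0 -> inner (cut x) (ell2_basis R k) = 0.
  by move=> kn; rewrite inner_ell2_basis cutE kn eqxx.
have h0 := h n0.*2 (doubleK n0); have h1 := h n0.*2.+1 (uphalf_double n0).
have xE : x = cut x + (x n0.*2 *: ell2_basis R n0.*2 + x n0.*2.+1 *: ell2_basis R n0.*2.+1).
  by rewrite /cut !scaleNr addrACA addNr add0r addrAC addNr add0r.
move: (cut x) h0 h1 xE => w h0 h1 xE.
rewrite {1}xE nsqD [nsq (_ + _)]nsqD !nsqZ !nsq_ell2_basis !mulr1 /rip.
rewrite innerDr !innerZr !innerZl h0 h1 inner_ell2_basis ell2_basisE.
rewrite (_ : (_ == _) = false); last by apply/negbTE; lia.
by rewrite /= !mulr0 !addr0 [complex.Re 0]/(0 : R) !mulr0 !addr0 addrA.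
Qed.

(** A vector of [M] that nearly attains the supremum [r] of [alpha] has little mass in block [n0],
    which its [eps_n c] term keeps away from [r]. Cutting this mass off does not increase the
    deficit with respect to [r], since the block value is nonpositive. *)
Let removal alpha mu (e : R) : K mu -> 0 < e ->
  (exists2 x, K x & rfun alpha c < rfun alpha x) ->
  exists x, [/\ csub_set M x, forall k, k./2 = n0 -> x k = 0, x != 0 &
                (rfun alpha mu - e) * nsq x <= form alpha x].
Proof.
move=> Kmu e0 [x0 Kx0 hx0].
pose E : set R := [set rfun alpha x | x in K].
have Esup : has_sup E.
  split; first by exists (rfun alpha c), c.
  have [B _ hB] := rfun_bounded alpha Kcompact.
  exists (rfun alpha c + B) => _ [x Kx <-].
  by have := hB x c Kx Kc; rewrite ler_norml => /andP[_]; lra.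
pose r := sup E.
have Er (x : vec) : K x -> rfun alpha x <= r.
  by move=> Kx; apply: ub_le_sup; [exact: Esup.2|exists x].
have gap : 0 < r - rfun alpha c by have := Er x0 Kx0; lra.
have eg0 : 0 < ep n0 * (r - rfun alpha c) by rewrite mulr_gt0 // eps_gt0.
(* The second bound forces at least half of the mass out of the block; the first one then lets [e]
   absorb the lost half. *)
pose eta := Num.min e (ep n0 * (r - rfun alpha c)) / 2.
have eta0 : 0 < eta by rewrite divr_gt0 // lt_min e0.
have [eta1 eta2] : eta <= e / 2 /\ eta <= ep n0 * (r - rfun alpha c) / 2.
  by split; rewrite ler_pM2r ?invr_gt0 // ge_min lexx ?orbT.
have [x Mx hx] : exists2 x, csub_set M x & (r - eta) * nsq x < form alpha x.
  apply: exists_near_sup => //.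
  by have [_ [mu' Kmu' <-] h] := sup_adherent eta0 Esup; exists mu'.
pose q (_ _ : 'I_1) : R[i] := (- r)%:C.
pose y i (_ _ : 'I_1) := alpha i.
have wE (mu' : vec) (w : 'I_1 -> R[i]) : Re (wpoint q y mu' w) = (rfun alpha mu' - r) * csq (w 0).
  by rewrite /wpoint !big_ord1 mulcJ mulrC ReMr ReD mulrC addrC.
have yK (mu' : vec) : K mu' -> forall w, Re (wpoint q y mu' w) <= 0.
  by move=> Kmu' w; rewrite wE mulr_le0_ge0 ?csq_ge0 // subr_le0 Er.
have pE (z : ell2 R) : Re (pencil A q y (fun _ => z)) = form alpha z - r * nsq z.
  by rewrite scalar_pencil mulNr addrC.
have cutP : block_cut n0 (fun _ : 'I_1 => x) (fun _ => cut x) by move=> a k; exact: cutE.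
have h1 := model_pencil_le alpha1 Kcompact G0 Ke1 Ke2 Ke3 Kc Ks yK (fun _ => x) n0.
have h2 := block_value_le c alpha1 G0 Ke1 Ke2 Ke3 Ks yK (fun _ => x) n0.
have h3 := block_value_le0 alpha1 G0 Ke1 Ke2 Ke3 Kc Ks yK (fun _ => x) n0.
have := congr1 (@complex.Re R) (block_cut_pencil e2 c alpha1 Kcompact G0 Ke1 Ke3 Ks q y cutP).
rewrite ReB !pE => h4.
rewrite pE in h1; rewrite !wE in h2.
have nx := nsq_cut x; set t := csq _ in nx h2; set t' := csq _ in nx h2.
have tt : 0 <= t + t' by rewrite addr_ge0 ?csq_ge0.
have x_gt0 : 0 < nsq x.
  rewrite nsq_gt0; apply: contraTN hx => /eqP ->.
  by rewrite nsq0 mulr0 /form big1 ?ltxx // => i _; rewrite inner0r mulr0.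
(* The block costs at least [ep n0 * (r - rfun alpha c)] per unit of mass, while the total deficit
   is below [eta * nsq x]. *)
have small : t + t' <= nsq x / 2.
  have k1 : ep n0 * (r - rfun alpha c) * (t + t') < eta * nsq x by rewrite /ep; lra.
  have k2 : eta * nsq x <= ep n0 * (r - rfun alpha c) / 2 * nsq x by rewrite ler_wpM2r // ltW.
  rewrite -(ler_pM2l eg0); lra.
exists (cut x); split.
- exact: cut_in.
- by move=> k kn; rewrite cutE kn eqxx.
- by rewrite -nsq_gt0; lra.
have k3 : (rfun alpha mu - e) * nsq (cut x) <= (r - e) * nsq (cut x).
  by rewrite ler_wpM2r ?nsq_ge0 // lerD2r Er.
have k4 : eta * nsq x <= e / 2 * nsq x by rewrite ler_wpM2r // ltW.
have k5 : e / 2 * nsq x <= e * nsq (cut x).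
  by rewrite mulrAC mulrC -subr_ge0; have := ltW e0; nra.
lra.
Qed.

(** Without a gap at [c], [alpha] is constant on [K] by [cmax]. The form is then at least this
    constant on every vector, and any nonzero vector of [M] outside block [n0] will do; [alpha1],
    which is not constant, supplies one. *)
Let removal_all alpha mu (e : R) : K mu -> 0 < e ->
  exists x, [/\ csub_set M x, forall k, k./2 = n0 -> x k = 0, x != 0 &
                (rfun alpha mu - e) * nsq x <= form alpha x].
Proof.
move=> Kmu e0; have [h|h] := pselect (exists2 x, K x & rfun alpha c < rfun alpha x).
  exact: removal.
have ac (x : vec) : K x -> rfun alpha x = rfun alpha c.
  by apply: cmax => z Kz; rewrite leNgt; apply/negP => hz; apply: h; exists z.
have [z [Mz z0 zn _]] : exists x, [/\ csub_set M x, forall k, k./2 = n0 -> x k = 0, x != 0 &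
                (rfun alpha1 c - 1) * nsq x <= form alpha1 x].
  apply: removal => //; apply: contrapT => h'.
  have a1 (x : vec) : K x -> rfun alpha1 x = rfun alpha1 c.
    by apply: cmax => w Kw; rewrite leNgt; apply/negP => hw; apply: h'; exists w.
  by move: f13; rewrite rfunB !a1 // subrr => /eqP; rewrite eq_sym oner_eq0.
exists z; split=> //.
(* The pencil of the constant minus [alpha] vanishes on [K]; its nonpositivity at the model is the
   lower bound on the form. *)
pose q (_ _ : 'I_1) : R[i] := (rfun alpha c)%:C.
pose y i (_ _ : 'I_1) := - alpha i.
have aN (v : vec) : rfun (fun i => - alpha i) v = - rfun alpha v.
  by rewrite /rfun -ReN -sumrN; congr Re; apply: eq_bigr => i _; rewrite mulNr.
have yK (mu' : vec) : K mu' -> forall w, Re (wpoint q y mu' w) <= 0.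
  move=> Kmu' w; rewrite /wpoint !big_ord1 mulcJ mulrC ReMr ReD mulrC /=.
  by rewrite -/(rfun (fun i => - alpha i) mu') aN ac // subrr mul0r.
have := model_pencil_le0 alpha1 Kcompact G0 Ke1 Ke2 Ke3 Kc Ks yK (fun _ => z).
rewrite -/A (scalar_pencil A (fun i => - alpha i)) => h1.
have h2 : Re (\sum_i - alpha i * inner (A i z) z) = - form alpha z.
  by rewrite /form -ReN -sumrN; congr Re; apply: eq_bigr => i _; rewrite mulNr.
rewrite h2 in h1; rewrite ac // mulrBl.
have : 0 <= e * nsq z by rewrite mulr_ge0 ?nsq_ge0 // ltW.
lra.
Qed.

Definition block_removed : set (subspace_type M) :=
  [set z | forall k, k./2 = n0 -> (val z : ell2 R) k = 0].

Fact block_removed_closed : closed block_removed.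
Proof.
apply: closed_of_limits => z hz k kn; apply/eqP; rewrite -cabs_eq0 eq_le cabs_ge0 andbT.
apply/ler_addgt0Pr => e e0; rewrite add0r; have [w hw zw] := hz e e0.
rewrite nrm_val subspace_valB in zw.
apply: le_trans (ltW zw).
by apply: le_trans (cabs_ell2 _ k); rewrite ell2B hw // subr0.
Qed.

Fact block_removed0 : block_removed 0. Proof. by []. Qed.

Fact block_removedP (a : R[i]) x y :
  block_removed x -> block_removed y -> block_removed (a *: x + y).
Proof.
by move=> hx hy k kn; rewrite subspace_valP ell2D ell2Z hx // hy // mulr0 addr0.
Qed.

Definition block_removed_csub :=
  ClosedSubspace block_removed0 block_removedP block_removed_closed.

Lemma block_removed_reducing : reducing (restr redAM) block_removed_csub.
Proof.
have stab (x : ell2 R) : (forall k, k./2 = n0 -> x k = 0) -> forall i k, k./2 = n0 ->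
    A i x k = 0 /\ adj (A i) x k = 0.
  by move=> hx i k kn; rewrite AE adjAE !hx ?flip_half // !mulr0 addr0.
move=> i; split=> [x hx k kn|x hx y hy].
  by have [] := stab (val x) hx i k kn.
rewrite -[LHS]/(inner _ _) (adjP (restr redAM i)); apply: hx => k kn.
by rewrite val_adj_restr; have [] := stab (val y) hy i k kn.
Qed.

(** The basis vector [2 n0] of [M] shows that the subspace is proper, and the vectors of
    [removal_all] restore the support function of [K] on it. *)
Lemma removed_not_minimal : ~ minimal (restr redAM).
Proof.
move=> /(_ block_removed_csub block_removed_reducing); case.
  apply/eqP => /seteqP[_ /(_ (Subsp (introT (asboolP _) Mn0 : _ \in csub_pred M)) I)].
  move=> h; have : ell2_basis R n0.*2 n0.*2 = 0 := h n0.*2 (doubleK n0).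
  rewrite ell2_basisE eqxx => /eqP.
  by rewrite oner_eq0.
move=> _; apply; rewrite rangeM model_matrix_range.
apply: Wmin_sub_range => //; apply: supports_rangeP => alpha mu e Kmu e0.
have [x [Mx xn x0 hx]] := removal_all alpha Kmu e0.
have x1 : x \in csub_pred M by apply/asboolP.
have x2 : Subsp x1 \in csub_pred block_removed_csub by apply/asboolP.
by exists (Subsp x2).
Qed.

End Removal.

Lemma model_not_minimal (M : closedSubspace (ell2 R)) (redAM : reducing A M) :
  matrix_range (restr redAM) = matrix_range A -> ~ minimal (restr redAM).
Proof.
move=> rangeM.
have [j Mj] := exists_basis_in AE adjAE oco0 oco_flip delta_neq0 sep redAM
  (reducing_nontrivial rangeM).
have Mfj := basis_flip_in AE adjAE oco_flip beta_neq0 redAM Mj.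
(* [j] and [flip j] are the two indices of block [j./2], in an order that depends on the parity of
   [j]. *)
have [M0 M1] : csub_set M (ell2_basis R j./2.*2) /\ csub_set M (ell2_basis R j./2.*2.+1).
  have := odd_double_half j; case: (boolP (odd j)) => oj jE.
    rewrite add1n in jE; rewrite jE; split=> //.
    by move: Mfj; rewrite -{1}jE flip_doubleS.
  rewrite add0n in jE; rewrite {1}jE; split=> //.
  by move: Mfj; rewrite -{1}jE flip_double.
exact: (removed_not_minimal rangeM M0 M1).
Qed.

End FinalModel.

Theorem theorem3p29 (R : realType) (d : nat) (K : set 'rV[R[i]^o]_d)
    (Kcompact : compact K) (Kconvex : convex_set K)
    (Kext : `I_3 #<= extreme_points K) :
  exists (H : hilbertType R) (A : 'I_d -> 'B(H)),
    [/\ matrix_range A = Wmin K,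
        (forall (M : closedSubspace H) (redAM : reducing A M),
           (M : set H) != [set 0] -> ~ normal_tuple (restr redAM)) &
        (forall (M : closedSubspace H) (redAM : reducing A M),
           matrix_range (restr redAM) = matrix_range A ->
           ~ minimal (restr redAM))].
Proof.
have [e1 [e2 [e3 [alpha1 [alpha2 [[Ke1 Ke2 Ke3] [f23 f13 g23]]]]]]] :=
  separating_functionals Kext.
have K0 : K !=set0 by exists e1.
have [s [Ks sdense]] := compact_dense_sequence Kcompact K0.
have [c Kc cmax] := relative_interior_point Kcompact Kconvex K0.
have [G G0 GK] := rfun_bounded alpha1 Kcompact.
exists (ell2 R), (model e2 c alpha1 Kcompact G0 Ke1 Ke3 Ks); split.
- by apply: model_matrix_range; assumption.
- by move=> M redAM; apply: model_not_normal; eassumption.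
- by move=> M redAM; apply: model_not_minimal; eassumption.
Qed.
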